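(* Let $n\ge 1$ and $h\ge 0$ be integers. Let $B$ be the matrix of the bilinear form $G$ on $\mathcal{S}(I\times I,n,h)$ with respect to the basis $\mathcal{B}_n^h=\{B_{a_1,\dots,a_n}\}$, and let $S$ be the semi-meander matrix defined in the context. Then $$\det(S)=\left(\frac{\Delta_1^h}{\Delta_h}\right)^{|\mathcal{D}_n^h|}\det(B)=\Delta_1^{h|\mathcal{D}_n^h|}\prod_{k\ge 1}\left(\frac{\Delta_k}{\Delta_{k-1}}\right)^{\alpha^k_{(n,h)}},$$ where $$\alpha^k_{(n,h)}=\binom{n}{\frac{n+h+2k-2s}{2}}-\binom{n}{\frac{n+h+2k+2}{2}},\qquad s=\min\{k-1,h\}.$$
   Context: Let $A$ be a variable and let $\Lambda$ be $\mathbb{Z}[A,A^{-1}]$ localized by inverting the multiplicative set generated by $\{A^m-1\mid m\in\mathbb{Z}^+\}$. Put $I=[0,1]$ and $\delta=-A^2-A^{-2}$. For an oriented surface $F$ with $m$ specified points on $\partial F$, $\mathcal{S}(F,m)$ is the $\Lambda$-module of formal linear sums of tangle diagrams in $F$ with endpoints at the $m$ points, modulo: a trivial closed loop may be removed at the cost of a factor $\delta$, and the Kauffman bracket relation (a crossing equals $A$ times one smoothing plus $A^{-1}$ times the other). The Temperley-Lieb algebra $TL_m$ is $\mathcal{S}(I\times I,2m)$ with $m$ points on $I\times\{0\}$ and $m$ points on $I\times\{1\}$, with multiplication by stacking. It is generated by $1$ and $e_1,\dots,e_{m-1}$, where $e_i$ joins the $i$-th and $(i+1)$-st points at the bottom,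 likewise at the top, and is vertical elsewhere. The Jones-Wenzl idempotent $f_m\in TL_m$ is the unique element with $f_me_i=e_if_m=0$ for $1\le i\le m-1$, $f_m-1$ in the subalgebra generated by $e_1,\dots,e_{m-1}$, and $f_mf_m=f_m$ ($f_0$ is the empty diagram). The closure of $f_m$ evaluates to $\Delta_m=(-1)^m\frac{A^{2(m+1)}-A^{-2(m+1)}}{A^2-A^{-2}}$. $\mathcal{S}(I\times I,n,h)$ is the submodule of $\mathcal{S}(I\times I,n+h)$ (with $n$ points on the bottom side $I\times\{0\}$ and $h$ points on the top side $I\times\{1\}$) consisting of the elements obtained by placing $f_h$ on top, at the $h$ top points. Index set: tuples $(a_1,\dots,a_n)$ of non-negative integers with $a_1=1$, $a_n=h$, $|a_i-a_{i+1}|=1$ for $1\le i\le n-1$; $|\mathcal{D}_n^h|$ is the number of such tuples. For such a tuple, the crossing-free diagram $B'_{a_1,\dots,a_n}$ with $n$ bottom points and $h$ top points is built recursively: $B'_{a_1}$ is a single vertical strand; given $B'_{a_1,\dots,a_i}$ (with $i$ bottom points and $a_i$ top points), place one more vertical strand to its right, and if $a_{i+1}=a_i+1$ this is $B'_{a_1,\dots,a_{i+1}}$, while if $a_{i+1}=a_i-1$ join the top ends of the new strand and of the rightmost of the $a_i$ top points by an arc to obtain $B'_{a_1,\dots,a_{i+1}}$. Then $B_{a_1,\dots,a_n}$ is $B'_{a_1,\dots,a_n}$ with $f_h$ placed on top. The $\Lambda$-bilinear form $G$ on $\mathcal{S}(I\times I,n,h)$ is given, on elements represented by crossing-free diagrams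 with $f_h$ attached, by gluing the first element to the reflection of the second in a horizontal line, joining the $i$-th bottom points to each other for $i=1,\dots,n$ and the $i$-th top points to each other for $i=1,\dots,h$ by parallel strands in the plane without crossings, and evaluating the resulting closed planar diagram by the Kauffman bracket (empty diagram $=1$, each loop $=\delta$). The matrix $S=[S_{a,b}]$ is indexed by $a,b\in\{B'_{a_1,\dots,a_n}\}$. Glue $a$ to the reflection of $b$ in the same way along the $n$ bottom points and the $h$ top points (giving a semi-meander of order $n$ with winding number $h$, the $n$ points lying on the positive half line and the $h$ points on the negative half line), and let $c(a,b)$ be the number of components of the resulting collection of loops. If the $h$ points lie on $h$ distinct components, $S_{a,b}=\delta^{c(a,b)}$; otherwise $S_{a,b}=0$. Convention: $\binom{a}{b}=0$ if $a<b$ or if $a,b$ are not non-negative integers. *)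

(* Defs.v *)
From HB Require Import structures.
From mathcomp Require Import all_boot all_order all_algebra fraction ring_quotient.
From mathcomp Require Import finmap monalg.
From mathcomp Require Import mathcomp_extra boolp classical_sets fsbigop.

Set Implicit Arguments.
Unset Strict Implicit.
Unset Printing Implicit Defensive.

Import GRing.Theory.
Local Open Scope classical_set_scope.
Local Open Scope ring_scope.

(** [Lam] is Z[A, A^-1] localized at the multiplicative set generated by the
    A^m - 1, m > 0, realized inside the field of fractions of Z[X] with A = X. *)

Definition lam_den (k : nat) (ms : seq nat) : {poly int} :=
  'X^k * \prod_(m <- ms) ('X^(m.+1) - 1).

Definition lam_pred : {pred {fraction {poly int}}} := fun x =>
  `[< exists p k ms, x = FracField.tofrac p / FracField.tofrac (lam_den k ms) >].

Lemma lam_den_neq0 k ms : lam_den k ms != 0.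
Proof.
apply: mulf_neq0; first exact/monic_neq0/monicXn.
by rewrite prodf_seq_neq0; apply/allP => m _; exact/monic_neq0/monicXnsubC.
Qed.

Lemma lam_denM k ms k' ms' :
  lam_den k ms * lam_den k' ms' = lam_den (k + k') (ms ++ ms').
Proof. by rewrite /lam_den exprD big_cat /= mulrACA. Qed.

Lemma lam_predP x : reflect
  (exists p k ms, x = FracField.tofrac p / FracField.tofrac (lam_den k ms))
  (x \in lam_pred).
Proof. exact: asboolP. Qed.

Lemma tofrac_subdiv (R : idomainType) (p q a b : R) : a != 0 -> b != 0 ->
  FracField.tofrac p / FracField.tofrac a - FracField.tofrac q / FracField.tofrac b
  = FracField.tofrac (p * b - q * a) / FracField.tofrac (a * b).
Proof.
move=> a0 b0; rewrite tofracB !tofracM -mulNr addf_div ?tofrac_eq0 //.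
by rewrite mulNr.
Qed.

Lemma tofrac_muldiv (R : idomainType) (p q a b : R) :
  (FracField.tofrac p / FracField.tofrac a) * (FracField.tofrac q / FracField.tofrac b)
  = FracField.tofrac (p * q) / FracField.tofrac (a * b).
Proof. by rewrite !tofracM mulf_div. Qed.

Lemma lam_subring : subring_closed lam_pred.
Proof.
split=> [|x y|x y].
- apply/lam_predP; exists 1, 0%N, [::].
  by rewrite /lam_den big_nil expr0 mulr1 tofrac1 divr1.
- move=> /lam_predP[p [k [ms ->]]] /lam_predP[q [l [ns ->]]].
  apply/lam_predP; exists (p * lam_den l ns - q * lam_den k ms).
  exists (k + l)%N, (ms ++ ns); rewrite -lam_denM.
  exact: tofrac_subdiv (lam_den_neq0 k ms) (lam_den_neq0 l ns).
- move=> /lam_predP[p [k [ms ->]]] /lam_predP[q [l [ns ->]]].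
  apply/lam_predP; exists (p * q), (k + l)%N, (ms ++ ns).
  rewrite -lam_denM; exact: tofrac_muldiv.
Qed.

HB.instance Definition _ :=
  GRing.isSubringClosed.Build {fraction {poly int}} lam_pred lam_subring.

Record Lam := MkLam { lam_val : {fraction {poly int}}; _ : lam_val \in lam_pred }.

HB.instance Definition _ := [isSub for lam_val].
HB.instance Definition _ := [Choice of Lam by <:].
HB.instance Definition _ := [SubChoice_isSubComNzRing of Lam by <:].

Definition lam_unit : {pred Lam} := fun x =>
  (lam_val x != 0) && ((lam_val x)^-1 \in lam_pred).

HB.lock Definition lam_inv (x : Lam) : Lam := insubd x (lam_val x)^-1.

Lemma lam_mulVr : {in lam_unit, left_inverse 1 lam_inv *%R}.
Proof.
move=> x /andP[x0 xV]; apply: val_inj; rewrite rmorphM rmorph1 /=.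
by rewrite lam_inv.unlock -[lam_val _]/(val _) val_insubd xV mulVf.
Qed.

Lemma lam_unitP (x y : Lam) : y * x = 1 -> lam_unit x.
Proof.
move=> /(congr1 val); rewrite rmorphM rmorph1 /= => xy1.
have x0 : lam_val x != 0.
  by apply: contraPneq xy1 => ->; rewrite mulr0 => /esym/eqP; rewrite oner_eq0.
rewrite /lam_unit x0 /=; suff -> : (lam_val x)^-1 = lam_val y by case: (y).
by apply: (mulIf x0); rewrite mulVf.
Qed.

Lemma lam_inv_out : {in [predC lam_unit], lam_inv =1 id}.
Proof.
move=> x; rewrite inE /= negb_and negbK => /orP[/eqP x0|/negPf xV];
  apply: val_inj; rewrite lam_inv.unlock val_insubd.
  by rewrite x0 invr0 -x0 /= if_same.
by rewrite xV.
Qed.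

HB.instance Definition _ :=
  GRing.ComNzRing_hasMulInverse.Build Lam lam_mulVr lam_unitP lam_inv_out.

Lemma lamA_subproof : FracField.tofrac 'X \in lam_pred.
Proof.
apply/lam_predP; exists 'X, 0%N, [::].
by rewrite /lam_den big_nil expr0 mulr1 tofrac1 divr1.
Qed.

HB.lock Definition lamA : Lam := MkLam lamA_subproof.

Definition delta : Lam := - lamA ^+ 2 - lamA ^- 2.

Definition Delta (m : nat) : Lam :=
  (-1) ^+ m * (lamA ^+ (2 * m.+1) - lamA ^- (2 * m.+1))
    / (lamA ^+ 2 - lamA ^- 2).

(** A tangle diagram is cut by horizontal lines into layers, each containing
    one minimum ([Cup]), one maximum ([Cap]) or one crossing besides vertical
    strands.  Words of layers are read from the bottom of the square to its
    top.  In a layer [(x, i)] exactly [i] vertical strands lie to the left of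
    the event [x]; how many lie to its right is determined by the number of
    points on the line below.  In [Pos] the strand coming from the bottom left
    passes over, in [Neg] it passes under. *)

Variant kind := Cup | Cap | Pos | Neg.

Definition kind_code (x : kind) : nat :=
  match x with Cup => 0 | Cap => 1 | Pos => 2 | Neg => 3 end%N.
Definition kind_decode (k : nat) : kind :=
  match k with 0 => Cup | 1 => Cap | 2 => Pos | _ => Neg end%N.
Lemma kind_codeK : cancel kind_code kind_decode. Proof. by case. Qed.
HB.instance Definition _ := Countable.copy kind (can_type kind_codeK).

Definition layer : Type := (kind * nat)%type.

Definition ends_below (x : kind) : nat := if x is Cup then 0%N else 2%N.
Definition ends_above (x : kind) : nat := if x is Cap then 0%N else 2%N.

(** Number of points on the top line of a word with [k] points on its bottom
    line, [None] if some layer does not fit. *)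
Fixpoint run (k : nat) (w : seq layer) : option nat :=
  if w is (x, i) :: w' then
    if (i + ends_below x <= k)%N then run (k - ends_below x + ends_above x) w'
    else None
  else Some k.

Record tangle (n m : nat) :=
  Tangle { tword : seq layer; tword_run : run n tword == Some m }.
HB.instance Definition _ n m := [isSub for @tword n m].
HB.instance Definition _ n m := [Choice of tangle n m by <:].

(** Since positions are counted from the left, a word also denotes the diagram
    with [r] more vertical strands on the right. *)
Lemma run_widen r k w m : run k w = Some m -> run (k + r) w = Some (m + r)%N.
Proof.
elim: w k => [k [->] //|[x i] w IHw k] /=.
case: leqP => // le_k /IHw; rewrite addnAC -addnBAC; last first.
  exact: leq_trans (leq_addl _ _) le_k.
by rewrite (leq_trans le_k (leq_addr _ _)).
Qed.

Lemma run_cat k w w' : run k (w ++ w') = obind (run^~ w') (run k w).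
Proof. by elim: w k => //= -[x i] w IHw k; case: ifP. Qed.

Lemma tangle_idP n : run n [::] == Some n. Proof. by []. Qed.
Definition tangle_id n : tangle n n := Tangle (tangle_idP n).

Lemma tangle_compP n m k (s : tangle m k) (t : tangle n m) :
  run n (tword t ++ tword s) == Some k.
Proof. by rewrite run_cat (eqP (tword_run t)) /= (eqP (tword_run s)). Qed.

(** [s] is placed on top of [t]. *)
Definition tangle_comp n m k (s : tangle m k) (t : tangle n m) : tangle n k :=
  Tangle (tangle_compP s t).

Lemma tangle_widenP r n m (t : tangle n m) : run (n + r) (tword t) == Some (m + r)%N.
Proof. by rewrite (run_widen _ (eqP (tword_run t))). Qed.
Definition tangle_widen r n m (t : tangle n m) : tangle (n + r) (m + r) :=
  Tangle (tangle_widenP r t).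

(** Reflection in a horizontal line.  On crossing-free diagrams this is all
    there is to it; keeping the type of each crossing means that crossings are
    changed as well, which makes the operation compatible with the
    [Lam]-linear bracket relations. *)
Definition flip_kind (x : kind) : kind :=
  match x with Cup => Cap | Cap => Cup | Pos => Pos | Neg => Neg end.
Definition flip_layer (l : layer) : layer := (flip_kind l.1, l.2).
Definition flip_word (w : seq layer) : seq layer := rev (map flip_layer w).

Lemma tangle_flipP n m (t : tangle n m) : run m (flip_word (tword t)) == Some n.
Proof.
rewrite /flip_word; apply/eqP; case: t => w /= /eqP.
elim: w n => [n [->] //|[x i] w IHw n] /=.
case: leqP => // le_n /IHw; rewrite rev_cons -cats1 run_cat => -> /=.
have -> : ends_below (flip_kind x) = ends_above x by case: x {le_n}.
have -> : ends_above (flip_kind x) = ends_below x by case: x {le_n}.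
have le_b : (ends_below x <= n)%N := leq_trans (leq_addl _ _) le_n.
by rewrite leq_add2r addnK subnK // leq_subRL // addnC le_n.
Qed.
Definition tangle_flip n m (t : tangle n m) : tangle m n :=
  Tangle (tangle_flipP t).

(** Planar isotopies of sliced diagrams: sliding distant events past each other
    in height, straightening a maximum against a minimum, and moving a strand
    that crosses one leg of a maximum or minimum to the other leg. *)
Inductive isotopy : seq layer -> seq layer -> Prop :=
| iso_height x y i j : (i <= j)%N ->
    isotopy [:: (x, i); (y, j + ends_above x)%N] [:: (y, j + ends_below x)%N; (x, i)]
| iso_zigzag i : isotopy [:: (Cup, i); (Cap, i.+1)] [::]
| iso_zagzig i : isotopy [:: (Cup, i.+1); (Cap, i)] [::]
| iso_cap_pos i : isotopy [:: (Pos, i.+1); (Cap, i)] [:: (Neg, i); (Cap, i.+1)]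
| iso_cap_neg i : isotopy [:: (Neg, i.+1); (Cap, i)] [:: (Pos, i); (Cap, i.+1)]
| iso_cup_pos i : isotopy [:: (Cup, i); (Pos, i.+1)] [:: (Cup, i.+1); (Neg, i)]
| iso_cup_neg i : isotopy [:: (Cup, i); (Neg, i.+1)] [:: (Cup, i.+1); (Pos, i)].

(** Formal linear sums of tangle diagrams with [n] bottom and [m] top points. *)
Definition formal (n m : nat) : lmodType Lam := {malg Lam[tangle n m]}.

Inductive skein_rel (n m : nat) : formal n m -> Prop :=
| skein_isotopy x y (s t : tangle n m) p q :
    isotopy x y -> tword s = p ++ x ++ q -> tword t = p ++ y ++ q ->
    skein_rel (<< s >> - << t >>)
| skein_loop i (s t : tangle n m) p q :
    tword s = p ++ [:: (Cup, i); (Cap, i)] ++ q -> tword t = p ++ q ->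
    skein_rel (<< s >> - delta *: << t >>)
| skein_pos i (s t r : tangle n m) p q :
    tword s = p ++ [:: (Pos, i)] ++ q -> tword t = p ++ q ->
    tword r = p ++ [:: (Cap, i); (Cup, i)] ++ q ->
    skein_rel (<< s >> - (lamA *: << t >> + lamA^-1 *: << r >>))
| skein_neg i (s t r : tangle n m) p q :
    tword s = p ++ [:: (Neg, i)] ++ q -> tword t = p ++ q ->
    tword r = p ++ [:: (Cap, i); (Cup, i)] ++ q ->
    skein_rel (<< s >> - (lamA^-1 *: << t >> + lamA *: << r >>)).

Definition submodule (V : lmodType Lam) (M : set V) : Prop :=
  M 0 /\ forall a u v, M u -> M v -> M (a *: u + v).

Definition skein_ker (n m : nat) : set (formal n m) :=
  smallest (@submodule (formal n m)) (@skein_rel n m).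

Lemma skein_ker_submodule n m : submodule (@skein_ker n m).
Proof.
split=> [M [[M0 _] _] //|a u v Nu Nv M MP].
by case: (MP) => -[_ MD] _; apply: MD; [exact: Nu|exact: Nv].
Qed.

Definition skein_pred (n m : nat) : {pred formal n m} :=
  fun u => `[< skein_ker u >].

Lemma skein_zmod_closed n m : zmod_closed (@skein_pred n m).
Proof.
have [N0 ND] := skein_ker_submodule n m.
split=> [|u v /asboolP Nu /asboolP Nv]; apply/asboolP => //.
by rewrite addrC -scaleN1r; exact: ND.
Qed.

HB.instance Definition _ n m :=
  GRing.isZmodClosed.Build (formal n m) (@skein_pred n m) (skein_zmod_closed n m).

Definition skein (n m : nat) : Type := {ideal_quot (@skein_pred n m)}.
HB.instance Definition _ n m := GRing.Zmodule.on (skein n m).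

Local Open Scope quotient_scope.

Definition skein_pi n m (u : formal n m) : skein n m :=
  \pi_({ideal_quot (@skein_pred n m)}) u.
Definition skein_repr n m (u : skein n m) : formal n m :=
  repr (u : {ideal_quot (@skein_pred n m)}).

Lemma skein_reprK n m (u : skein n m) : skein_pi (skein_repr u) = u.
Proof. exact: reprK. Qed.

Lemma skein_piP n m (u v : formal n m) :
  skein_pi u = skein_pi v <-> skein_ker (u - v).
Proof.
rewrite /skein_pi; split=> [/eqP|uv].
  by rewrite -Quotient.idealrBE => /asboolP.
by apply/eqP; rewrite -Quotient.idealrBE; apply/asboolP.
Qed.

Lemma skein_piD n m : {morph @skein_pi n m : u v / u + v}.
Proof. exact: (@Quotient.pi_add _ (@skein_pred n m)). Qed.

Lemma skein_kerD n m (u v : formal n m) :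
  skein_ker u -> skein_ker v -> skein_ker (u + v).
Proof. by have [_ ND] := skein_ker_submodule n m; rewrite -{2}[u]scale1r; apply: ND. Qed.

Lemma skein_kerZ n m a (u : formal n m) : skein_ker u -> skein_ker (a *: u).
Proof. by have [N0 ND] := skein_ker_submodule n m; rewrite -[a *: u]addr0 => /ND; apply. Qed.

HB.lock Definition skein_scale n m (a : Lam) (u : skein n m) : skein n m :=
  skein_pi (a *: skein_repr u).

Lemma skein_piZ n m a (u : formal n m) :
  skein_scale a (skein_pi u) = skein_pi (a *: u).
Proof.
rewrite skein_scale.unlock; apply/skein_piP; rewrite -scalerBr; apply: skein_kerZ.
by apply/skein_piP; rewrite skein_reprK.
Qed.

Lemma skein_scaleA n m a b (u : skein n m) :
  skein_scale a (skein_scale b u) = skein_scale (a * b) u.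
Proof. by rewrite -[u]skein_reprK !skein_piZ scalerA. Qed.

Lemma skein_scale1 n m : left_id 1 (@skein_scale n m).
Proof. by move=> u; rewrite -[u]skein_reprK skein_piZ scale1r. Qed.

Lemma skein_scaleDr n m : right_distributive (@skein_scale n m) +%R.
Proof.
move=> a u v; rewrite -[u]skein_reprK -[v]skein_reprK.
by rewrite -skein_piD !skein_piZ scalerDr skein_piD.
Qed.

Lemma skein_scaleDl n m (u : skein n m) : {morph @skein_scale n m ^~ u : a b / a + b}.
Proof. by move=> a b; rewrite -[u]skein_reprK !skein_piZ scalerDl skein_piD. Qed.

HB.instance Definition _ n m := GRing.Zmodule_isLmodule.Build Lam (skein n m)
  (@skein_scaleA n m) (@skein_scale1 n m) (@skein_scaleDr n m) (@skein_scaleDl n m).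

HB.lock Definition cls n m (t : tangle n m) : skein n m := skein_pi << t >>.

(** Linear extension of a function on diagrams, first to formal sums, then to
    the skein module; the latter is computed on representatives, hence is
    meaningful when the former vanishes on [skein_rel]. *)
HB.lock Definition extend_formal n m (W : lmodType Lam) (F : tangle n m -> W)
  (u : formal n m) : W := \sum_(t <- msupp u) u@_t *: F t.

HB.lock Definition extend n m (W : lmodType Lam) (F : tangle n m -> W) (u : skein n m) : W :=
  extend_formal F (skein_repr u).

Section Extend.
Variables (n m : nat) (W : lmodType Lam) (F : tangle n m -> W).

Lemma extend_formalE (d : {fset tangle n m}) (u : formal n m) :
  (msupp u `<=` d)%fset -> extend_formal F u = \sum_(t <- d) u@_t *: F t.
Proof.
move=> ud; rewrite extend_formal.unlock (big_fset_incl _ ud) // => t _ t_u.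
by rewrite mcoeff_outdom ?scale0r.
Qed.

Lemma extend_formalP a u v :
  extend_formal F (a *: u + v) = a *: extend_formal F u + extend_formal F v.
Proof.
set d := (msupp u `|` msupp v)%fset.
rewrite !(@extend_formalE d) ?fsubsetUl ?fsubsetUr //; last first.
  apply: fsubset_trans (msuppD_le _ _) _; apply: fsetSU; exact: msuppZ_le.
rewrite scaler_sumr -big_split /=; apply: eq_bigr => t _.
by rewrite mcoeffD mcoeffZ scalerDl scalerA.
Qed.

Lemma extend_formalU t : extend_formal F << t >> = F t.
Proof.
rewrite (@extend_formalE [fset t]%fset) ?msuppU_le //.
by rewrite big_seq_fset1 mcoeffUU scale1r.
Qed.

Hypothesis F_rel : forall u, skein_rel u -> extend_formal F u = 0.

Lemma extend_formal_ker u : skein_ker u -> extend_formal F u = 0.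
Proof.
move=> Nu; apply: (Nu [set v | extend_formal F v = 0]); split=> //=; split=> /=.
  by rewrite extend_formal.unlock msupp0 big_seq_fset0.
by move=> a v w /= v0 w0; rewrite extend_formalP v0 w0 scaler0 addr0.
Qed.

Lemma extend_pi u : extend F (skein_pi u) = extend_formal F u.
Proof.
rewrite extend.unlock.
have := extend_formal_ker (iffLR (skein_piP _ _) (skein_reprK (skein_pi u))).
rewrite addrC -scaleN1r extend_formalP scaleN1r addrC => /eqP.
by rewrite subr_eq0 => /eqP.
Qed.

Lemma extend_cls t : extend F (cls t) = F t.
Proof. by rewrite cls.unlock extend_pi extend_formalU. Qed.

Lemma extendP a u v : extend F (a *: u + v) = a *: extend F u + extend F v.
Proof.
rewrite -[u]skein_reprK -[v]skein_reprK.
have -> : a *: skein_pi (skein_repr u) = skein_pi (a *: skein_repr u) by exact: skein_piZ.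
by rewrite -skein_piD !extend_pi extend_formalP.
Qed.

End Extend.

Lemma extend_formalB n m (W : lmodType Lam) (F : tangle n m -> W) u v :
  extend_formal F (u - v) = extend_formal F u - extend_formal F v.
Proof. by rewrite addrC -scaleN1r extend_formalP scaleN1r addrC. Qed.

Lemma extend_formalD n m (W : lmodType Lam) (F : tangle n m -> W) u v :
  extend_formal F (u + v) = extend_formal F u + extend_formal F v.
Proof. by rewrite -{1}[u]scale1r extend_formalP scale1r. Qed.

Lemma extend_formalZ n m (W : lmodType Lam) (F : tangle n m -> W) a u :
  extend_formal F (a *: u) = a *: extend_formal F u.
Proof.
have F0 : extend_formal F 0 = 0.
  by rewrite extend_formal.unlock msupp0 big_seq_fset0.
by rewrite -[a *: u]addr0 extend_formalP F0 addr0.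
Qed.

Lemma skein_piB n m (u v : formal n m) : skein_pi (u - v) = skein_pi u - skein_pi v.
Proof. by rewrite -[RHS]addr0; apply: (addIr (skein_pi v)); rewrite addr0 -skein_piD !subrK. Qed.

Lemma skein_pi_scale n m a (u : formal n m) : skein_pi (a *: u) = a *: skein_pi u.
Proof. by rewrite -skein_piZ. Qed.

Lemma extend_formal_rel2 n m (W : lmodType Lam) (F : tangle n m -> W) s a t :
  extend_formal F (<< s >> - a *: << t >>) = F s - a *: F t.
Proof. by rewrite extend_formalB extend_formalZ !extend_formalU. Qed.

Lemma extend_formal_rel3 n m (W : lmodType Lam) (F : tangle n m -> W) s a t b r :
  extend_formal F (<< s >> - (a *: << t >> + b *: << r >>))
  = F s - (a *: F t + b *: F r).
Proof.
rewrite extend_formalB extend_formalD extend_formalU; congr (_ - (_ + _)).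
  by rewrite extend_formalZ extend_formalU.
by rewrite extend_formalZ extend_formalU.
Qed.

Lemma skein_isotopyE n m x y (s t : tangle n m) p q :
  isotopy x y -> tword s = p ++ x ++ q -> tword t = p ++ y ++ q -> cls s = cls t.
Proof.
move=> xy es et; rewrite cls.unlock; apply/skein_piP.
by move=> M [_]; apply; exact: skein_isotopy xy es et.
Qed.

Lemma skein_loopE n m i (s t : tangle n m) p q :
  tword s = p ++ [:: (Cup, i); (Cap, i)] ++ q -> tword t = p ++ q ->
  cls s = delta *: cls t.
Proof.
move=> es et; rewrite cls.unlock -skein_pi_scale; apply/skein_piP.
by move=> M [_]; apply; exact: skein_loop es et.
Qed.

Lemma skein_posE n m i (s t r : tangle n m) p q :
  tword s = p ++ [:: (Pos, i)] ++ q -> tword t = p ++ q ->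
  tword r = p ++ [:: (Cap, i); (Cup, i)] ++ q ->
  cls s = lamA *: cls t + lamA^-1 *: cls r.
Proof.
move=> es et er; rewrite cls.unlock -(skein_pi_scale lamA) -(skein_pi_scale lamA^-1) -skein_piD.
by apply/skein_piP => M [_]; apply; exact: skein_pos es et er.
Qed.

Lemma skein_negE n m i (s t r : tangle n m) p q :
  tword s = p ++ [:: (Neg, i)] ++ q -> tword t = p ++ q ->
  tword r = p ++ [:: (Cap, i); (Cup, i)] ++ q ->
  cls s = lamA^-1 *: cls t + lamA *: cls r.
Proof.
move=> es et er; rewrite cls.unlock -(skein_pi_scale lamA) -(skein_pi_scale lamA^-1) -skein_piD.
by apply/skein_piP => M [_]; apply; exact: skein_neg es et er.
Qed.

Lemma cls_context n m n' m' (F : tangle n m -> tangle n' m') p q :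
  (forall t, tword (F t) = p ++ tword t ++ q) ->
  forall u, skein_rel u -> extend_formal (fun t => cls (F t)) u = 0.
Proof.
move=> hF u; case.
- move=> x y s t p' q' xy es et; rewrite extend_formalB !extend_formalU.
  apply/eqP; rewrite subr_eq0; apply/eqP.
  by apply: (skein_isotopyE (p := p ++ p') (q := q' ++ q) xy);
    rewrite hF (es, et) -!catA.
- move=> i s t p' q' es et; rewrite extend_formal_rel2.
  apply/eqP; rewrite subr_eq0; apply/eqP.
  by apply: (skein_loopE (i := i) (p := p ++ p') (q := q' ++ q));
    rewrite hF (es, et) -!catA.
- move=> i s t r p' q' es et er; rewrite extend_formal_rel3.
  apply/eqP; rewrite subr_eq0; apply/eqP.
  by apply: (skein_posE (i := i) (p := p ++ p') (q := q' ++ q));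
    rewrite hF (es, et, er) -!catA.
- move=> i s t r p' q' es et er; rewrite extend_formal_rel3.
  apply/eqP; rewrite subr_eq0; apply/eqP.
  by apply: (skein_negE (i := i) (p := p ++ p') (q := q' ++ q));
    rewrite hF (es, et, er) -!catA.
Qed.

Lemma isotopy_flip x y : isotopy x y ->
  isotopy (flip_word x) (flip_word y) \/ isotopy (flip_word y) (flip_word x).
Proof.
have fb z : ends_below (flip_kind z) = ends_above z by case: z.
have fa z : ends_above (flip_kind z) = ends_below z by case: z.
case=> [z z' i j le_ij|i|i|i|i|i|i]; rewrite /flip_word /flip_layer /rev /=.
- by right; rewrite -fa -[ends_above z]fb; exact: iso_height.
- by left; exact: iso_zagzig.
- by left; exact: iso_zigzag.
- by left; exact: iso_cup_pos.
- by left; exact: iso_cup_neg.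
- by left; exact: iso_cap_pos.
- by left; exact: iso_cap_neg.
Qed.

Lemma flip_word_cat w w' : flip_word (w ++ w') = flip_word w' ++ flip_word w.
Proof. by rewrite /flip_word map_cat rev_cat. Qed.

Lemma cls_flip n m n' m' (F : tangle n m -> tangle n' m') p q :
  (forall t, tword (F t) = p ++ flip_word (tword t) ++ q) ->
  forall u, skein_rel u -> extend_formal (fun t => cls (F t)) u = 0.
Proof.
move=> hF u; case.
- move=> x y s t p' q' xy es et; rewrite extend_formalB !extend_formalU.
  apply/eqP; rewrite subr_eq0; apply/eqP.
  case: (isotopy_flip xy) => xy'; [|symmetry];
  by apply: (skein_isotopyE (p := p ++ flip_word q') (q := flip_word p' ++ q) xy');
    rewrite hF (es, et) !flip_word_cat -!catA.
- move=> i s t p' q' es et; rewrite extend_formal_rel2.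
  apply/eqP; rewrite subr_eq0; apply/eqP.
  by apply: (skein_loopE (i := i) (p := p ++ flip_word q') (q := flip_word p' ++ q));
    rewrite hF (es, et) !flip_word_cat -!catA.
- move=> i s t r p' q' es et er; rewrite extend_formal_rel3.
  apply/eqP; rewrite subr_eq0; apply/eqP.
  by apply: (skein_posE (i := i) (p := p ++ flip_word q') (q := flip_word p' ++ q));
    rewrite hF (es, et, er) !flip_word_cat -!catA.
- move=> i s t r p' q' es et er; rewrite extend_formal_rel3.
  apply/eqP; rewrite subr_eq0; apply/eqP.
  by apply: (skein_negE (i := i) (p := p ++ flip_word q') (q := flip_word p' ++ q));
    rewrite hF (es, et, er) !flip_word_cat -!catA.
Qed.

Lemma extendE n m (W : lmodType Lam) (F : tangle n m -> W) u :
  extend F u = \sum_(t <- msupp (skein_repr u)) (skein_repr u)@_t *: F t.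
Proof. by rewrite extend.unlock extend_formal.unlock. Qed.

Section Bilinear.
Variables (n m n' m' k l : nat) (F : tangle n m -> tangle n' m' -> tangle k l).

Definition extend2 (u : skein n m) (v : skein n' m') : skein k l :=
  extend (fun s => extend (fun t => cls (F s t)) v) u.

Hypothesis Fl : forall t u, skein_rel u -> extend_formal (fun s => cls (F s t)) u = 0.
Hypothesis Fr : forall s v, skein_rel v -> extend_formal (fun t => cls (F s t)) v = 0.

Lemma extend2_rel v u :
  skein_rel u -> extend_formal (fun s => extend (fun t => cls (F s t)) v) u = 0.
Proof.
move=> ru; pose G t := extend_formal (fun s => cls (F s t)) u.
suff -> : extend_formal (fun s => extend (fun t => cls (F s t)) v) u =
          extend_formal G (skein_repr v).
  by rewrite extend_formal.unlock big1 // => t _; rewrite /G Fl // scaler0.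
rewrite /G extend.unlock extend_formal.unlock.
under eq_bigr do rewrite scaler_sumr.
under [RHS]eq_bigr do rewrite scaler_sumr.
rewrite exchange_big /=; apply: eq_bigr => t _; apply: eq_bigr => s _.
by rewrite !scalerA mulrC.
Qed.

Lemma extend2_cls s t : extend2 (cls s) (cls t) = cls (F s t).
Proof. by rewrite /extend2 (extend_cls (extend2_rel _)) (extend_cls (Fr _)). Qed.

Lemma extend2Pl a u u' v : extend2 (a *: u + u') v = a *: extend2 u v + extend2 u' v.
Proof. exact: extendP (extend2_rel _) _ _ _. Qed.

Lemma extend2Pr a u v v' : extend2 u (a *: v + v') = a *: extend2 u v + extend2 u v'.
Proof.
have E w : extend2 u w = \sum_(s <- msupp (skein_repr u))
    (skein_repr u)@_s *: extend (fun t => cls (F s t)) w.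
  exact: extendE.
rewrite !E scaler_sumr -big_split /=; apply: eq_bigr => s _.
by rewrite (extendP (Fr s)) scalerDr !scalerA mulrC.
Qed.

End Bilinear.

(** [u] placed on top of [v]. *)
Definition stack n m k (u : skein m k) (v : skein n m) : skein n k :=
  extend2 (@tangle_comp n m k) u v.

Lemma stack_rell n m k (t : tangle n m) (u : formal m k) :
  skein_rel u -> extend_formal (fun s => cls (tangle_comp s t)) u = 0.
Proof. by apply: (cls_context (p := tword t) (q := [::])) => s; rewrite cats0. Qed.

Lemma stack_relr n m k (s : tangle m k) (v : formal n m) :
  skein_rel v -> extend_formal (fun t => cls (tangle_comp s t)) v = 0.
Proof. exact: (cls_context (p := [::]) (q := tword s)). Qed.

Lemma stack_cls n m k (s : tangle m k) (t : tangle n m) :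
  stack (cls s) (cls t) = cls (tangle_comp s t).
Proof. exact: extend2_cls (@stack_rell _ _ _) (@stack_relr _ _ _) _ _. Qed.

Lemma stackPl n m k a (u u' : skein m k) (v : skein n m) :
  stack (a *: u + u') v = a *: stack u v + stack u' v.
Proof. exact: extend2Pl (@stack_rell _ _ _) _ _ _ _. Qed.

Lemma stackPr n m k a (u : skein m k) (v v' : skein n m) :
  stack u (a *: v + v') = a *: stack u v + stack u v'.
Proof. exact: extend2Pr (@stack_relr _ _ _) _ _ _ _. Qed.

Definition TL (m : nat) : lmodType Lam := skein m m.

Lemma TL_eP m (i : 'I_m.-1) : run m [:: (Cap, val i); (Cup, val i)] == Some m.
Proof.
case: m i => [|[|m]] [i] //=; rewrite ltnS => le_im.
by rewrite addn2 !ltnS le_im !addn0 subn2 /= le_im subn0 addn2.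
Qed.

(** The generator joining the points [i] and [i + 1], counted from [0], at the
    bottom and at the top. *)
Definition TL_e m (i : 'I_m.-1) : TL m := cls (Tangle (TL_eP i)).

Definition TL_one m : TL m := cls (tangle_id m).

(** Subalgebras need not contain the unit: otherwise the condition on [f - 1]
    below would be void. *)
Definition subalgebra m (M : set (TL m)) : Prop :=
  submodule M /\ forall u v, M u -> M v -> M (stack u v).

Definition is_jones_wenzl m (f : TL m) : Prop :=
  [/\ forall i : 'I_m.-1, stack f (TL_e i) = 0 /\ stack (TL_e i) f = 0,
      smallest (@subalgebra m) (range (@TL_e m)) (f - TL_one m)
    & stack f f = f].

Definition jones_wenzl m : TL m := xget 0 [set f | is_jones_wenzl f].

(** The submodule [S(I x I, n, h)] of elements with [f_h] placed on top. *)
Definition skein_top n h : set (skein n h) := range (stack (n := n) (jones_wenzl h)).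

(** [h] nested minima: the points [i] and [2 h - 1 - i] are joined. *)
Definition nest_word (h : nat) : seq layer := [seq (Cup, i) | i <- iota 0 h].

Lemma nestP h : run 0 (nest_word h) == Some (h + h)%N.
Proof.
suff E a : run (a + a) [seq (Cup, i) | i <- iota a h] = Some ((a + h) + (a + h))%N.
  by rewrite (E 0%N).
elim: h a => [a|h IHh a] /=; first by rewrite addn0.
by rewrite addn0 leq_addr subn0 addn2 -addnS -addSn IHh !addSnnS.
Qed.
Definition nest h : tangle 0 (h + h) := Tangle (nestP h).

(** The closed diagram obtained by gluing [s] to the reflection of [t]: the
    reflection of [t] is placed below [s], which joins the bottom points, and
    the top points of [s] are joined on the right, through [h] nested maxima,
    [h] vertical strands and [h] nested minima, to those of [t]. *)
Definition glue_tangle n h (s t : tangle n h) : tangle 0 0 :=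
  tangle_comp (tangle_flip (nest h))
    (tangle_comp (tangle_widen h (tangle_comp s (tangle_flip t))) (nest h)).

Definition glue n h (u v : skein n h) : skein 0 0 := extend2 (@glue_tangle n h) u v.

Lemma glue_rell n h (t : tangle n h) (u : formal n h) :
  skein_rel u -> extend_formal (fun s => cls (glue_tangle s t)) u = 0.
Proof.
apply: (cls_context (p := nest_word h ++ flip_word (tword t))
                    (q := flip_word (nest_word h))) => s.
by rewrite /= -!catA.
Qed.

Lemma glue_relr n h (s : tangle n h) (v : formal n h) :
  skein_rel v -> extend_formal (fun t => cls (glue_tangle s t)) v = 0.
Proof.
apply: (cls_flip (p := nest_word h) (q := tword s ++ flip_word (nest_word h))) => t.
by rewrite /= -!catA.
Qed.

Lemma glue_cls n h (s t : tangle n h) : glue (cls s) (cls t) = cls (glue_tangle s t).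
Proof. exact: extend2_cls (@glue_rell _ _) (@glue_relr _ _) _ _. Qed.

Lemma gluePl n h a (u u' v : skein n h) :
  glue (a *: u + u') v = a *: glue u v + glue u' v.
Proof. exact: extend2Pl (@glue_rell _ _) _ _ _ _. Qed.

Lemma gluePr n h a (u v v' : skein n h) :
  glue u (a *: v + v') = a *: glue u v + glue u v'.
Proof. exact: extend2Pr (@glue_relr _ _) _ _ _ _. Qed.

(** The value of a closed diagram is its coefficient on the empty diagram. *)
Definition bracket (u : skein 0 0) : Lam :=
  xget 0 [set c | u = c *: cls (tangle_id 0)].

(** The form [G] is the restriction of this form to [skein_top n h]. *)
Definition form n h (u v : skein n h) : Lam := bracket (glue u v).

(** Number of points on the line below the layer number [t] of [w]. *)
Definition width (n : nat) (w : seq layer) (t : nat) : nat :=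
  odflt 0%N (run n (take t w)).

(** Strands inside a layer; [false] stands for its bottom line and [true] for
    its top line. *)
Definition strand (l : layer) (x y : bool * nat) : bool :=
  let i := l.2 in
  match l.1, x, y with
  | Cup, (true, j), (true, j') => (j == i) && (j' == i.+1)
  | Cup, (false, j), (true, j') => j' == (if (j < i)%N then j else j.+2)
  | Cap, (false, j), (false, j') => (j == i) && (j' == i.+1)
  | Cap, (false, j), (true, j') => j == (if (j' < i)%N then j' else j'.+2)
  | (Pos | Neg), (false, j), (true, j') =>
      j' == (if j == i then i.+1 else if j == i.+1 then i else j)
  | _, _, _ => false
  end.

Section Components.
Variables (n m : nat) (s : tangle n m).
Let w := tword s.

(** The intersection points of the diagram with the horizontal lines. *)
Definition point : finType := {t : 'I_(size w).+1 & 'I_(width n w t)}.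

Definition level (x : point) : nat := tag x.
Definition position (x : point) : nat := tagged x.

Definition linked (x y : point) : bool :=
  [exists t : 'I_(size w), exists a : bool, exists b : bool,
    [&& level x == (t + a)%N, level y == (t + b)%N
      & strand (tnth (in_tuple w) t) (a, position x) (b, position y)]].

Definition joined : rel point := fun x y => linked x y || linked y x.

Definition components : nat := n_comp joined point.

End Components.

Definition adjacent (x y : nat) : bool := (y == x.+1) || (x == y.+1).

(** The tuples [(a_1, ..., a_n)]; note that [a_i <= i <= n]. *)
Definition admissible n (h : nat) (a : n.-tuple 'I_n.+1) : bool :=
  let s := [seq val x | x <- a] in
  [&& head 0%N s == 1%N, last 0%N s == h & sorted adjacent s].

Definition D (n h : nat) : finType := {a : n.-tuple 'I_n.+1 | admissible h a}.

(** The maxima used to go from [B'_{x}] to [B'_{x, s}]: a step down from [x]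
    joins the [x]-th strand to the new strand on its right. *)
Fixpoint steps_word (x : nat) (s : seq nat) : seq layer :=
  if s is y :: s' then
    (if y == x.+1 then [::] else [:: (Cap, x.-1)]) ++ steps_word y s'
  else [::].

Lemma steps_wordP x s :
  path adjacent x s -> run (x + size s) (steps_word x s) = Some (last x s).
Proof.
elim: s x => [x _|y s IHs x /= /andP[/orP[] /eqP -> /IHs E]]; first by rewrite addn0.
  by rewrite eqxx /= addnS -addSn.
rewrite ltn_eqF ?leqnSn //= addn2 [in X in (_ < X)%N]addSnnS addnS addnS !ltnS leq_addr.
by rewrite addSnnS !addnS subn2 addn0.
Qed.

Definition Bprime_word n h (a : D n h) : seq layer :=
  steps_word 1 (behead [seq val x | x <- val a]).

Lemma BprimeP n h (a : D n h) : run n (Bprime_word a) == Some h.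
Proof.
case: a => a ha; rewrite /Bprime_word /=; case/and3P: (ha) => {ha}.
have : size [seq val x | x <- a] = n by rewrite size_map size_tuple.
case: [seq val x | x <- a] => //= x s <- /eqP-> /eqP<- /steps_wordP.
by rewrite add1n => ->.
Qed.

Definition Bprime n h (a : D n h) : tangle n h := Tangle (BprimeP a).

Definition Bvec n h (a : D n h) : skein n h := stack (jones_wenzl h) (cls (Bprime a)).

Lemma Bvec_top n h (a : D n h) : skein_top (Bvec a).
Proof. by exists (cls (Bprime a)). Qed.

Definition Bmx n h : 'M[Lam]_#|D n h| :=
  \matrix_(i, j) form (Bvec (enum_val i)) (Bvec (enum_val j)).

(** The [h] points common to [s] and the reflection of [t] lie on pairwise
    distinct components of [glue_tangle s t]; they are represented by the [h]
    leftmost points of the line just above the nested minima. *)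
Definition distinct_ends n h (s t : tangle n h) : bool :=
  [forall x : point (glue_tangle s t), forall y : point (glue_tangle s t),
    [&& level x == h, level y == h, position x < h, position y < h & x != y]%N
      ==> ~~ connect (@joined _ _ (glue_tangle s t)) x y].

Definition S_entry n h (s t : tangle n h) : Lam :=
  if distinct_ends s t then delta ^+ components (glue_tangle s t) else 0.

Definition Smx n h : 'M[Lam]_#|D n h| :=
  \matrix_(i, j) S_entry (Bprime (enum_val i)) (Bprime (enum_val j)).

(** [p] choose [a / 2], which is [0] by convention when [a] is odd. *)
Definition bin_half (p a : nat) : nat := if odd a then 0%N else 'C(p, a./2).

Definition alpha (n h k : nat) : int :=
  let s := minn k.-1 h in (* hence 2 * s <= 2 * k when 0 < k *)
  (bin_half n (n + h + 2 * k - 2 * s))%:Z - (bin_half n (n + h + 2 * k + 2))%:Z.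

(* Main.v *)
(** Gluing two crossing-free diagrams [s], [t] with [n] bottom and [h] top
    points produces a closure of the crossing-free diagram [w], [t] reflected
    below [s], in [TL_h].  Using only planar isotopies and loop removals, [w]
    reduces to a power [delta ^+ c] times either the identity or a diagram with
    a minimum on its top line.  In the second case the Jones-Wenzl idempotent
    kills [w] and two of the [h] points lie on one component, so both entries
    vanish; in the first case the entries are [Delta h * delta ^+ c] and
    [delta ^+ (c + h)].  Hence [S] and [B] are multiples of one matrix.
    Components are counted by 2-colourings, since the colouring model obeys the
    same reductions with loop value 2.

    The common matrix is computed in the spin representation: up to a power of
    [- A ^ 2] its entries are dot products of the highest weight vectors
    obtained by pulling the state with all spins up back along the diagrams.
    For the raising operator [E] of quantum sl2 these vectors are unitriangular
    with respect to an orthogonal basis indexed by the same paths, where a step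
    up adds a spin up to [z], and a step down adds a spin down together with
    the multiple of [F z] times a spin up that restores [E z = 0].  A step from
    [k] to [k - 1] multiplies the norm by [Delta k / Delta (k - 1)], so the
    exponents count such steps over all paths; they satisfy the Pascal-type
    recursion of [alpha]. *)

Require Import Defs.
From mathcomp Require Import all_boot all_order all_algebra fraction perm.
From mathcomp Require Import monalg.
From mathcomp Require Import mathcomp_extra boolp classical_sets fsbigop.
From mathcomp Require Import zify ring.

Set Implicit Arguments.
Unset Strict Implicit.
Unset Printing Implicit Defensive.

Import Order.TTheory GRing.Theory Num.Theory.
Local Open Scope ring_scope.

(** * State models of words *)

(** [Lam] is not a field, but what has to be inverted or cancelled ([Delta k], [cc p.+1], the norms)
    is a unit, because [A] and all [A ^ m - 1] are. The delicate point is triangularity: for a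
    diagram vector to be a combination of the [zvec] at all, these must span every highest weight
    vector. This is proved by peeling off the last spin. At weight 0 the remainder has weight -1, so
    the induction also carries the injectivity of [E] in negative weights, which in turn uses
    spanning and invertible norms at weight 0. The ratio [Delta k / Delta k.-1] has two sources: a
    step down multiplies the plain dot product by [1 + gam k ^+ 2 * cc k], and reflecting its
    maximum contributes [- A ^ 2]. The spin model has a second use: it is the functional which shows
    that the coefficient of a closed diagram on the empty diagram is unique, so that [bracket]
    returns it. *)

Fixpoint configs (k : nat) : seq (seq bool) :=
  if k is k'.+1 then
    [seq true :: u | u <- configs k'] ++ [seq false :: u | u <- configs k']
  else [:: [::]].

Lemma mem_configs k u : (u \in configs k) = (size u == k).
Proof.
elim: k u => [|k IHk] [|c u] //=; rewrite mem_cat.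
  by apply/negbTE/norP; split; apply/mapP => -[].
rewrite eqSS -IHk; apply/orP/idP => [[] /mapP[v vk [_ ->]] //|uk].
by case: c; [left|right]; apply/mapP; exists u.
Qed.

Lemma uniq_configs k : uniq (configs k).
Proof.
elim: k => //= k IHk; rewrite cat_uniq !map_inj_uniq ?IHk; try by move=> u v [].
by rewrite andbT /=; apply/hasPn => _ /mapP[u _ ->]; apply/mapP => -[].
Qed.

Lemma sum_configsD (V : nmodType) a b (f : seq bool -> V) :
  \sum_(w <- configs (a + b)) f w =
  \sum_(u <- configs a) \sum_(v <- configs b) f (u ++ v).
Proof.
elim: a f => [|a IHa] f /=; first by rewrite big_seq1.
by rewrite !big_cat !big_map /= !IHa.
Qed.

Lemma sum_config0 (V : nmodType) (f : seq bool -> V) :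
  \sum_(u <- configs 0) f u = f [::].
Proof. by rewrite big_seq1. Qed.

Lemma sum_config2 (V : nmodType) (f : seq bool -> V) :
  \sum_(u <- configs 2) f u =
  f [:: true; true] + f [:: true; false] + f [:: false; true] + f [:: false; false].
Proof. by rewrite /= !big_cons big_nil addr0 !addrA. Qed.

Lemma split_at (T : Type) (u : seq T) i e : (i + e <= size u)%N ->
  exists u1 b u2, [/\ u = u1 ++ b ++ u2, size u1 = i & size b = e].
Proof.
move=> le_u; exists (take i u), (take e (drop i u)), (drop e (drop i u)).
by rewrite !cat_take_drop !size_take_min size_drop; split=> //; lia.
Qed.

Lemma split1 (T : Type) (u : seq T) i : (i < size u)%N ->
  exists u1 a u2, u = u1 ++ a :: u2 /\ size u1 = i.
Proof.
by rewrite -addn1 => /split_at[u1 [[|a [|? ?]] [u2 [-> <-]]]] //= _; exists u1, a, u2.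
Qed.

Lemma split2 (T : Type) (u : seq T) i : (i + 2 <= size u)%N ->
  exists u1 a b u2, u = u1 ++ [:: a, b & u2] /\ size u1 = i.
Proof.
by move=> /split_at[u1 [[|a [|b [|? ?]]] [u2 [-> <-]]]] //= _; exists u1, a, b, u2.
Qed.

Section StateModel.
Variables (R : comNzRingType) (cap cup : bool -> bool -> R) (p q : R).

(** Crossings are defined by their bracket expansion, with [p] and [q] for [A] and its inverse, so
    that the Kauffman relation holds by construction. *)
Definition tensor (x : kind) (b v : seq bool) : R :=
  match x, b, v with
  | Cup, [::], [:: c; d] => cup c d
  | Cap, [:: a; b], [::] => cap a b
  | Pos, [:: a; b], [:: c; d] =>
      p * ((a == c) && (b == d))%:R + q * (cap a b * cup c d)
  | Neg, [:: a; b], [:: c; d] =>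
      q * ((a == c) && (b == d))%:R + p * (cap a b * cup c d)
  | _, _, _ => 0
  end.

(** A function on the configurations of the top line is pulled back to the
    bottom line. *)
Definition lay (l : layer) (F : seq bool -> R) (u : seq bool) : R :=
  \sum_(v <- configs (ends_above l.1))
    tensor l.1 (take (ends_below l.1) (drop l.2 u)) v
    * F (take l.2 u ++ v ++ drop (l.2 + ends_below l.1) u).

Definition ev (w : seq layer) (F : seq bool -> R) : seq bool -> R := foldr lay F w.

Lemma ev_cat w w' F : ev (w ++ w') F = ev w (ev w' F).
Proof. exact: foldr_cat. Qed.

Lemma lay_cat x i F u1 b u2 : size u1 = i -> size b = ends_below x ->
  lay (x, i) F (u1 ++ b ++ u2) =
  \sum_(v <- configs (ends_above x)) tensor x b v * F (u1 ++ v ++ u2).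
Proof.
move=> <- sb; rewrite /lay /=; apply: eq_bigr => v _.
rewrite -sb take_size_cat // drop_size_cat // take_size_cat //.
by rewrite [in drop _ _]catA drop_size_cat // size_cat.
Qed.

Lemma lay_cup i F u1 u2 : size u1 = i ->
  lay (Cup, i) F (u1 ++ u2) =
    cup true true * F (u1 ++ [:: true, true & u2]) +
    cup true false * F (u1 ++ [:: true, false & u2]) +
    cup false true * F (u1 ++ [:: false, true & u2]) +
    cup false false * F (u1 ++ [:: false, false & u2]).
Proof. by move=> su; rewrite (@lay_cat _ _ _ _ [::]) // sum_config2. Qed.

Lemma lay_cap i F u1 a b u2 : size u1 = i ->
  lay (Cap, i) F (u1 ++ [:: a, b & u2]) = cap a b * F (u1 ++ u2).
Proof. by move=> su; rewrite (@lay_cat _ _ _ _ [:: a; b]) // sum_config0. Qed.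

Lemma eq_ev w F G : F =1 G -> ev w F =1 ev w G.
Proof. by move=> /funext ->. Qed.

Lemma ev_eq n m w F G : run n w = Some m ->
  (forall y, size y = m -> F y = G y) -> forall x, size x = n -> ev w F x = ev w G x.
Proof.
elim: w n => [n [->] //|[x i] w IHw n] /=; case: leqP => // le_n r FG u su.
rewrite /lay big_seq [RHS]big_seq; apply: eq_bigr => v; rewrite mem_configs => /eqP sv.
congr (_ * _); apply: IHw r FG _ _.
rewrite !size_cat sv size_take_min size_drop su; move: le_n => /=; lia.
Qed.

Lemma ev_widen n m w F u r : run n w = Some m -> size u = n ->
  ev w F (u ++ r) = ev w (fun y => F (y ++ r)) u.
Proof.
elim: w n u => [n u [->] //|[x i] w IHw n u] /=; case: leqP => // le_n rw su.
have [u1 [b [u2 [eu s1 sb]]]] : exists u1 b u2,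
  [/\ u = u1 ++ b ++ u2, size u1 = i & size b = ends_below x].
  by apply: split_at; rewrite su.
rewrite eu -!catA !lay_cat // big_seq [RHS]big_seq; apply: eq_bigr => v.
rewrite mem_configs => /eqP sv; congr (_ * _); rewrite !catA.
apply: IHw rw _; move: su; rewrite eu !size_cat sv s1 sb; lia.
Qed.

Lemma evP w a F G u : ev w (fun y => a * F y + G y) u = a * ev w F u + ev w G u.
Proof.
elim: w u => [|l w IHw] u //=.
rewrite /lay mulr_sumr -big_split /=; apply: eq_bigr => v _.
by rewrite IHw mulrDr mulrCA.
Qed.

Lemma ev0 w u : ev w (fun=> 0) u = 0.
Proof.
by elim: w u => //= l w IHw u; rewrite /lay big1 // => v _; rewrite IHw mulr0.
Qed.

Lemma evZ w a F u : ev w (fun y => a * F y) u = a * ev w F u.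
Proof. by rewrite -[RHS]addr0 -[in RHS](ev0 w u) -evP; under [RHS]eq_ev do rewrite addr0. Qed.

(** Straightening a strand amounts to [cap] and [cup] being inverse matrices. *)
Hypothesis zigzag : forall a c, cup c true * cap true a + cup c false * cap false a = (a == c)%:R.
Hypothesis zagzig : forall a d, cap a true * cup true d + cap a false * cup false d = (a == d)%:R.

Lemma ev_zigzag i F u : (i < size u)%N -> ev [:: (Cup, i); (Cap, i.+1)] F u = F u.
Proof.
move=> /split1[u1 [a [u2 [-> su1]]]] /=.
have capE c d : lay (Cap, i.+1) F (u1 ++ [:: c, d, a & u2]) = cap d a * F (u1 ++ c :: u2).
  by rewrite -cat_rcons lay_cap ?size_rcons ?su1 // cat_rcons.
rewrite lay_cup // !capE; set X := F (u1 ++ true :: u2); set Y := F (u1 ++ false :: u2).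
transitivity ((cup true true * cap true a + cup true false * cap false a) * X +
  (cup false true * cap true a + cup false false * cap false a) * Y); first by ring.
by rewrite !zigzag /X /Y; case: (a) => /=; rewrite ?mul1r ?mul0r ?addr0 ?add0r.
Qed.

Lemma ev_zagzig i F u : (i < size u)%N -> ev [:: (Cup, i.+1); (Cap, i)] F u = F u.
Proof.
move=> /split1[u1 [a [u2 [-> su1]]]] /=.
rewrite -cat_rcons lay_cup ?size_rcons ?su1 // !cat_rcons !lay_cap //.
set X := F (u1 ++ true :: u2); set Y := F (u1 ++ false :: u2).
transitivity ((cap a true * cup true true + cap a false * cup false true) * X +
  (cap a true * cup true false + cap a false * cup false false) * Y); first by ring.
by rewrite !zagzig /X /Y; case: (a) => /=; rewrite ?mul1r ?mul0r ?addr0 ?add0r.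
Qed.

Definition loop_value : R :=
  cup true true * cap true true + cup true false * cap true false +
  cup false true * cap false true + cup false false * cap false false.

Lemma ev_loop i F u : (i <= size u)%N -> ev [:: (Cup, i); (Cap, i)] F u = loop_value * F u.
Proof.
move=> le_iu; rewrite -(cat_take_drop i u) /=.
have su1 : size (take i u) = i by rewrite size_takel.
by rewrite lay_cup // !lay_cap // /loop_value; ring.
Qed.

Lemma lay_pos i F u : (i + 2 <= size u)%N ->
  lay (Pos, i) F u = p * F u + q * ev [:: (Cap, i); (Cup, i)] F u.
Proof.
move=> /split2[u1 [a [b' [u2 [-> su1]]]]] /=.
rewrite (@lay_cat _ _ _ _ [:: a; b']) // lay_cap // lay_cup // sum_config2 /=.
by case: a; case: b' => /=; ring.
Qed.

Lemma lay_neg i F u : (i + 2 <= size u)%N ->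
  lay (Neg, i) F u = q * F u + p * ev [:: (Cap, i); (Cup, i)] F u.
Proof.
move=> /split2[u1 [a [b' [u2 [-> su1]]]]] /=.
rewrite (@lay_cat _ _ _ _ [:: a; b']) // lay_cap // lay_cup // sum_config2 /=.
by case: a; case: b' => /=; ring.
Qed.

(** The two events act on disjoint tensor factors, so their sums can be exchanged. *)
Lemma ev_height x y i j F u : (i <= j)%N -> (j + ends_below x + ends_below y <= size u)%N ->
  ev [:: (x, i); (y, j + ends_above x)%N] F u =
  ev [:: (y, j + ends_below x)%N; (x, i)] F u.
Proof.
move=> le_ij le_u.
have [u1 [b [r [eu s1 sb]]]] : exists u1 b u2,
  [/\ u = u1 ++ b ++ u2, size u1 = i & size b = ends_below x] by apply: split_at; lia.
have [u2 [b' [u3 [er s2 sb']]]] : exists u1 b u2,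
  [/\ r = u1 ++ b ++ u2, size u1 = (j - i)%N & size b = ends_below y].
  by apply: split_at; move: le_u; rewrite eu !size_cat s1 sb; lia.
rewrite eu er /= lay_cat //.
transitivity (\sum_(v <- configs (ends_above x)) \sum_(v' <- configs (ends_above y))
    tensor x b v * (tensor y b' v' * F (u1 ++ v ++ u2 ++ v' ++ u3))).
  rewrite big_seq [RHS]big_seq; apply: eq_bigr => v; rewrite mem_configs => /eqP sv.
  rewrite -mulr_sumr; congr (_ * _).
  have -> : u1 ++ v ++ u2 ++ b' ++ u3 = (u1 ++ v ++ u2) ++ b' ++ u3 by rewrite -!catA.
  rewrite lay_cat //; last first.
    by rewrite !size_cat sv s1 s2; lia.
  by apply: eq_bigr => v' _; rewrite -!catA.
rewrite exchange_big /=.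
have -> : u1 ++ b ++ u2 ++ b' ++ u3 = (u1 ++ b ++ u2) ++ b' ++ u3 by rewrite -!catA.
rewrite lay_cat //; last first.
  by rewrite !size_cat sb s1 s2; lia.
apply: eq_bigr => v' _; rewrite -!catA lay_cat // mulr_sumr; apply: eq_bigr => v _.
by rewrite mulrCA.
Qed.

(** Expanding the crossing leaves a zigzag in the second term. The value obtained is the common one
    through which the two sides of [iso_cap_pos] are compared. *)
Lemma ev_pos_cap i F u : (i + 3 <= size u)%N ->
  ev [:: (Pos, i.+1); (Cap, i)] F u = p * lay (Cap, i) F u + q * lay (Cap, i.+1) F u.
Proof.
move=> le_u; rewrite /= lay_pos; last lia; congr (_ + _ * _).
rewrite -[LHS]/(ev [:: (Cap, i.+1)] (ev [:: (Cup, i.+1); (Cap, i)] F) u).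
apply: (@ev_eq (size u) (size u - 2)) => //=; first by rewrite ifT; [congr Some|]; lia.
by move=> y sy; apply: ev_zagzig; lia.
Qed.

Lemma ev_neg_cap i F u : (i + 3 <= size u)%N ->
  ev [:: (Neg, i); (Cap, i.+1)] F u = q * lay (Cap, i.+1) F u + p * lay (Cap, i) F u.
Proof.
move=> le_u; rewrite /= lay_neg; last lia; congr (_ + _ * _).
rewrite -[LHS]/(ev [:: (Cap, i)] (ev [:: (Cup, i); (Cap, i.+1)] F) u).
apply: (@ev_eq (size u) (size u - 2)) => //=; first by rewrite ifT; [congr Some|]; lia.
by move=> y sy; apply: ev_zigzag; lia.
Qed.

Lemma ev_cup_pos i F u : (i < size u)%N ->
  ev [:: (Cup, i); (Pos, i.+1)] F u = p * lay (Cup, i) F u + q * lay (Cup, i.+1) F u.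
Proof.
move=> lt_u; transitivity (ev [:: (Cup, i)]
    (fun y => p * F y + ev [:: (Cap, i.+1); (Cup, i.+1)] (fun z => q * F z) y) u).
  rewrite -[LHS]/(ev [:: (Cup, i)] (lay (Pos, i.+1) F) u).
  apply: (@ev_eq (size u) (size u + 2)) => //=; first by rewrite ifT; [congr Some|]; lia.
  by move=> y sy; rewrite lay_pos ?sy; [rewrite [X in _ = _ + X](evZ [:: _; _]) | lia].
rewrite evP; congr (_ + _).
rewrite -[LHS]/(ev [:: (Cup, i); (Cap, i.+1)] _ u) ev_zigzag //.
exact: (evZ [:: (Cup, i.+1)]).
Qed.

Lemma ev_cup_neg i F u : (i < size u)%N ->
  ev [:: (Cup, i.+1); (Neg, i)] F u = q * lay (Cup, i.+1) F u + p * lay (Cup, i) F u.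
Proof.
move=> lt_u; transitivity (ev [:: (Cup, i.+1)]
    (fun y => q * F y + ev [:: (Cap, i); (Cup, i)] (fun z => p * F z) y) u).
  rewrite -[LHS]/(ev [:: (Cup, i.+1)] (lay (Neg, i) F) u).
  apply: (@ev_eq (size u) (size u + 2)) => //=; first by rewrite ifT; [congr Some|]; lia.
  by move=> y sy; rewrite lay_neg ?sy; [rewrite [X in _ = _ + X](evZ [:: _; _]) | lia].
rewrite evP; congr (_ + _).
rewrite -[LHS]/(ev [:: (Cup, i.+1); (Cap, i)] _ u) ev_zagzig //.
exact: (evZ [:: (Cup, i)]).
Qed.

End StateModel.

Lemma isotopy_ev (R : comNzRingType) (cap cup : bool -> bool -> R) (p q : R) :
  (forall a c, cup c true * cap true a + cup c false * cap false a = (a == c)%:R) ->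
  (forall a d, cap a true * cup true d + cap a false * cup false d = (a == d)%:R) ->
  forall x y F k u, isotopy x y -> run k x -> run k y -> size u = k ->
  ev cap cup p q x F u = ev cap cup p q y F u.
Proof.
move=> zz zs x y F k u xy.
case: xy => [x' y' i j le_ij|i|i|i|i|i|i].
  rewrite /run; case: ifP => // h1; case: ifP => // h2 _ _ su.
  by apply: ev_height => //; lia.
all: rewrite /run; do ![case: ifP => //= ?]; move=> *.
- by apply: ev_zigzag => //; lia.
- by apply: ev_zagzig => //; lia.
- transitivity (p * lay cap cup p q (Cap, i) F u + q * lay cap cup p q (Cap, i.+1) F u).
    by apply: ev_pos_cap => //; lia.
  by rewrite addrC; symmetry; apply: ev_neg_cap => //; lia.
- transitivity (q * lay cap cup p q (Cap, i) F u + p * lay cap cup p q (Cap, i.+1) F u).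
    (* A negative crossing is, up to conversion, a positive one with [p] and [q] exchanged. *)
    by apply: (ev_pos_cap q p) => //; lia.
  by rewrite addrC; symmetry; apply: (ev_neg_cap q p) => //; lia.
- transitivity (p * lay cap cup p q (Cup, i) F u + q * lay cap cup p q (Cup, i.+1) F u).
    by apply: ev_cup_pos => //; lia.
  by rewrite addrC; symmetry; apply: ev_cup_neg => //; lia.
- transitivity (q * lay cap cup p q (Cup, i) F u + p * lay cap cup p q (Cup, i.+1) F u).
    by apply: (ev_cup_pos q p) => //; lia.
  by rewrite addrC; symmetry; apply: (ev_cup_neg q p) => //; lia.
Qed.

(** * The spin model over [Lam] and the bracket *)

Lemma lam_den_unit (x : Lam) k ms :
  lam_val x = FracField.tofrac (lam_den k ms) -> x \is a GRing.unit.
Proof.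
move=> xE; have yP : 1 / FracField.tofrac (lam_den k ms) \in lam_pred.
  by apply/lam_predP; exists 1, k, ms; rewrite tofrac1.
apply/unitrPr; exists (MkLam yP); apply: val_inj; rewrite rmorphM rmorph1 /= xE.
by rewrite mul1r divff // tofrac_eq0 lam_den_neq0.
Qed.

Lemma lam_val_lamA : lam_val lamA = FracField.tofrac 'X.
Proof. by rewrite lamA.unlock. Qed.

Lemma lamA_unit : lamA \is a GRing.unit.
Proof.
apply: (@lam_den_unit _ 1 [::]); rewrite lam_val_lamA.
by rewrite /lam_den big_nil mulr1.
Qed.

Lemma lamA_exp_sub1_unit m : lamA ^+ m.+1 - 1 \is a GRing.unit.
Proof.
apply: (@lam_den_unit _ 0 [:: m]); rewrite /lam_den big_seq1 expr0 mul1r.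
by rewrite -[lam_val _]/(val _) rmorphB rmorphXn rmorph1 /= lam_val_lamA tofracB tofrac1 tofracXn.
Qed.

Lemma lamA_diff_unit m : lamA ^+ m.+1 - lamA ^- m.+1 \is a GRing.unit.
Proof.
have Au := unitrX m.+1 lamA_unit.
rewrite (_ : _ - _ = (lamA ^+ (m.*2.+1.+1) - 1) / lamA ^+ m.+1); last first.
  by rewrite -doubleS -addnn exprD mulrBl mulrK // mul1r.
by rewrite unitrM unitrV Au lamA_exp_sub1_unit.
Qed.

Lemma Delta0 : Delta 0 = 1.
Proof. by rewrite /Delta expr0 mul1r divrr // lamA_diff_unit. Qed.

Lemma Delta1 : Delta 1 = delta.
Proof.
rewrite /Delta /delta expr1 mulN1r; apply: (mulIr (lamA_diff_unit 1)).
rewrite divrK ?lamA_diff_unit // -!exprVn.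
have := mulrV lamA_unit; set a := lamA; set b := a^-1 => ab.
by rewrite mulrBl !mulrBr; ring: ab.
Qed.

Lemma Delta_unit m : Delta m \is a GRing.unit.
Proof.
by rewrite /Delta !unitrM unitrV unitrX ?unitrN1 // mulnS !lamA_diff_unit.
Qed.

(** The Chebyshev recursion; it turns [delta - Delta m / Delta m.+1], which arises in partial
    traces, into [Delta m.+2 / Delta m.+1]. *)
Lemma Delta_rec m : delta * Delta m.+1 = Delta m.+2 + Delta m.
Proof.
rewrite /delta /Delta mulrA -mulrDl; congr (_ / _).
have := mulrV lamA_unit; rewrite -!exprVn.
set a := lamA; set b := a^-1 => ab.
rewrite !mulnS !exprD.
have ab2 : a ^+ 2 * b ^+ 2 = 1 by rewrite -exprMn ab expr1n.
by rewrite !(exprS (-1)); ring: ab2.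
Qed.

(** [true] is the upward spin.  This is the usual spin representation of the
    Temperley-Lieb category, normalized so that [spin_cup] is
    [- lamA ^+ 2] times the transpose of [spin_cap]. *)
Definition spin_cap (a b : bool) : Lam :=
  if a then (if b then 0 else 1) else (if b then - lamA ^- 2 else 0).
Definition spin_cup (a b : bool) : Lam :=
  if a then (if b then 0 else - lamA ^+ 2) else (if b then 1 else 0).
Definition spin : seq layer -> (seq bool -> Lam) -> seq bool -> Lam :=
  ev spin_cap spin_cup lamA lamA^-1.

Lemma lamA2VK : - lamA ^+ 2 * - lamA ^- 2 = 1.
Proof. by rewrite mulrNN divrr // unitrX ?lamA_unit. Qed.

Lemma spin_zigzag a c :
  spin_cup c true * spin_cap true a + spin_cup c false * spin_cap false a = (a == c)%:R.
Proof.
by case: a; case: c; rewrite /= ?lamA2VK ?mul0r ?mulr0 ?mulr1 ?addr0 ?add0r.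
Qed.

Lemma spin_zagzig a d :
  spin_cap a true * spin_cup true d + spin_cap a false * spin_cup false d = (a == d)%:R.
Proof.
by case: a; case: d; rewrite /= ?[- lamA ^- 2 * _]mulrC ?lamA2VK
  ?mul0r ?mulr0 ?mul1r ?addr0 ?add0r.
Qed.

Lemma spin_loop_value : loop_value spin_cap spin_cup = delta.
Proof. by rewrite /loop_value /delta /= !mul0r !mulr1 mul1r add0r addr0. Qed.

Lemma run_catl k w w' m : run k (w ++ w') = Some m ->
  exists2 l, run k w = Some l & run l w' = Some m.
Proof. by rewrite run_cat; case: (run k w) => //= l; exists l. Qed.

Lemma spin_context n k p x y q F u :
  run n p = Some k -> size u = n ->
  (forall G v, size v = k -> spin x G v = spin y G v) ->
  spin (p ++ x ++ q) F u = spin (p ++ y ++ q) F u.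
Proof.
move=> rp su xy; rewrite /spin !ev_cat; apply: ev_eq rp _ _ su => v sv.
exact: xy.
Qed.

(** Makes evaluation in the spin model, at a fixed state, a functional on the skein module. *)
Lemma spin_rel n m F u (v : formal n m) : size u = n -> skein_rel v ->
  extend_formal (fun s => spin (tword s) F u : Lam^o) v = 0.
Proof.
move=> su; case.
- move=> x y s t p q xy es et; rewrite extend_formalB !extend_formalU.
  apply/eqP; rewrite subr_eq0; apply/eqP; rewrite es et.
  have /eqP := tword_run s; have /eqP := tword_run t; rewrite es et.
  move=> /run_catl[k rp /run_catl[k1 ry rq]] rs.
  apply: (spin_context _ _ rp su) => G w sw.
  apply: (isotopy_ev lamA lamA^-1 spin_zigzag spin_zagzig) (xy) _ _ sw; last by rewrite ry.
  by move: rs; rewrite run_cat rp /= run_cat; case: run.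
- move=> i s t p q es et; rewrite extend_formal_rel2; apply/eqP; rewrite subr_eq0; apply/eqP.
  have /eqP := tword_run s; rewrite es => /run_catl[k rp /run_catl[k1 rx rq]].
  rewrite et /spin !ev_cat -[RHS]evZ; apply: ev_eq rp _ _ su => w sw.
  rewrite ev_loop ?spin_loop_value //; move: rx => /=; case: ifP => //; lia.
- move=> i s t r p q es et er; rewrite extend_formal_rel3; apply/eqP; rewrite subr_eq0; apply/eqP.
  have /eqP := tword_run s; rewrite es => /run_catl[k rp /run_catl[k1 rx rq]].
  rewrite et er /spin !ev_cat -[X in _ + X]evZ -[RHS]evP; apply: ev_eq rp _ _ su => w sw.
  rewrite [LHS]lay_pos //; move: rx => /=; case: ifP => //; lia.
- move=> i s t r p q es et er; rewrite extend_formal_rel3; apply/eqP; rewrite subr_eq0; apply/eqP.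
  have /eqP := tword_run s; rewrite es => /run_catl[k rp /run_catl[k1 rx rq]].
  rewrite et er /spin !ev_cat -[X in _ + X]evZ -[RHS]evP; apply: ev_eq rp _ _ su => w sw.
  rewrite [LHS]lay_neg //; move: rx => /=; case: ifP => //; lia.
Qed.

(** [stack], [wid], [clo] and [sflip] are not bundled as linear maps; the usual consequences are
    drawn from the bare linearity law. *)
Section Lin.
Variables (V W : lmodType Lam) (f : V -> W).
Hypothesis fP : forall a u v, f (a *: u + v) = a *: f u + f v.

Lemma lin0 : f 0 = 0.
Proof.
have := fP 1 0 0; rewrite !scale1r addr0 => /eqP.
by rewrite -subr_eq0 opprD addrA subrr sub0r oppr_eq0 => /eqP.
Qed.

Lemma linD u v : f (u + v) = f u + f v.
Proof. by rewrite -[u in LHS]scale1r fP scale1r. Qed.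

Lemma linZ a u : f (a *: u) = a *: f u.
Proof. by rewrite -[a *: u]addr0 fP lin0 addr0. Qed.

Lemma linB u v : f (u - v) = f u - f v.
Proof. by rewrite -scaleN1r linD linZ scaleN1r. Qed.

Lemma lin_sum (I : Type) (r : seq I) (F : I -> V) : f (\sum_(i <- r) F i) = \sum_(i <- r) f (F i).
Proof. by elim: r => [|i r IHr]; rewrite ?big_nil ?lin0 // !big_cons linD IHr. Qed.

End Lin.

(** The coefficient chosen by [xget] is unique because the spin model takes the value 1 on the empty
    diagram. *)
Lemma bracket_scale c : bracket (c *: cls (tangle_id 0)) = c.
Proof.
pose F (s : tangle 0 0) : Lam^o := spin (tword s) (fun=> 1) [::].
have F_rel (v : formal 0 0) : skein_rel v -> extend_formal F v = 0 by exact: spin_rel.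
have VE a : extend F (a *: cls (tangle_id 0)) = a.
  by rewrite (linZ (extendP F_rel)) (extend_cls F_rel) [LHS]mulr1.
rewrite /bracket; case: xgetP => [b -> /(congr1 (extend F))|].
  by rewrite !VE.
by move=> /(_ c) [].
Qed.

(** * Reduction of crossing-free words *)

(** [red c w w']: [w] is [delta ^+ c] times [w'] for reasons that are valid in
    every state model. *)
Inductive red : nat -> seq layer -> seq layer -> Prop :=
| red_refl w : red 0 w w
| red_trans c d w1 w2 w3 : red c w1 w2 -> red d w2 w3 -> red (c + d) w1 w3
| red_catr c w w' q : red c w w' -> red c (w ++ q) (w' ++ q)
| red_loop p i : red 1 (p ++ [:: (Cup, i); (Cap, i)]) p
| red_zigzag p i : red 0 (p ++ [:: (Cup, i); (Cap, i.+1)]) p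
| red_zagzig p i : red 0 (p ++ [:: (Cup, i.+1); (Cap, i)]) p
| red_left p i j : (i <= j)%N ->
    red 0 (p ++ [:: (Cup, i); (Cap, j + 2)%N]) (p ++ [:: (Cap, j); (Cup, i)])
| red_right p i j : (i <= j)%N ->
    red 0 (p ++ [:: (Cup, j + 2)%N; (Cap, i)]) (p ++ [:: (Cap, i); (Cup, j)]).

Lemma red_run c w w' n m : red c w w' -> run n w = Some m -> run n w' = Some m.
Proof.
move=> r; elim: r n m => {c w w'} //.
- by move=> c d w1 w2 w3 _ IH1 _ IH2 n m /IH1/IH2.
- by move=> c w w' q _ IH n m /run_catl[k /IH rw' rq]; rewrite run_cat rw'.
- move=> p i n m /run_catl[k ->] /=; do ![case: ifP => // ?]; move=> [<-]; congr Some; lia.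
- move=> p i n m /run_catl[k ->] /=; do ![case: ifP => // ?]; move=> [<-]; congr Some; lia.
- move=> p i n m /run_catl[k ->] /=; do ![case: ifP => // ?]; move=> [<-]; congr Some; lia.
- move=> p i j le_ij n m /run_catl[k rp] rk; rewrite run_cat rp /=; move: rk => /=.
  do 2![case: ifP => // ?]; move=> [<-]; rewrite !ifT; first (congr Some); lia.
- move=> p i j le_ij n m /run_catl[k rp] rk; rewrite run_cat rp /=; move: rk => /=.
  do 2![case: ifP => // ?]; move=> [<-]; rewrite !ifT; first (congr Some); lia.
Qed.

Section RedModel.
Variables (R : comNzRingType) (cap cup : bool -> bool -> R) (p q : R).
Hypothesis zz : forall a c, cup c true * cap true a + cup c false * cap false a = (a == c)%:R.
Hypothesis zs : forall a d, cap a true * cup true d + cap a false * cup false d = (a == d)%:R.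
Notation eval := (ev cap cup p q).

Lemma red_ev c w w' n m F u : red c w w' -> run n w = Some m -> size u = n ->
  eval w F u = loop_value cap cup ^+ c * eval w' F u.
Proof.
move=> r; elim: r n m F u => {c w w'}.
- by move=> *; rewrite expr0 mul1r.
- move=> c d w1 w2 w3 r1 IH1 _ IH2 n m F u rw su.
  by rewrite (IH1 _ _ _ _ rw su) (IH2 _ _ _ _ (red_run r1 rw) su) mulrA exprD.
- move=> c w w' q' _ IH n m F u /run_catl[k rw _] su.
  by rewrite !ev_cat (IH _ _ _ _ rw su).
- move=> p' i n m F u /run_catl[k rp rk] su; rewrite ev_cat expr1 -evZ.
  apply: (ev_eq _ _ _ _ rp _ su) => v sv; apply: ev_loop.
  by move: rk => /=; case: ifP => //; lia.
- move=> p' i n m F u /run_catl[k rp rk] su; rewrite ev_cat expr0 mul1r.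
  apply: (ev_eq _ _ _ _ rp _ su) => v sv; apply: ev_zigzag => //.
  by move: rk => /=; do 2![case: ifP => // ?]; lia.
- move=> p' i n m F u /run_catl[k rp rk] su; rewrite ev_cat expr0 mul1r.
  apply: (ev_eq _ _ _ _ rp _ su) => v sv; apply: ev_zagzig => //.
  by move: rk => /=; do 2![case: ifP => // ?]; lia.
- move=> p' i j le_ij n m F u /run_catl[k rp rk] su; rewrite !ev_cat expr0 mul1r.
  apply: (ev_eq _ _ _ _ rp _ su) => v sv.
  have := @ev_height _ cap cup p q Cup Cap i j F v le_ij; rewrite addn0; apply.
  by move: rk => /=; do 2![case: ifP => // ?]; lia.
- move=> p' i j le_ij n m F u /run_catl[k rp rk] su; rewrite !ev_cat expr0 mul1r.
  apply: (ev_eq _ _ _ _ rp _ su) => v sv.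
  have := @ev_height _ cap cup p q Cap Cup i j F v le_ij; rewrite /= !addn0 => ->//.
  by move: rk => /=; do 2![case: ifP => // ?]; lia.
Qed.

End RedModel.

(** The continuation [q] is quantified inside the induction, so that [red_catr] merely lengthens
    it. *)
Lemma red_cls c w w' : red c w w' -> forall q n m (s t : tangle n m),
  tword s = w ++ q -> tword t = w' ++ q -> cls s = delta ^+ c *: cls t.
Proof.
elim=> {c w w'}.
- move=> w q n m s t es et; rewrite expr0 scale1r; congr cls.
  by apply: val_inj; rewrite /= es et.
- move=> c d w1 w2 w3 r1 IH1 _ IH2 q n m s t es et.
  have rP : run n (w2 ++ q) == Some m.
    have /eqP := tword_run s; rewrite es => /run_catl[k /(red_run r1) r2].
    by rewrite run_cat r2 /= => ->.
  by rewrite (IH1 _ _ _ s (Tangle rP) es erefl) (IH2 _ _ _ (Tangle rP) t erefl et) scalerA exprD.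
- by move=> c w w' q _ IH q' n m s t; rewrite -!catA; exact: IH.
- move=> p i q n m s t; rewrite -catA => es et; rewrite expr1; exact: skein_loopE es et.
- move=> p i q n m s t; rewrite -catA => es et; rewrite expr0 scale1r.
  exact: skein_isotopyE (iso_zigzag i) es et.
- move=> p i q n m s t; rewrite -catA => es et; rewrite expr0 scale1r.
  exact: skein_isotopyE (iso_zagzig i) es et.
- move=> p i j le_ij q n m s t; rewrite -!catA => es et; rewrite expr0 scale1r.
  have := iso_height Cup Cap le_ij; rewrite addn0 => /skein_isotopyE.
  by apply; [exact: es|exact: et].
- move=> p i j le_ij q n m s t; rewrite -!catA => es et; rewrite expr0 scale1r; symmetry.
  have := iso_height Cap Cup le_ij; rewrite /= !addn0 => /skein_isotopyE.
  by apply; [exact: et|exact: es].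
Qed.

Definition cap_word (w : seq layer) := all (fun l => l.1 == Cap) w.
Definition planar_layer (l : layer) := (l.1 == Cap) || (l.1 == Cup).
Definition planar (w : seq layer) := all planar_layer w.

(** Only a maximum placed directly above a final minimum needs work: either the two cancel, or they
    are distant and the minimum slides up past the maximum. The size bound makes the induction
    available again after a cancellation. *)
Lemma planar_red w : planar w -> exists c w',
  [/\ red c w w', planar w', (size w' <= size w)%N
    & cap_word w' \/ exists w'' i, w' = rcons w'' (Cup, i)].
Proof.
elim: {w}_.+1 {-2}w (ltnSn (size w)) => // N IH w.
case/lastP: w => [|w l]; first by exists 0%N, [::]; split=> //; [exact: red_refl | left].
rewrite size_rcons ltnS /planar all_rcons => sw /andP[pl pw].
have [c [w1 [r1 p1 s1 e1]]] := IH w sw pw.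
have rl : red c (rcons w l) (rcons w1 l) by rewrite -!cats1; exact: red_catr.
case: l pl rl => x j; rewrite /planar_layer /= => /orP[] /eqP-> rl; last first.
  exists c, (rcons w1 (Cup, j)); rewrite !size_rcons ltnS all_rcons; split=> //.
  by right; exists w1, j.
case: e1 => [cw1|[w2 [i ew]]].
  exists c, (rcons w1 (Cap, j)); rewrite !size_rcons ltnS all_rcons; split=> //.
  by left; rewrite /cap_word all_rcons.
have [s2 p2] : (size w2 < size w)%N /\ planar w2.
  by move: s1 p1; rewrite ew size_rcons /planar all_rcons => ? /andP[].
(* Cancellation exposes the arbitrary end of [w2], which is reduced anew. *)
have shrink d : red d (rcons w1 (Cap, j)) w2 -> exists c w',
    [/\ red c (rcons w (Cap, j)) w', planar w', (size w' <= (size w).+1)%N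
      & cap_word w' \/ exists w'' i, w' = rcons w'' (Cup, i)].
  move=> r2; have [|e [w3 [r3 p3 s3 e3]]] := IH w2 _ p2; first exact: ltn_trans s2 sw.
  exists (c + d + e)%N, w3; split=> //; last first.
    by apply: leq_trans s3 _; exact: leq_trans (ltnW s2) (leqnSn _).
  exact: red_trans (red_trans rl r2) r3.
have w1E : rcons w1 (Cap, j) = w2 ++ [:: (Cup, i); (Cap, j)].
  by rewrite ew -!cats1 -catA.
(* After a slide the word ends with a minimum again, so nothing is left to reduce. *)
have swap i' j' : red 0 (rcons w1 (Cap, j)) (w2 ++ [:: (Cap, j'); (Cup, i')]) -> exists c w',
    [/\ red c (rcons w (Cap, j)) w', planar w', (size w' <= (size w).+1)%N
      & cap_word w' \/ exists w'' i, w' = rcons w'' (Cup, i)].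
  move=> r2; exists (c + 0)%N, (rcons (rcons w2 (Cap, j')) (Cup, i')).
  rewrite /planar !size_rcons !all_rcons /=; split=> //; last first.
    by right; exists (rcons w2 (Cap, j')), i'.
  by apply: red_trans rl _; move: r2; rewrite -!cats1 -!catA.
have [lt_ij|lt_ji|e_ij] := ltngtP i j.
- have [e_j|ne_j] := eqVneq j i.+1.
    by apply: (shrink 0%N); rewrite w1E e_j; exact: red_zigzag.
  apply: (swap i (j - 2)%N); rewrite w1E.
  by have := @red_left w2 i (j - 2)%N; rewrite subnK; [apply|]; lia.
- have [e_i|ne_i] := eqVneq i j.+1.
    by apply: (shrink 0%N); rewrite w1E e_i; exact: red_zagzig.
  apply: (swap (i - 2)%N j); rewrite w1E.
  by have := @red_right w2 j (i - 2)%N; rewrite subnK; [apply|]; lia.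
- by apply: (shrink 1%N); rewrite w1E e_ij; exact: red_loop.
Qed.

Lemma run_cap_word n m w : cap_word w -> run n w = Some m -> n = (m + (size w).*2)%N.
Proof.
elim: w n => [n _ [->]|[x i] w IHw n /= /andP[/eqP /= -> /IHw IH]] /=; first by rewrite addn0.
by case: ifP => // le_n /IH; lia.
Qed.

Lemma planar_endo h w : planar w -> run h w = Some h -> exists c,
  red c w [::] \/ exists w' i, red c w (rcons w' (Cup, i)).
Proof.
move=> pw rw; have [c [w' [r' p' _ [cw'|[w'' [i ew]]]]]] := planar_red pw; exists c.
  (* Each maximum loses two strands; equal numbers at both ends leave the empty word. *)
  left; have := run_cap_word cw' (red_run r' rw).
  by case: (w') r' => //= l w1 _; lia.
by right; exists w'', i; rewrite -ew.
Qed.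

(** * Skein algebra *)

(** Diagrams generate the skein module; the identities below are thereby reduced, one argument at a
    time, to identities between words. *)
Lemma lin_ext n m (W : lmodType Lam) (f g : skein n m -> W) :
  (forall a u v, f (a *: u + v) = a *: f u + f v) ->
  (forall a u v, g (a *: u + v) = a *: g u + g v) ->
  (forall t, f (cls t) = g (cls t)) -> f =1 g.
Proof.
move=> fP gP fg u; rewrite -[u]skein_reprK.
pose h (v : formal n m) := f (skein_pi v); pose k v := g (skein_pi v).
have hP a v w : h (a *: v + w) = a *: h v + h w by rewrite /h skein_piD skein_pi_scale fP.
have kP a v w : k (a *: v + w) = a *: k v + k w by rewrite /k skein_piD skein_pi_scale gP.
rewrite -/(h _) -/(k _) [skein_repr u]monalgE (lin_sum hP) (lin_sum kP).
apply: eq_bigr => t _; set c := (skein_repr u)@_t.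
have -> : << c *g t >> = c *: (<< t >> : formal n m).
  by apply/malgP => s; rewrite mcoeffZ !mcoeffU mulr_natr.
by rewrite (linZ hP) (linZ kP); congr (_ *: _); rewrite /h /k; have := fg t; rewrite cls.unlock.
Qed.

Section StackLinear.
Variables n m k : nat.
Implicit Types (u : skein m k) (v : skein n m).

Lemma stackBl u u' v : stack (u - u') v = stack u v - stack u' v.
Proof. exact: (linB (fun a u u' => stackPl a u u' v)). Qed.
Lemma stackBr u v v' : stack u (v - v') = stack u v - stack u v'.
Proof. exact: (linB (fun a v v' => stackPr a u v v')). Qed.
Lemma stackDl u u' v : stack (u + u') v = stack u v + stack u' v.
Proof. exact: (linD (fun a u u' => stackPl a u u' v)). Qed.
Lemma stackDr u v v' : stack u (v + v') = stack u v + stack u v'.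
Proof. exact: (linD (fun a v v' => stackPr a u v v')). Qed.
Lemma stackZl a u v : stack (a *: u) v = a *: stack u v.
Proof. exact: (linZ (fun a u u' => stackPl a u u' v)). Qed.
Lemma stackZr a u v : stack u (a *: v) = a *: stack u v.
Proof. exact: (linZ (fun a v v' => stackPr a u v v')). Qed.
Lemma stack0l v : stack (0 : skein m k) v = 0.
Proof. exact: (lin0 (fun a u u' => stackPl a u u' v)). Qed.
Lemma stack0r u : stack u (0 : skein n m) = 0.
Proof. exact: (lin0 (fun a v v' => stackPr a u v v')). Qed.
End StackLinear.

Lemma stackA n m k l (u : skein k l) (v : skein m k) (w : skein n m) :
  stack u (stack v w) = stack (stack u v) w.
Proof.
apply: (lin_ext (f := fun u => stack u (stack v w))
  (g := fun u => stack (stack u v) w)) => [a x y|a x y|s];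
  rewrite ?stackPl //.
apply: (lin_ext (f := fun v => stack (cls s) (stack v w))
  (g := fun v => stack (stack (cls s) v) w)) => [a x y|a x y|t].
- by rewrite stackPl stackPr.
- by rewrite stackPr stackPl.
apply: (lin_ext (f := fun w => stack (cls s) (stack (cls t) w))
  (g := fun w => stack (stack (cls s) (cls t)) w)) => [a x y|a x y|r].
- by rewrite !stackPr.
- by rewrite stackPr.
by rewrite !stack_cls; congr cls; apply: val_inj; rewrite /= catA.
Qed.

Lemma stack1l n m (u : skein n m) : stack (TL_one m) u = u.
Proof.
apply: (lin_ext (f := stack (TL_one m)) (g := id)) u => [a x y||t] //; first exact: stackPr.
by rewrite stack_cls; congr cls; apply: val_inj; rewrite /= cats0.
Qed.

Lemma stack1r n m (u : skein n m) : stack u (TL_one n) = u.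
Proof.
apply: (lin_ext (f := fun u => stack u (TL_one n)) (g := id)) u => [a x y||t] //; first exact: stackPl.
by rewrite stack_cls; congr cls; apply: val_inj.
Qed.

(** Junk value [0] when the word does not fit. *)
Definition wcls n m (w : seq layer) : skein n m := oapp (@cls n m) 0 (insub w).

Lemma wclsE n m (t : tangle n m) : wcls n m (tword t) = cls t.
Proof. by rewrite /wcls (valK t). Qed.

Lemma wcls_tangle n m w (wP : run n w == Some m) : wcls n m w = cls (Tangle wP).
Proof. by rewrite -wclsE. Qed.

Lemma wcls_stack n m k w w' : run n w = Some m -> run m w' = Some k ->
  stack (wcls m k w') (wcls n m w) = wcls n k (w ++ w').
Proof.
move=> /eqP wP /eqP wP'; rewrite (wcls_tangle wP) (wcls_tangle wP') stack_cls.
by rewrite -wclsE.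
Qed.

Lemma run_comp n m w w' : run n w = Some m -> run n (w ++ w') = run m w'.
Proof. by rewrite run_cat => ->. Qed.

Lemma red_wcls c w w' q n m : red c w w' -> run n (w ++ q) = Some m ->
  wcls n m (w ++ q) = delta ^+ c *: wcls n m (w' ++ q).
Proof.
move=> r rw; have rw' : run n (w' ++ q) = Some m.
  by move: rw => /run_catl[k /(red_run r) r2]; rewrite run_cat r2.
move/eqP: rw => rw; move/eqP: rw' => rw'.
by rewrite (wcls_tangle rw) (wcls_tangle rw'); exact: red_cls r _ _ _ _ _ _ _.
Qed.

Lemma iso_wcls n m p x y q : isotopy x y ->
  run n (p ++ x ++ q) = Some m -> run n (p ++ y ++ q) = Some m ->
  wcls n m (p ++ x ++ q) = wcls n m (p ++ y ++ q).
Proof.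
move=> xy /eqP rx /eqP ry; rewrite (wcls_tangle rx) (wcls_tangle ry).
exact: (skein_isotopyE (p := p) (q := q) xy).
Qed.

(** A layer to the right of all the strands of [w] can be moved below [w]. *)
Lemma wcls_slide n m k l r w y j p q : run k w = Some l ->
  run n p = Some (k + (j + ends_below y + r))%N ->
  run n (p ++ w ++ [:: (y, l + j)%N] ++ q) = Some m ->
  wcls n m (p ++ w ++ [:: (y, l + j)%N] ++ q) =
  wcls n m (p ++ [:: (y, k + j)%N] ++ w ++ q).
Proof.
elim: w k p => [k p [->] //|[x i] w IHw k p] /=; case: ifP => // le_k rl rp.
rewrite -cat_rcons => rt; rewrite (IHw _ _ rl) //; last first.
  rewrite -cats1 run_cat rp /= ifT; last lia.
  by congr Some; lia.
rewrite cat_rcons.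
have e1 : (k - ends_below x + ends_above x + j = k - ends_below x + j + ends_above x)%N by lia.
have e2 : (k + j = k - ends_below x + j + ends_below x)%N by lia.
have rs : run n (p ++ [:: (x, i); (y, k - ends_below x + j + ends_above x)%N] ++ w ++ q) == Some m.
  move: rt; rewrite cat_rcons !run_cat rp /= ifT; last lia.
  have := run_widen (j + ends_below y + r) rl; rewrite !run_cat.
  rewrite (_ : (k + (j + ends_below y + r) - _ + _ =
    k - ends_below x + ends_above x + (j + ends_below y + r)))%N; last lia.
  move=> -> /=; rewrite !ifT; try lia.
  rewrite (_ : (k - _ + _ + _ - _ + _ =
    k - ends_below x + ends_above x + (j + ends_above y + r))%N); last lia.
  by rewrite (run_widen _ rl) /= => <-; apply/eqP; congr run; lia.
have rt' : run n (p ++ [:: (y, k - ends_below x + j + ends_below x)%N; (x, i)] ++ w ++ q) == Some m.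
  move: rs; rewrite !run_cat rp /= !ifT; try lia.
  by move=> /eqP <-; apply/eqP; congr (run _ _); lia.
rewrite e1 e2; have le_ij : (i <= k - ends_below x + j)%N by lia.
exact: (iso_wcls (iso_height x y le_ij) (eqP rs) (eqP rt')).
Qed.

(** Recasts [tangle_widen 1] from [n + 1] to [n.+1], the index of the recursion for the
    idempotents. *)
Lemma widen1P n m (t : tangle n m) : run n.+1 (tword t) == Some m.+1.
Proof. by have := tangle_widenP 1 t; rewrite !addn1. Qed.
Definition widen1 n m (t : tangle n m) : tangle n.+1 m.+1 := Tangle (widen1P t).

Definition wid n m (u : skein n m) : skein n.+1 m.+1 := extend (fun t => cls (widen1 t)) u.

Lemma wid_rel n m (u : formal n m) :
  skein_rel u -> extend_formal (fun t => cls (widen1 t)) u = 0.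
Proof. by apply: (cls_context (p := [::]) (q := [::])) => t; rewrite cats0. Qed.

Lemma wid_cls n m (t : tangle n m) : wid (cls t) = cls (widen1 t).
Proof. exact: (extend_cls (@wid_rel n m)). Qed.

Lemma widP n m a (u v : skein n m) : wid (a *: u + v) = a *: wid u + wid v.
Proof. exact: (extendP (@wid_rel n m)). Qed.

Lemma wid_wcls n m w : run n w = Some m -> wid (wcls n m w) = wcls n.+1 m.+1 w.
Proof. by move=> /eqP rw; rewrite (wcls_tangle rw) wid_cls -wclsE. Qed.

Lemma wid_stack n m k (u : skein m k) (v : skein n m) : wid (stack u v) = stack (wid u) (wid v).
Proof.
apply: (lin_ext (f := fun u => wid (stack u v)) (g := fun u => stack (wid u) (wid v)))
  => [a x y|a x y|s]; rewrite ?stackPl ?widP ?stackPl //.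
apply: (lin_ext (f := fun v => wid (stack (cls s) v)) (g := fun v => stack (wid (cls s)) (wid v)))
  => [a x y|a x y|t]; rewrite ?stackPr ?widP ?stackPr //.
by rewrite !(stack_cls, wid_cls); congr cls; apply: val_inj.
Qed.

Lemma wid_one n : wid (TL_one n) = TL_one n.+1.
Proof. by rewrite wid_cls; congr cls; apply: val_inj. Qed.

(** * Temperley-Lieb relations *)

Definition e_word i : seq layer := [:: (Cap, i); (Cup, i)].
(** The position is a plain number rather than an ordinal, so that it is unchanged when strands are
    added. *)
Definition TLe m i : TL m := wcls m m (e_word i).

Lemma e_wordP m i : (i.+1 < m)%N -> run m (e_word i) = Some m.
Proof. by move=> lt_im /=; rewrite !ifT; first (congr Some); lia. Qed.

Lemma TLeE m (i : 'I_m.-1) : TLe m i = TL_e i.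
Proof. by rewrite /TLe (wcls_tangle (TL_eP i)). Qed.

Lemma TLe_wid m i : (i.+1 < m)%N -> wid (TLe m i) = TLe m.+1 i.
Proof. by move=> lt_im; rewrite /TLe wid_wcls // e_wordP. Qed.

Lemma TLe_sqr m i : (i.+1 < m)%N -> stack (TLe m i) (TLe m i) = delta *: TLe m i.
Proof.
move=> lt_im; rewrite /TLe (wcls_stack (e_wordP lt_im) (e_wordP lt_im)).
have r := red_catr [:: (Cup, i)] (red_loop [:: (Cap, i)] i).
have := red_wcls (q := [::]) (n := m) (m := m) r.
rewrite !cats0 expr1 => -> //.
by rewrite -[_ ++ _]/(e_word i ++ e_word i) (run_comp _ (e_wordP lt_im)) e_wordP.
Qed.

Lemma TLe_braid m i : (i.+2 < m)%N ->
  stack (TLe m i.+1) (stack (TLe m i) (TLe m i.+1)) = TLe m i.+1.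
Proof.
move=> lt_im; have lt_im' := ltnW lt_im.
rewrite /TLe (wcls_stack (e_wordP lt_im) (e_wordP lt_im')).
have rr : run m (e_word i.+1 ++ e_word i) = Some m.
  by rewrite (run_comp _ (e_wordP lt_im)) e_wordP.
rewrite (wcls_stack rr (e_wordP lt_im)).
have r1 := red_catr [:: (Cup, i); (Cap, i.+1); (Cup, i.+1)] (red_zagzig [:: (Cap, i.+1)] i).
have r2 := red_catr [:: (Cup, i.+1)] (red_zigzag [:: (Cap, i.+1)] i).
have := red_wcls (q := [::]) (n := m) (m := m) (red_trans r1 r2).
rewrite !cats0 addn0 expr0 scale1r => -> //.
rewrite -[_ ++ _]/(e_word i.+1 ++ e_word i ++ e_word i.+1).
by rewrite catA (run_comp _ rr) e_wordP.
Qed.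

(** The generator lies to the right of [u]; its maximum and then its minimum slide down past [u]. *)
Lemma TLe_comm k (u : TL k) :
  stack (TLe k.+2 k) (wid (wid u)) = stack (wid (wid u)) (TLe k.+2 k).
Proof.
apply: (lin_ext (f := fun u => stack (TLe k.+2 k) (wid (wid u)))
  (g := fun u => stack (wid (wid u)) (TLe k.+2 k))) => [a x y|a x y|t].
- by rewrite !widP stackPr.
- by rewrite !widP stackPl.
rewrite !wid_cls -!wclsE /= /TLe; have /eqP rt := tword_run t.
have rt2 : run k.+2 (tword t) = Some k.+2 by have /eqP := widen1P (widen1 t).
have re : run k.+2 (e_word k) = Some k.+2 by apply: e_wordP.
rewrite !(wcls_stack rt2 re) (wcls_stack re rt2).
have h1 : run k.+2 [::] = Some (k + (0 + ends_below Cap + 0))%N by rewrite addn2.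
have h2 : run k.+2 ([::] ++ tword t ++ [:: (Cap, k + 0)%N] ++ [:: (Cup, k)]) = Some k.+2.
  by rewrite addn0 [LHS](run_comp _ rt2).
have h3 : run k.+2 [:: (Cap, k)] = Some (k + (0 + ends_below Cup + 0))%N.
  by rewrite /= addn2 leqnn addn0; congr Some; lia.
have h4 : run k.+2 ([:: (Cap, k)] ++ tword t ++ [:: (Cup, k + 0)%N] ++ [::]) = Some k.+2.
  by rewrite (run_comp _ h3) !addn0 cats0 (run_comp _ rt) /= addn0 leqnn; congr Some; lia.
have := wcls_slide rt h1 h2; rewrite !addn0 => E1.
have := wcls_slide rt h3 h4; rewrite !addn0 !cats0 => E2.
exact: etrans E1 E2.
Qed.

(** * Jones-Wenzl idempotents *)

(** Wenzl's recursion. The inner match isolates the passage from 0 to 1 strands, where there is no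
    generator to correct for. *)
Fixpoint wenzl (m : nat) : TL m :=
  if m is k.+1 then
    match k return TL k -> TL k.+1 with
    | 0 => fun f => wid f
    | m'.+1 => fun f => wid f - (Delta m' / Delta m'.+1) *:
        stack (wid f) (stack (TLe m'.+2 m') (wid f))
    end (wenzl k)
  else TL_one 0.

Lemma wenzlS m : wenzl m.+2 = wid (wenzl m.+1) - (Delta m / Delta m.+1) *:
  stack (wid (wenzl m.+1)) (stack (TLe m.+2 m) (wid (wenzl m.+1))).
Proof. by []. Qed.

(** The last clause is a partial trace: closing the last strand of [f] gives a multiple of the
    previous idempotent. It strengthens the induction, since it is what makes the next generator
    vanish on the next idempotent. *)
Definition wenzl_props m : Prop :=
  let f := wenzl m.+1 in let g := wid (wenzl m) in
  [/\ stack f f = f,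
      forall i, (i < m)%N -> stack f (TLe m.+1 i) = 0 /\ stack (TLe m.+1 i) f = 0,
      stack g f = f /\ stack f g = f
    & stack (TLe m.+2 m) (stack (wid f) (TLe m.+2 m)) =
      (Delta m.+1 / Delta m) *: stack (wid g) (TLe m.+2 m)].

Lemma wenzlP m : wenzl_props m.
Proof.
elim: m => [|m IH]; rewrite /wenzl_props.
  rewrite -[wenzl 0]/(TL_one 0) -[wenzl 1]/(wid (TL_one 0)) !wid_one !stack1l Delta0 Delta1 divr1.
  by split=> //; exact: TLe_sqr.
have [ff ef [gf fg] efe] := IH.
set r := Delta m / Delta m.+1; set F := wid (wenzl m.+1); set E := TLe m.+2 m.
set G := wid (wid (wenzl m)).
have f'E : wenzl m.+2 = F - r *: stack F (stack E F) by [].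
have rV : r * (Delta m.+1 / Delta m) = 1.
  by rewrite /r mulrA divrK ?Delta_unit // divrr ?Delta_unit.
have FF : stack F F = F by rewrite -wid_stack ff.
have GF : stack G F = F by rewrite -wid_stack gf.
have FG : stack F G = F by rewrite -wid_stack fg.
have EG : stack E G = stack G E by exact: TLe_comm.
have rEFE : r *: stack E (stack F E) = stack G E by rewrite efe scalerA rV scale1r.
have rFEFE : r *: stack F (stack E (stack F E)) = stack F E.
  by rewrite -stackZr rEFE stackA FG.
have Ff' : stack F (wenzl m.+2) = wenzl m.+2.
  by rewrite f'E stackBr stackZr !stackA FF.
have f'F : stack (wenzl m.+2) F = wenzl m.+2.
  by rewrite f'E stackBl stackZl -!stackA FF.
(* Here the coefficient [r] is decisive: by the partial trace, both terms contribute [stack F E]. *)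
have f'e : stack (wenzl m.+2) E = 0.
  by rewrite f'E stackBl stackZl -!stackA rFEFE subrr.
have ef' : stack E (wenzl m.+2) = 0.
  rewrite f'E stackBr stackZr !stackA -[stack (stack E F) E]stackA -stackZl rEFE.
  by rewrite -EG -stackA GF subrr.
split=> //.
- by rewrite {2}f'E stackBr stackZr !stackA f'F f'e stack0l scaler0 subr0.
- move=> i; rewrite ltnS leq_eqVlt => /orP[/eqP-> //|lt_im].
  have [fe0 ef0] := ef i lt_im.
  have W0 : wid (0 : TL m.+1) = 0 by exact: (lin0 (@widP m.+1 m.+1)).
  have Fe : stack F (TLe m.+2 i) = 0 by rewrite -TLe_wid // -wid_stack fe0 W0.
  have eF : stack (TLe m.+2 i) F = 0 by rewrite -TLe_wid // -wid_stack ef0 W0.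
  split; first by rewrite -f'F -stackA Fe stack0r.
  by rewrite -Ff' stackA eF stack0l.
(* The next partial trace: [E'] commutes with [F'], so the first term produces a loop, and in the
   second [E' e E'] collapses to [E']. *)
set E' := TLe m.+3 m.+1; set F' := wid F; set e := wid E.
have F'F' : stack F' F' = F' by rewrite -wid_stack FF.
have comm : stack E' F' = stack F' E' by exact: TLe_comm.
have E'E' : stack E' E' = delta *: E' by exact: TLe_sqr.
have braid : stack E' (stack e E') = E'.
  by rewrite /e /E TLe_wid //; exact: TLe_braid.
have wE : wid (wenzl m.+2) = F' - r *: stack F' (stack e F').
  rewrite f'E (linB (@widP _ _)) (linZ (@widP _ _)) !wid_stack //.
rewrite wE stackBl stackBr stackZl stackZr.
have -> : stack E' (stack F' E') = delta *: stack F' E'.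
  by rewrite -comm stackA E'E' stackZl.
have -> : stack E' (stack (stack F' (stack e F')) E') = stack F' E'.
  rewrite -!stackA -comm [stack E' (stack F' _)]stackA {1}comm -stackA.
  by rewrite [stack e (stack E' F')]stackA [stack E' (stack _ F')]stackA braid comm stackA F'F'.
rewrite -scalerBl; congr (_ *: _).
have := Delta_rec m; rewrite /r => Drec; apply: (mulIr (Delta_unit m.+1)).
by rewrite mulrBl !divrK ?Delta_unit // Drec addrK.
Qed.

(** [glue_tangle s t] is the closure of [s] placed on the reflection of [t]. *)
Definition closure_tangle m (t : tangle m m) : tangle 0 0 :=
  tangle_comp (tangle_flip (nest m)) (tangle_comp (tangle_widen m t) (nest m)).
Definition clo m (u : TL m) : skein 0 0 := extend (fun t => cls (closure_tangle t)) u.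

Lemma clo_rel m (u : formal m m) :
  skein_rel u -> extend_formal (fun t => cls (closure_tangle t)) u = 0.
Proof.
by apply: (cls_context (p := nest_word m) (q := flip_word (nest_word m))) => t; rewrite /= -!catA.
Qed.

Lemma clo_cls m (t : tangle m m) : clo (cls t) = cls (closure_tangle t).
Proof. exact: (extend_cls (@clo_rel m)). Qed.

Lemma cloP m a (u v : TL m) : clo (a *: u + v) = a *: clo u + clo v.
Proof. exact: (extendP (@clo_rel m)). Qed.

Definition closure_word m w := nest_word m ++ w ++ flip_word (nest_word m).

Lemma clo_wcls m w : run m w = Some m -> clo (wcls m m w) = wcls 0 0 (closure_word m w).
Proof.
move=> rw; rewrite (wcls_tangle (introT eqP rw)) clo_cls -wclsE.
by rewrite /closure_word /= -!catA.
Qed.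

Lemma nest_wordS m : nest_word m.+1 = nest_word m ++ [:: (Cup, m)].
Proof. by rewrite /nest_word -addn1 iotaD map_cat. Qed.

Lemma run_flip_nest m : run (m + m) (flip_word (nest_word m)) = Some 0%N.
Proof. by apply/eqP; exact: tangle_flipP (nest m). Qed.

(** The added strand closes up beside [u]: its minimum slides up to its maximum and they form a
    loop. *)
Lemma clo_wid m (u : TL m) : clo (wid u) = delta *: clo u.
Proof.
apply: (lin_ext (f := fun u => clo (wid u)) (g := fun u => delta *: clo u)) => [a x y|a x y|t].
- by rewrite widP cloP.
- by rewrite cloP scalerDr !scalerA mulrC.
have /eqP rt := tword_run t; have /eqP rt1 := widen1P t.
rewrite -wclsE wid_wcls // !clo_wcls // /closure_word nest_wordS flip_word_cat -catA.
rewrite (_ : flip_word [:: (Cup, m)] = [:: (Cap, m)]) //.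
have rn : run 0 (nest_word m) = Some (m + (0 + ends_below Cup + m))%N by exact/eqP/nestP.
have rnt : run 0 (nest_word m ++ tword t) = Some (m + m)%N.
  by rewrite (run_comp _ rn) (run_widen _ rt).
have rall : run 0 (nest_word m ++ tword t ++ [:: (Cup, m)] ++ [:: (Cap, m)] ++
    flip_word (nest_word m)) = Some 0%N.
  rewrite catA (run_comp _ rnt) /= addn0 leq_addr subn0 leq_add2r leq_addr addnK addn0.
  exact: run_flip_nest.
have := wcls_slide (n := 0) (m := 0) (j := 0) (y := Cup) (p := nest_word m)
  (q := [:: (Cap, m)] ++ flip_word (nest_word m)) rt rn; rewrite !addn0 => <- //.
have := red_wcls (n := 0) (m := 0) (q := flip_word (nest_word m)) (red_loop (nest_word m ++ tword t) m).
by rewrite -!catA expr1; apply.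
Qed.

(** On the left the last closing arc meets only the generator. Pulling it straight, by one zigzag on
    each side, turns the generator into vertical strands. *)
Lemma clo_e m (u v : TL m.+1) :
  clo (stack (wid u) (stack (TLe m.+2 m) (wid v))) = clo (stack u v).
Proof.
apply: (lin_ext (f := fun u => clo (stack (wid u) (stack (TLe m.+2 m) (wid v))))
  (g := fun u => clo (stack u v))) => [a x y|a x y|s].
- by rewrite widP stackPl cloP.
- by rewrite stackPl cloP.
apply: (lin_ext (f := fun v => clo (stack (wid (cls s)) (stack (TLe m.+2 m) (wid v))))
  (g := fun v => clo (stack (cls s) v))) => [a x y|a x y|t].
- by rewrite widP !stackPr cloP.
- by rewrite stackPr cloP.
have /eqP rs := tword_run s; have /eqP rs1 := widen1P s.
have /eqP rt := tword_run t; have /eqP rt1 := widen1P t.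
have re : run m.+2 (e_word m) = Some m.+2 by exact: e_wordP.
have rte : run m.+2 (tword t ++ e_word m) = Some m.+2 by rewrite (run_comp _ rt1).
have rtes : run m.+2 ((tword t ++ e_word m) ++ tword s) = Some m.+2 by rewrite (run_comp _ rte).
have rts : run m.+1 (tword t ++ tword s) = Some m.+1 by rewrite (run_comp _ rt).
rewrite -!wclsE !wid_wcls // /TLe (wcls_stack rt1 re) (wcls_stack rte rs1) (wcls_stack rt rs).
rewrite !clo_wcls // /closure_word nest_wordS flip_word_cat -!catA.
rewrite (_ : flip_word [:: (Cup, m.+1)] = [:: (Cap, m.+1)]) //.
set nw := nest_word m.+1; set fw := flip_word nw.
have rn : run 0 nw = Some (m.+1 + (0 + ends_below Cup + m.+1))%N by exact/eqP/nestP.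
have rf : run (m.+1 + m.+1) fw = Some 0%N by exact: run_flip_nest.
have rnt : run 0 (nw ++ tword t) = Some (m.+1 + m.+1)%N.
  by rewrite (run_comp _ rn) (run_widen _ rt).
have rcc i : (i <= m.+1 + m.+1)%N ->
    run (m.+1 + m.+1) [:: (Cup, i)] = Some (m.+1 + (0 + 2 + m.+1))%N.
  by move=> le_i /=; rewrite addn0 le_i; congr Some; lia.
have rdd i : (i <= m.+1 + m.+1)%N ->
    run (m.+1 + (0 + 2 + m.+1)) [:: (Cap, i)] = Some (m.+1 + m.+1)%N.
  by move=> le_i /=; rewrite ifT; first (congr Some); lia.
have run_tail : run (m.+1 + m.+1) ([:: (Cup, m)] ++ tword s ++ [:: (Cap, m.+1)] ++ fw) = Some 0%N.
  rewrite (run_comp _ (rcc _ _)); last lia.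
  rewrite (run_comp _ (run_widen _ rs)) (run_comp _ (rdd _ _)) //; lia.
have run_all : run 0 (nw ++ tword t ++ [:: (Cup, m.+1)] ++ [:: (Cap, m); (Cup, m)] ++
    tword s ++ [:: (Cap, m.+1)] ++ fw) = Some 0%N.
  rewrite catA (run_comp _ rnt) (run_comp _ (rcc _ _)); last lia.
  rewrite -[_ ++ tword s ++ _]/([:: (Cap, m)] ++ [:: (Cup, m)] ++ tword s ++ [:: (Cap, m.+1)] ++ fw).
  by rewrite (run_comp _ (rdd _ _)) //; lia.
have := wcls_slide (n := 0) (m := 0) (j := 0) (y := Cup) (p := nw)
  (q := [:: (Cap, m); (Cup, m)] ++ tword s ++ [:: (Cap, m.+1)] ++ fw) rt rn.
rewrite !addn0 => <- //.
have := red_wcls (n := 0) (m := 0) (q := [:: (Cup, m)] ++ tword s ++ [:: (Cap, m.+1)] ++ fw)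
  (red_zagzig (nw ++ tword t) m).
rewrite -!catA expr0 scale1r => -> //.
have rp : run 0 (nw ++ tword t ++ [:: (Cup, m)]) = Some (m.+1 + (0 + ends_below Cap + m.+1))%N.
  by rewrite catA (run_comp _ rnt) rcc //; lia.
have := wcls_slide (n := 0) (m := 0) (j := 0) (y := Cap) (p := nw ++ tword t ++ [:: (Cup, m)])
  (q := fw) rs rp; rewrite !addn0 -!catA => ->; last first.
  by rewrite catA (run_comp _ rnt).
have := red_wcls (n := 0) (m := 0) (q := tword s ++ fw) (red_zigzag (nw ++ tword t) m).
rewrite -!catA expr0 scale1r => -> //.
rewrite catA (run_comp _ rnt).
rewrite -[_ ++ tword s ++ _]/([:: (Cup, m)] ++ [:: (Cap, m.+1)] ++ tword s ++ fw).
rewrite (run_comp _ (rcc _ _)); last lia.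
rewrite (run_comp _ (rdd _ _)); last lia.
by rewrite (run_comp _ (run_widen _ rs)).
Qed.

Lemma clo_wenzl m : clo (wenzl m) = Delta m *: cls (tangle_id 0).
Proof.
have c0 : clo (wenzl 0) = cls (tangle_id 0).
  rewrite [wenzl 0]/(TL_one 0) /TL_one clo_cls; congr cls; exact: val_inj.
(* [Delta_rec] has depth two, so consecutive values are proved together. *)
have [] // : clo (wenzl m) = Delta m *: cls (tangle_id 0) /\
  clo (wenzl m.+1) = Delta m.+1 *: cls (tangle_id 0).
elim: m => [|m [IH1 IH2]].
  by rewrite -[wenzl 1]/(wid (wenzl 0)) clo_wid c0 Delta0 Delta1 scale1r.
split=> //; rewrite wenzlS (linB (@cloP _)) (linZ (@cloP _)) clo_wid clo_e.
have [-> _ _ _] := wenzlP m; rewrite IH2 !scalerA -scalerBl divrK ?Delta_unit //.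
by rewrite Delta_rec addrK.
Qed.

(** * Existence and uniqueness of the Jones-Wenzl idempotent *)

Definition TL_ideal m := smallest (@subalgebra m) (range (@TL_e m)).

Lemma TL_ideal_sub m (M : set (TL m)) : subalgebra M -> (forall i, M (TL_e i)) ->
  forall u, TL_ideal u -> M u.
Proof. by move=> sM eM u; apply; split=> // _ [i _ <-]. Qed.

Lemma TL_ideal_subalgebra m : subalgebra (@TL_ideal m).
Proof.
split; first split=> [M [[[M0 _] _] _] //|a u v uI vI M MP].
  by case: (MP) => -[[_ MD] _] _; apply: MD; [exact: uI|exact: vI].
by move=> u v uI vI M MP; case: (MP) => -[_ MS] _; apply: MS; [exact: uI|exact: vI].
Qed.

Lemma TL_ideal_e m (i : 'I_m.-1) : TL_ideal (TL_e i).
Proof. by move=> M [_]; apply; exists i. Qed.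

Lemma TL_idealB m (u v : TL m) : TL_ideal u -> TL_ideal v -> TL_ideal (u - v).
Proof.
have [[_ ID] _] := @TL_ideal_subalgebra m.
by move=> uI vI; rewrite addrC -scaleN1r; apply: ID.
Qed.

Lemma TL_idealD m (u v : TL m) : TL_ideal u -> TL_ideal v -> TL_ideal (u + v).
Proof.
have [[_ ID] _] := @TL_ideal_subalgebra m.
by move=> uI vI; rewrite -[u]scale1r; apply: ID.
Qed.

Lemma TL_idealZ m a (u : TL m) : TL_ideal u -> TL_ideal (a *: u).
Proof.
have [[I0 ID] _] := @TL_ideal_subalgebra m.
by move=> uI; rewrite -[_ *: u]addr0; apply: ID.
Qed.

Lemma TL_idealM m (u v : TL m) : TL_ideal u -> TL_ideal v -> TL_ideal (stack u v).
Proof. by have [_] := @TL_ideal_subalgebra m; apply. Qed.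

Lemma TL_ideal0 m : TL_ideal (0 : TL m).
Proof. by have [[]] := @TL_ideal_subalgebra m. Qed.

Lemma TL_ideal_wid m (u : TL m) : TL_ideal u -> TL_ideal (wid u).
Proof.
apply: (TL_ideal_sub (M := fun u => TL_ideal (wid u))); first split; first split.
- by rewrite (lin0 (@widP m m)); exact: TL_ideal0.
- by move=> a v w vI wI; rewrite widP; apply: TL_idealD => //; exact: TL_idealZ.
- by move=> v w vI wI; rewrite wid_stack; exact: TL_idealM.
move=> i; rewrite -TLeE TLe_wid; last by case: (i) => /= j; lia.
have lt_i : (val i < m.+1.-1)%N by case: (i) => /= j; lia.
by rewrite -[val i]/(val (Ordinal lt_i)) TLeE; exact: TL_ideal_e.
Qed.

Lemma wenzl_ideal m : TL_ideal (wenzl m - TL_one m).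
Proof.
case: m => [|m]; first by rewrite subrr; exact: TL_ideal0.
elim: m => [|m IH].
  by rewrite -[wenzl 1]/(wid (TL_one 0)) wid_one subrr; exact: TL_ideal0.
rewrite wenzlS; set r := _ / _; set F := wid _.
have FI : TL_ideal (F - TL_one m.+2).
  by rewrite -wid_one -(linB (@widP _ _)); exact: TL_ideal_wid.
have EI : TL_ideal (TLe m.+2 m).
  by rewrite -[m]/(val (@ord_max m)) (@TLeE m.+2 ord_max); exact: TL_ideal_e.
have EFI : TL_ideal (stack (TLe m.+2 m) F).
  (* The subalgebra has no unit, so [F] is split as [(F - 1) + 1] before multiplying. *)
  rewrite -[F](subrK (TL_one m.+2)) stackDr stack1r.
  by apply: TL_idealD => //; apply: TL_idealM.
rewrite addrAC; apply: TL_idealB => //; apply: TL_idealZ.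
rewrite -{1}[F](subrK (TL_one m.+2)) stackDl stack1l.
by apply: TL_idealD => //; apply: TL_idealM.
Qed.

Lemma wenzl_jw m : is_jones_wenzl (wenzl m).
Proof.
split; last 1 first.
- by case: m => [|m]; [exact: stack1l | have [] := wenzlP m].
- case: m => [[]//|m] i; have [_ ke _ _] := wenzlP m.
  by have := ke i (ltn_ord i); rewrite TLeE.
- exact: wenzl_ideal.
Qed.

Lemma jones_wenzlP m : is_jones_wenzl (jones_wenzl m).
Proof. by rewrite /jones_wenzl; case: xgetP => // /(_ (wenzl m)) []; exact: wenzl_jw. Qed.

(** To kill a product it is enough to kill its left factor, so vanishing spreads from the
    generators. *)
Lemma kill_ideal m k (f : skein m k) :
  (forall i : 'I_m.-1, stack f (TL_e i) = 0) -> forall u, TL_ideal u -> stack f u = 0.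
Proof.
move=> fe; apply: TL_ideal_sub => //; split; first split=> [|a u v fu fv]; first exact: stack0r.
  by rewrite stackPr fu fv scaler0 addr0.
by move=> u v fu _; rewrite stackA fu stack0l.
Qed.

(** For two solutions [f] and [g], the product [f g] equals [f], as [f] kills [g - 1], and equals
    [g], as [g] kills [f - 1]. *)
Lemma jones_wenzlE m : jones_wenzl m = wenzl m.
Proof.
have [ke fI ff] := jones_wenzlP m; have [ke' fI' ff'] := wenzl_jw m.
set f := jones_wenzl m in ke fI ff *; set g := wenzl m in ke' fI' ff' *.
have fg : stack f g = f.
  apply/eqP; rewrite -subr_eq0 -{2}[f]stack1r -stackBr; apply/eqP.
  by apply: kill_ideal fI' => // i; case: (ke i).
suff : stack (f - TL_one m) g = 0.
  by rewrite stackBl stack1l fg => /eqP; rewrite subr_eq0 => /eqP.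
move: fI; apply: (TL_ideal_sub (M := fun u => stack u g = 0)).
  split; first split=> [|a u v ug vg]; first exact: stack0l.
    by rewrite stackPl ug vg scaler0 addr0.
  by move=> u v _ vg; rewrite -stackA vg stack0r.
by move=> i; case: (ke' i).
Qed.

Lemma clo_jones_wenzl m : clo (jones_wenzl m) = Delta m *: cls (tangle_id 0).
Proof. by rewrite jones_wenzlE clo_wenzl. Qed.

(** * The form [G] on glued diagrams *)

Definition sflip n m (u : skein n m) : skein m n := extend (fun t => cls (tangle_flip t)) u.

Lemma sflip_rel n m (u : formal n m) :
  skein_rel u -> extend_formal (fun t => cls (tangle_flip t)) u = 0.
Proof. by apply: (cls_flip (p := [::]) (q := [::])) => t; rewrite cats0. Qed.

Lemma sflip_cls n m (t : tangle n m) : sflip (cls t) = cls (tangle_flip t).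
Proof. exact: (extend_cls (@sflip_rel n m)). Qed.

Lemma sflipP n m a (u v : skein n m) : sflip (a *: u + v) = a *: sflip u + sflip v.
Proof. exact: (extendP (@sflip_rel n m)). Qed.

Lemma sflip_stack n m k (u : skein m k) (v : skein n m) :
  sflip (stack u v) = stack (sflip v) (sflip u).
Proof.
apply: (lin_ext (f := fun u => sflip (stack u v)) (g := fun u => stack (sflip v) (sflip u)))
  => [a x y|a x y|s]; rewrite ?stackPl ?sflipP ?stackPr //.
apply: (lin_ext (f := fun v => sflip (stack (cls s) v))
  (g := fun v => stack (sflip v) (sflip (cls s))))
  => [a x y|a x y|t]; rewrite ?stackPr ?sflipP ?stackPl //.
by rewrite !(stack_cls, sflip_cls); congr cls; apply: val_inj; rewrite /= flip_word_cat.
Qed.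

Lemma glue_clo n h (u v : skein n h) : glue u v = clo (stack u (sflip v)).
Proof.
apply: (lin_ext (f := fun u => glue u v)
  (g := fun u => clo (stack u (sflip v)))) => [a x y|a x y|s].
- by rewrite gluePl.
- by rewrite stackPl cloP.
apply: (lin_ext (f := fun v => glue (cls s) v)
  (g := fun v => clo (stack (cls s) (sflip v)))) => [a x y|a x y|t].
- by rewrite gluePr.
- by rewrite sflipP stackPr cloP.
by rewrite glue_cls sflip_cls stack_cls clo_cls.
Qed.

Lemma sflip_ideal m (u : TL m) : TL_ideal u -> TL_ideal (sflip u).
Proof.
apply: (TL_ideal_sub (M := fun u => TL_ideal (sflip u))); first split; first split.
- by rewrite (lin0 (@sflipP m m)); exact: TL_ideal0.
- by move=> a v w vI wI; rewrite sflipP; apply: TL_idealD => //; exact: TL_idealZ.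
- by move=> v w vI wI; rewrite sflip_stack; exact: TL_idealM.
move=> i; rewrite sflip_cls (_ : cls _ = TL_e i); first exact: TL_ideal_e.
by congr cls; apply: val_inj.
Qed.

(** Reflection preserves the span of products of generators, so [sflip f - 1] still lies in what [f]
    kills. *)
Lemma jones_wenzl_sflip m : stack (jones_wenzl m) (sflip (jones_wenzl m)) = jones_wenzl m.
Proof.
have [ke fI ff] := jones_wenzlP m; set f := jones_wenzl m in ke fI ff *.
apply/eqP; rewrite -subr_eq0 -{3}[f]stack1r -stackBr; apply/eqP.
have -> : TL_one m = sflip (TL_one m) by rewrite sflip_cls; congr cls; apply: val_inj.
rewrite -(linB (@sflipP m m)); apply: kill_ideal; last exact: sflip_ideal.
by move=> i; case: (ke i).
Qed.

(** Placing [e_i] on a minimum at [i] only creates a loop, and [delta] is a unit; hence the diagram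
    is a multiple of one with [e_i] on top. *)
Lemma jones_wenzl_cup h w i : run h (rcons w (Cup, i)) = Some h ->
  stack (jones_wenzl h) (wcls h h (rcons w (Cup, i))) = 0.
Proof.
rewrite -cats1 => rw; have [k rk] := run_catl rw.
rewrite /=; case: ifP => // le_ik [ek].
have lt_ih : (i.+1 < h)%N by lia.
have [lt_i rwe] : (i < h.-1)%N /\ run h ((w ++ [:: (Cup, i)]) ++ e_word i) = Some h.
  by split; [lia | rewrite (run_comp _ rw) e_wordP].
have r : red 1 (w ++ [:: (Cup, i); (Cap, i)] ++ [:: (Cup, i)]) (w ++ [:: (Cup, i)]).
  by rewrite catA; apply: red_catr; exact: red_loop.
have E : wcls h h ((w ++ [:: (Cup, i)]) ++ e_word i) = delta *: wcls h h (w ++ [:: (Cup, i)]).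
  have := red_wcls (n := h) (m := h) (q := [::]) r; rewrite !cats0 expr1 -catA; apply.
  by rewrite -rwe -catA.
have [ke _ _] := jones_wenzlP h.
have dU : delta \is a GRing.unit by rewrite -Delta1 Delta_unit.
rewrite -[LHS]scale1r -(mulVr dU) -scalerA -stackZr -E.
rewrite -(wcls_stack rw (e_wordP lt_ih)) stackA -/(TLe h i) -[i]/(val (Ordinal lt_i)) TLeE.
by have [-> _] := ke (Ordinal lt_i); rewrite stack0l scaler0.
Qed.

Section FormB.
Variables (n h : nat) (s t : tangle n h).
Let w := flip_word (tword t) ++ tword s.
Let f := jones_wenzl h.

Lemma run_flip_cat : run h w = Some h.
Proof. by apply/eqP; exact: tword_run (tangle_comp s (tangle_flip t)). Qed.

Lemma glue_top : glue (stack f (cls s)) (stack f (cls t)) =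
  clo (stack (stack f (wcls h h w)) (sflip f)).
Proof.
rewrite glue_clo sflip_stack sflip_cls -stackA stackA.
rewrite (_ : wcls h h w = stack (cls s) (cls (tangle_flip t))).
  by rewrite !stackA.
by rewrite stack_cls -wclsE.
Qed.

Lemma form_red_id c : red c w [::] ->
  Defs.form (stack f (cls s)) (stack f (cls t)) = Delta h * delta ^+ c.
Proof.
move=> r; rewrite /Defs.form glue_top.
have := red_wcls (n := h) (m := h) (q := [::]) r; rewrite !cats0 => -> //; last exact: run_flip_cat.
have -> : wcls h h [::] = TL_one h by rewrite -[[::]]/(tword (tangle_id h)) wclsE.
rewrite stackZr stack1r stackZl jones_wenzl_sflip (linZ (@cloP h)) clo_jones_wenzl scalerA.
by rewrite bracket_scale mulrC.
Qed.

Lemma form_red_cup c w' i : red c w (rcons w' (Cup, i)) ->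
  Defs.form (stack f (cls s)) (stack f (cls t)) = 0.
Proof.
move=> r; rewrite /Defs.form glue_top; have rw' := red_run r run_flip_cat.
have := red_wcls (n := h) (m := h) (q := [::]) r; rewrite !cats0 => -> //; last exact: run_flip_cat.
rewrite stackZr jones_wenzl_cup // scaler0 stack0l (lin0 (@cloP h)).
by rewrite -(scale0r (cls (tangle_id 0))) bracket_scale.
Qed.

End FormB.

(** * Counting components by colourings *)

Section Colourings.
Variables (P : finType) (e : rel P).
Hypothesis e_sym : symmetric e.

Definition colouring (f : {ffun P -> bool}) : bool :=
  [forall x, forall y, e x y ==> (f x == f y)].

Lemma colouringP (f : {ffun P -> bool}) : reflect (forall x y, e x y -> f x = f y) (colouring f).
Proof.
apply: (iffP forallP) => [H x y exy|H x]; first by have /forallP/(_ y)/implyP/(_ exy)/eqP := H x.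
by apply/forallP => y; apply/implyP => /H ->.
Qed.

Lemma colouring_connect (f : {ffun P -> bool}) x y : colouring f -> connect e x y -> f x = f y.
Proof.
move=> /colouringP cf /connectP[p ep ->]; elim: p x ep => //= z p IHp x /andP[/cf -> /IHp ->].
by [].
Qed.

Lemma connect_colouring x y :
  ~~ connect e x y -> exists f : {ffun P -> bool}, colouring f /\ f x != f y.
Proof.
move=> nxy; exists [ffun z => connect e x z]; split.
  apply/colouringP => z z' ezz'; rewrite !ffunE; apply/idP/idP => /connect_trans; apply.
    exact: connect1.
  by apply: connect1; rewrite e_sym.
by rewrite !ffunE connect0 (negbTE nxy).
Qed.

(** A colouring amounts to the set of component roots that it colours [true]. *)
Lemma card_colouring : #|[set f | colouring f]| = (2 ^ n_comp e P)%N.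
Proof.
have cs : connect_sym e by exact: sym_connect_sym.
pose R := [set x | roots e x]; pose col (A : {set P}) := [ffun x => fingraph.root e x \in A].
have -> : n_comp e P = #|R| by apply: eq_card => x; rewrite !inE andbT.
rewrite -card_powerset -(card_in_imset (f := col)); last first.
  move=> A B; rewrite !powersetE.
  move=> /fintype.subsetP AR /fintype.subsetP BR /ffunP AB; apply/setP => x.
  have [xR|xR] := boolP (x \in R); last by rewrite (contraNF (AR x) xR) (contraNF (BR x) xR).
  have := AB x; rewrite !ffunE; suff -> : fingraph.root e x = x by [].
  by apply/eqP; move: xR; rewrite inE.
apply: eq_card => f; rewrite inE; apply/idP/imsetP => [cf|[A _ ->]].
  exists [set x in R | f x].
    by rewrite powersetE; apply/fintype.subsetP => x; rewrite inE => /andP[].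
  apply/ffunP => x; rewrite ffunE !inE roots_root //=.
  by apply: colouring_connect cf _; exact: connect_root.
apply/colouringP => x y exy; rewrite !ffunE; congr (_ \in A).
by apply/eqP; rewrite root_connect //; exact: connect1.
Qed.

End Colourings.

Definition eqcol (a b : bool) : int := (a == b)%:R.
(** Counts 2-colourings of planar words. Integers are used because a sum of nonnegative counts
    vanishes only termwise. *)
Definition colour : seq layer -> (seq bool -> int) -> seq bool -> int := ev eqcol eqcol 0 0.

Lemma colour_zigzag a c : eqcol c true * eqcol true a + eqcol c false * eqcol false a = (a == c)%:R.
Proof. by case: a; case: c. Qed.

Lemma colour_zagzig a d : eqcol a true * eqcol true d + eqcol a false * eqcol false d = (a == d)%:R.
Proof. by case: a; case: d. Qed.

Lemma colour_loop_value : loop_value eqcol eqcol = 2.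
Proof. by []. Qed.

(** * Colourings of a planar word, line by line *)

Definition nexts (l : layer) (u : seq bool) : seq (seq bool) :=
  if l.1 == Cup then [seq take l.2 u ++ [:: c, c & drop l.2 u] | c <- [:: true; false]]
  else if nth false u l.2 == nth false u l.2.+1 then [:: take l.2 u ++ drop l.2.+2 u]
  else [::].

(** A history records a colouring of the whole diagram as the colours on its successive horizontal
    lines, starting with [u]. *)
Fixpoint hists (w : seq layer) (u : seq bool) : seq (seq (seq bool)) :=
  if w is l :: w' then
    flatten [seq [seq u :: h | h <- hists w' u'] | u' <- nexts l u]
  else [:: [:: u]].

Lemma nextsE l u F : planar_layer l -> (l.2 + ends_below l.1 <= size u)%N ->
  lay eqcol eqcol 0 0 l F u = \sum_(u' <- nexts l u) F u'.
Proof.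
case: l => x i /orP[] /= /eqP ->; rewrite /nexts /=.
  move=> /split2[u1 [a [b [u2 [-> su1]]]]]; rewrite lay_cap //.
  rewrite take_size_cat // -{1 2}su1 nth_cat ltnn subnn /= nth_cat ltnNge leqnSn /= subSnn /=.
  rewrite drop_cat -su1 ltnNge -addn2 leq_addr /= addKn /= drop0 /eqcol.
  by case: eqP => _; rewrite ?big_seq1 ?big_nil ?mul1r ?mul0r.
rewrite addn0 => le_i; rewrite -{1}(cat_take_drop i u) lay_cup ?size_takel //.
by rewrite !big_cons big_nil /eqcol /= !mul1r !mul0r !addr0.
Qed.

Lemma size_nexts l u u' : planar_layer l -> (l.2 + ends_below l.1 <= size u)%N ->
  u' \in nexts l u -> size u' = (size u - ends_below l.1 + ends_above l.1)%N.
Proof.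
case: l => x i /orP[] /= /eqP ->; rewrite /nexts /= => le_i.
  by case: eqP => // _; rewrite inE => /eqP ->; rewrite size_cat size_takel ?size_drop; lia.
rewrite !inE => /orP[] /eqP ->; rewrite size_cat /= size_drop size_takel //; lia.
Qed.

(** [G] reads the colours on the line between [w1] and [w2]; this is applied just above the nested
    minima. *)
Lemma sum_hists w1 w2 u m (G : seq bool -> int) :
  all planar_layer (w1 ++ w2) -> run (size u) (w1 ++ w2) = Some m ->
  \sum_(h <- hists (w1 ++ w2) u) G (nth [::] h (size w1)) =
  colour w1 (fun y => G y * colour w2 (fun=> 1) y) u.
Proof.
elim: w1 u => [|l w1 IH] u /=.
  elim: w2 u G => [|[x i] w IHw] u G /=; first by rewrite big_seq1 mulr1.
  move=> /andP[pl pw]; case: ifP => // le_u rw.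
  rewrite nextsE // big_flatten big_map mulr_sumr big_seq [RHS]big_seq.
  apply: eq_bigr => u' u'n; rewrite big_map /=.
  have su' := size_nexts pl le_u u'n; rewrite -su' in rw.
  have := IHw _ (fun=> 1) pw rw; rewrite mul1r => <-.
  by rewrite mulr_sumr; under [RHS]eq_bigr do rewrite mulr1.
case: l => x i /= /andP[pl pw]; case: ifP => // le_u rw.
rewrite nextsE // big_flatten big_map big_seq [RHS]big_seq.
apply: eq_bigr => u' u'n; rewrite big_map /= -IH //.
by rewrite (size_nexts pl le_u u'n).
Qed.

Lemma uniq_nexts l u : uniq (nexts l u).
Proof.
rewrite /nexts; case: ifP => _; last by case: ifP.
by rewrite /= andbT inE; apply/eqP => /eqP; rewrite eqseq_cat // => /andP[_].
Qed.

Lemma uniq_flatten_key (S T : eqType) (k : T -> S) (s : seq S) (g : S -> seq T) :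
  uniq s -> (forall x, uniq (g x)) -> (forall x y, y \in g x -> k y = x) ->
  uniq (flatten [seq g x | x <- s]).
Proof.
move=> + ug gk; elim: s => //= x s IHs /andP[xs us]; rewrite cat_uniq ug IHs // andbT /=.
apply/hasPn => y /flattenP[_ /mapP[x' x's ->] /gk yx'].
by apply: contraNN xs => /gk <-; rewrite yx'.
Qed.

Lemma hists_head w u h : h \in hists w u -> exists h', h = u :: h'.
Proof.
case: w => [|l w] /=; first by rewrite inE => /eqP ->; exists [::].
by move=> /flattenP[_ /mapP[u' _ ->] /mapP[h' _ ->]]; exists h'.
Qed.

Lemma uniq_hists w u : uniq (hists w u).
Proof.
elim: w u => //= l w IHw u.
(* The second line of a history tells which continuation it came from. *)
apply: (@uniq_flatten_key _ _ (fun h => nth [::] h 1)) (uniq_nexts l u) _ _ => [u'|u' h].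
  by rewrite map_inj_uniq // => h h' [].
by move=> /mapP[h' /hists_head[h'' ->] ->].
Qed.

Lemma mem_hists w u h : h \in hists w u <->
  [/\ size h = (size w).+1, nth [::] h 0 = u &
    forall t, (t < size w)%N -> nth [::] h t.+1 \in nexts (nth (Cap, 0%N) w t) (nth [::] h t)].
Proof.
elim: w u h => [|l w IHw] u h /=.
  rewrite inE; split=> [/eqP -> //|[]].
  by case: h => [|u' []] //= _ ->.
split=> [/flattenP[_ /mapP[u' u'n ->] /mapP[h' /IHw[sh h0 hS] ->]]|].
  by split=> /= [||[|t] lt_t]; rewrite ?sh ?h0 //; exact: hS.
case: h => [|u0 h] [] //= [sh] -> hS; apply/flattenP.
exists [seq u :: h | h <- hists w (nth [::] h 0)].
  by apply/mapP; exists (nth [::] h 0) => //; exact: (hS 0%N).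
by apply/mapP; exists h => //; apply/IHw; split=> // t lt_t; exact: (hS t.+1).
Qed.

(** The bridge between list operations and the strands of a layer. The bounds on [x] and [y] are
    explicit because [strand] ignores the width of the lines. *)
Lemma nextsP l u u' : planar_layer l -> (l.2 + ends_below l.1 <= size u)%N ->
  reflect (size u' = (size u - ends_below l.1 + ends_above l.1)%N /\
    forall (a b : bool) x y, strand l (a, x) (b, y) ->
      (x < size (if a then u' else u))%N -> (y < size (if b then u' else u))%N ->
      nth false (if a then u' else u) x = nth false (if b then u' else u) y)
    (u' \in nexts l u).
Proof.
move=> pl le_u; apply: (iffP idP) => [u'n|[su' H]].
  split; first exact: size_nexts u'n.
  case: l pl le_u u'n => x i /orP[] /= /eqP -> /= le_i; rewrite /nexts /=.
    case: eqP => // ui; rewrite inE => /eqP ->.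
    move=> [] [] x1 y1 //= => [/eqP -> _ lt_y|/andP[/eqP -> /eqP ->] //].
    rewrite nth_cat size_takel; last lia.
    by case: ltnP => /= h; rewrite ?nth_take // nth_drop; congr nth; lia.
  have E c j : nth false (take i u ++ [:: c, c & drop i u])
      (if j < i then j else j.+2)%N = nth false u j.
    rewrite nth_cat size_takel; last lia; case: (ltnP j i) => h; first by rewrite h nth_take.
    rewrite ltnNge (leq_trans h (leqW (leqnSn j))) (_ : j.+2 - i = (j - i).+2)%N; last lia.
    by rewrite /= nth_drop; congr nth; lia.
  have Ei c j : (i <= j <= i.+1)%N -> nth false (take i u ++ [:: c, c & drop i u]) j = c.
    move=> le_j; rewrite nth_cat size_takel; last lia; rewrite ltnNge (andP le_j).1 /=.
    by case ej : (j - i)%N => [|[|k]] //; lia.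
  rewrite !inE => /orP[] /eqP ->; move=> [] [] x1 y1 //=.
  - by move=> /andP[/eqP -> /eqP ->] _ _; rewrite !Ei ?leqnn ?leqnSn.
  - by move=> /eqP -> _ _; rewrite E.
  - by move=> /andP[/eqP -> /eqP ->] _ _; rewrite !Ei ?leqnn ?leqnSn.
  - by move=> /eqP -> _ _; rewrite E.
case: l pl le_u su' H => x i /orP[] /= /eqP -> /= le_i; rewrite /nexts /strand /=.
  move=> su' H; rewrite (H false false i i.+1) ?eqxx //=; try lia.
  rewrite ?eqxx inE; apply/eqP/(@eq_from_nth _ false) => [|j lt_j].
    by rewrite size_cat size_takel ?size_drop; lia.
  rewrite -(H false true (if j < i then j else j.+2)%N j (eqxx _)) //=; last by case: ifP; lia.
  rewrite nth_cat size_takel; last lia.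
  by case: ltnP => /= h; rewrite ?nth_take // nth_drop; congr nth; lia.
move=> su' H; suff : u' = take i u ++ [:: nth false u' i, nth false u' i & drop i u].
  by case: (nth false u' i) => ->; rewrite !inE eqxx ?orbT.
have ui : nth false u' i.+1 = nth false u' i.
  by symmetry; apply: (H true true); rewrite /= ?eqxx //; lia.
apply: (@eq_from_nth _ false) => [|j lt_j]; first by rewrite size_cat /= size_takel ?size_drop; lia.
rewrite nth_cat size_takel; last lia; case: ltnP => h.
  by rewrite nth_take //; symmetry; apply: (H false true); rewrite /= ?h ?eqxx //; lia.
case ej : (j - i)%N => [|[|k]] /=; [congr nth; lia | rewrite -ui; congr nth; lia |].
rewrite nth_drop; symmetry; apply: (H false true) => /=; [|lia|lia].
by rewrite ltnNge leq_addr; apply/eqP; lia.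
Qed.

Section Histories.
Variables (n m : nat) (T : tangle n m).
Let w := tword T.
Hypothesis planar_w : all planar_layer w.

Definition hist_colouring (h : seq (seq bool)) : {ffun Defs.point T -> bool} :=
  [ffun x => nth false (nth [::] h (level x)) (position x)].

Lemma level_le (x : Defs.point T) : (level x <= size w)%N.
Proof. by have := ltn_ord (tag x); rewrite ltnS. Qed.

Lemma position_lt (x : Defs.point T) : (position x < width n w (level x))%N.
Proof. exact: ltn_ord (tagged x). Qed.

Lemma point_exists t j : (t <= size w)%N -> (j < width n w t)%N ->
  exists x : Defs.point T, level x = t /\ position x = j.
Proof.
rewrite -ltnS => lt_t lt_j; pose i : 'I_(size w).+1 := Ordinal lt_t.
by exists (Tagged (fun t : 'I_(size w).+1 => 'I_(width n w t)) (@Ordinal (width n w i) j lt_j)).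
Qed.

Lemma point_inj (x y : Defs.point T) : level x = level y -> position x = position y -> x = y.
Proof.
case: x y => [t i] [t' j]; rewrite /level /position /= => ett'.
have {}ett' : t = t' by exact: val_inj.
by case: _ / ett' j => j /val_inj ->.
Qed.

Lemma width0 : width n w 0 = n. Proof. by rewrite /width take0. Qed.

Lemma widthS t : (t < size w)%N -> let l := nth (Cap, 0%N) w t in
  (l.2 + ends_below l.1 <= width n w t)%N /\
  width n w t.+1 = (width n w t - ends_below l.1 + ends_above l.1)%N.
Proof.
move=> lt_t /=; rewrite /width (take_nth (Cap, 0%N)) // -cats1.
have /eqP := tword_run T; rewrite -/w -{1}(cat_take_drop t w) (drop_nth (Cap, 0%N)) //.
move=> /run_catl[k rk]; rewrite (run_cat n) rk /=.
by case: (nth _ _ _) => x i /=; case: ifP.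
Qed.

Lemma hist_size u h t : size u = n -> h \in hists w u -> (t <= size w)%N ->
  size (nth [::] h t) = width n w t.
Proof.
move=> su /mem_hists[sh h0 hS]; elim: t => [_|t IHt lt_t]; first by rewrite width0 h0.
have [le_l ->] := widthS lt_t; rewrite -IHt ?(ltnW lt_t) // in le_l *.
by apply: size_nexts (hS t lt_t) => //; exact: (allP planar_w) (mem_nth _ lt_t).
Qed.

Lemma joined_sym : symmetric (@joined n m T).
Proof. by move=> x y; rewrite /joined orbC. Qed.

Lemma hist_colouringP u h : size u = n -> h \in hists w u ->
  colouring (@joined n m T) (hist_colouring h).
Proof.
move=> su hh; have [sh h0 hS] := iffLR (mem_hists _ _ _) hh.
suff H x y : @linked n m T x y -> hist_colouring h x = hist_colouring h y.
  by apply/colouringP => x y /orP[/H|/H].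
move=> /existsP[t /existsP[a /existsP[b /and3P[/eqP lx /eqP ly st]]]].
have pl : planar_layer (nth (Cap, 0%N) w t) by exact: (allP planar_w) (mem_nth _ (ltn_ord t)).
have [le_l wS] := widthS (ltn_ord t).
have sz := hist_size su hh; rewrite -(sz t) ?(ltnW (ltn_ord t)) // in le_l.
have [_ H] := elimT (nextsP _ pl le_l) (hS t (ltn_ord t)).
rewrite (tnth_nth (Cap, 0%N)) /= in st.
have E (c : bool) : (if c then nth [::] h t.+1 else nth [::] h t) = nth [::] h (t + c)%N.
  by case: c; rewrite ?addn1 ?addn0.
have := H a b _ _ st; rewrite !E -lx -ly !sz ?level_le // => HH.
by rewrite !ffunE; apply: HH; exact: position_lt.
Qed.

Lemma colouring_hist (f : {ffun Defs.point T -> bool}) : colouring (@joined n m T) f ->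
  exists u h, [/\ size u = n, h \in hists w u & f = hist_colouring h].
Proof.
move=> /colouringP cf.
(* Points are dependent pairs; [F] reads [f] at raw coordinates, with default [false] off the
   diagram. *)
pose F t j :=
  if [pick x : Defs.point T | (level x == t) && (position x == j)] is Some x then f x else false.
have FE x : F (level x) (position x) = f x.
  rewrite /F; case: pickP => [y /andP[/eqP ly /eqP py]|/(_ x)]; last by rewrite !eqxx.
  by rewrite (point_inj ly py).
pose row t := mkseq (F t) (width n w t); pose h := mkseq row (size w).+1.
have sr t : size (row t) = width n w t by rewrite size_mkseq.
have hE t : (t <= size w)%N -> nth [::] h t = row t by move=> le_t; rewrite nth_mkseq.
exists (row 0%N), h; split; first by rewrite sr width0.
  apply/mem_hists; split=> [||t lt_t]; first by rewrite size_mkseq.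
    by rewrite hE.
  rewrite !hE ?(ltnW lt_t) //.
  have pl : planar_layer (nth (Cap, 0%N) w t) by exact: (allP planar_w) (mem_nth _ lt_t).
  have [le_l wS] := widthS lt_t; rewrite -sr in le_l.
  apply/(nextsP _ pl le_l); split; first by rewrite !sr.
  move=> a b i j st.
  have E (c : bool) : (if c then row t.+1 else row t) = row (t + c)%N.
    by case: c; rewrite ?addn1 ?addn0.
  have le_c (c : bool) : (t + c <= size w)%N by case: c; rewrite ?addn1 ?addn0 // ltnW.
  rewrite !E !sr => lt_i lt_j; rewrite !nth_mkseq //.
  have [x [lx px]] := point_exists (le_c a) lt_i.
  have [y [ly py]] := point_exists (le_c b) lt_j.
  rewrite -lx -ly -px -py !FE; apply: cf; apply/orP; left.
  apply/existsP; exists (Ordinal lt_t); apply/existsP; exists a; apply/existsP; exists b.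
  by rewrite lx ly px py !eqxx (tnth_nth (Cap, 0%N)).
apply/ffunP => x; rewrite ffunE hE ?level_le // nth_mkseq ?FE //; exact: position_lt.
Qed.

End Histories.

Section Closed.
Variable (T : tangle 0 0).
Hypothesis planar_T : all planar_layer (tword T).

Lemma closed_components : (size (hists (tword T) [::]) = 2 ^ components T)%N.
Proof.
rewrite /components -(card_colouring (@joined_sym _ _ T)).
have inj : {in hists (tword T) [::] &, injective (hist_colouring T)}.
  move=> h h' hh hh' /ffunP E.
  have sz := @hist_size 0 0 T planar_T [::] _ _ erefl.
  have [sh _ _] := iffLR (mem_hists _ _ _) hh; have [sh' _ _] := iffLR (mem_hists _ _ _) hh'.
  apply: (@eq_from_nth _ [::]) => [|t]; rewrite sh // ltnS => le_t.
  apply: (@eq_from_nth _ false) => [|j]; first by rewrite !sz.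
  rewrite sz // => lt_j; have [x [lx px]] := point_exists le_t lt_j.
  by have := E x; rewrite !ffunE lx px.
rewrite -(size_map (hist_colouring T)) -(card_uniqP _); last first.
  by rewrite map_inj_in_uniq ?uniq_hists.
apply: eq_card => f; rewrite inE; apply/mapP/idP => [[h hh ->]|].
  exact: (hist_colouringP planar_T (u := [::])).
by move=> /(colouring_hist planar_T)[u [h [/size0nil -> hh ->]]]; exists h.
Qed.

(** Points are disconnected exactly when some colouring separates them; the sum counts the
    separating colourings. *)
Lemma connect_hists (x y : Defs.point T) : level x = level y ->
  connect (@joined _ _ T) x y =
  (\sum_(h <- hists (tword T) [::])
    (nth false (nth [::] h (level x)) (position x) !=
     nth false (nth [::] h (level x)) (position y))%:R == 0 :> int).
Proof.
move=> lxy; apply/idP/idP => [cxy|].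
  rewrite big_seq big1 // => h hh.
  have := colouring_connect (hist_colouringP planar_T (u := [::]) erefl hh) cxy.
  by rewrite !ffunE -lxy => ->; rewrite eqxx.
apply: contraLR => /(connect_colouring (@joined_sym _ _ T))[f [cf fxy]].
have [u [h [/size0nil eu hh ef]]] := colouring_hist planar_T cf; rewrite eu in hh.
rewrite (big_rem h) //= gt_eqF // ltr_pwDl //.
  by move: fxy; rewrite ef !ffunE -lxy => ->.
by apply: sumr_ge0 => i _; rewrite ler0n.
Qed.

End Closed.

(** * The semi-meander entries *)

(** Nested arcs join mirror positions, so the line above them is coloured by a palindrome. *)
Lemma colour_nest h G :
  colour (nest_word h) G [::] = \sum_(u <- configs h) G (u ++ rev u).
Proof.
elim: h G => [|h IHh] G; first by rewrite big_seq1.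
rewrite nest_wordS /colour ev_cat [LHS]IHh -[in RHS]addn1 sum_configsD big_seq [RHS]big_seq.
apply: eq_bigr => u; rewrite mem_configs => /eqP su.
rewrite [LHS]lay_cup // /eqcol /= !mul1r !mul0r !addr0 !big_cons big_nil addr0.
by rewrite !rev_cat -!catA.
Qed.

Lemma colour_flip_nest h F v r : size v = h -> size r = h ->
  colour (flip_word (nest_word h)) F (v ++ r) = (v == rev r)%:R * F [::].
Proof.
elim: h F v r => [|h IHh] F v r; first by move=> /size0nil -> /size0nil ->; rewrite mul1r.
case/lastP: v => // v a; rewrite size_rcons => -[sv]; case: r => // b r [sr].
rewrite nest_wordS flip_word_cat cat_rcons [LHS]lay_cap // [X in _ * X]IHh // rev_cons eqseq_rcons.
by rewrite /eqcol; do 2![case: eqP => _]; rewrite /= ?mul1r ?mul0r.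
Qed.

Section SEntry.
Variables (n h : nat) (s t : tangle n h).
Hypotheses (planar_s : planar (tword s)) (planar_t : planar (tword t)).
Let w := flip_word (tword t) ++ tword s.
Let T := glue_tangle s t.
(** The number of colourings of the rest of the glued diagram when the [h] common points are
    coloured by [u]. *)
Let K (u : seq bool) := colour (w ++ flip_word (nest_word h)) (fun=> 1) (u ++ rev u).

Lemma planar_flip x : planar x -> planar (flip_word x).
Proof.
rewrite /planar /flip_word all_rev all_map => /allP px; apply/allP => l /px.
by case: l => -[].
Qed.

Lemma planar_flip_cat : planar w.
Proof. by rewrite /planar all_cat; apply/andP; split; first exact: planar_flip. Qed.

Lemma glue_word : tword T = nest_word h ++ w ++ flip_word (nest_word h).
Proof. by rewrite /T /= -!catA. Qed.

Lemma planar_glue : all planar_layer (tword T).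
Proof.
have pn : planar (nest_word h) by apply/allP => l /mapP[i _ ->].
have pw := planar_flip_cat; have pf := planar_flip pn.
by rewrite glue_word all_cat all_cat; apply/and3P.
Qed.

Lemma sum_level_h (G : seq bool -> int) :
  \sum_(x <- hists (tword T) [::]) G (nth [::] x h) =
  \sum_(u <- configs h) G (u ++ rev u) * K u.
Proof.
have := @sum_hists (nest_word h) (w ++ flip_word (nest_word h)) [::] 0 G.
rewrite -glue_word size_map size_iota => ->; first exact: colour_nest.
  exact: planar_glue.
exact/eqP/tword_run.
Qed.

Lemma K_red c w' u : red c w w' -> size u = h ->
  K u = 2 ^+ c * colour w' (fun y => (y == u)%:R) u.
Proof.
move=> r su; rewrite /K /colour ev_cat (ev_widen _ _ _ _ _ _ (run_flip_cat s t)) //.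
rewrite (red_ev _ _ colour_zigzag colour_zagzig _ r (run_flip_cat s t) su) colour_loop_value.
congr (_ * _).
apply: ev_eq (red_run r (run_flip_cat s t)) _ _ (su) => y sy.
by rewrite [LHS]colour_flip_nest ?size_rev // revK mulr1.
Qed.

Lemma connect_level_h (x y : Defs.point T) : level x = h -> level y = h ->
  connect (@joined _ _ T) x y =
  (\sum_(u <- configs h) (nth false (u ++ rev u) (position x) !=
     nth false (u ++ rev u) (position y))%:R * K u == 0).
Proof.
move=> lx ly; rewrite (connect_hists planar_glue) ?lx ?ly //.
by rewrite (sum_level_h (fun v => (nth false v (position x) != nth false v (position y))%:R)).
Qed.

Lemma S_entry_id c : red c w [::] -> S_entry s t = delta ^+ (c + h).
Proof.
move=> r; have KE u : size u = h -> K u = 2 ^+ c.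
  by move=> su; rewrite (K_red r su) /= eqxx mulr1.
have sum1 m : \sum_(u <- configs m) (1 : int) = 2 ^+ m.
  elim: m => [|m IH]; first by rewrite big_seq1.
  by rewrite /= big_cat !big_map /= !IH exprS mulr_natl mulr2n.
rewrite /S_entry ifT.
  (* Both exponents are compared through the number of colourings: each of the [2 ^ h] colourings of
     the common points extends in [2 ^ c] ways. *)
  congr (_ ^+ _); apply: (@expnI 2) => //; rewrite -closed_components; last exact: planar_glue.
  apply/eqP; rewrite -(eqr_nat int) natrX exprD -(sum1 h) mulr_sumr.
  have := sum_level_h (fun=> 1); rewrite big_const_seq count_predT iter_addr_0 => ->.
  apply/eqP; rewrite big_seq [RHS]big_seq; apply: eq_bigr => u.
  by rewrite mem_configs => /eqP su; rewrite mul1r mulr1 KE.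
apply/forallP => x; apply/forallP => y; apply/implyP => /and5P[/eqP lx /eqP ly lt_x lt_y xy].
rewrite connect_level_h // gt_eqF //.
(* Marking the strand of [x] alone separates it from [y]. *)
pose u := [seq j == position x | j <- iota 0 h].
have su : size u = h by rewrite size_map size_iota.
have uu : u \in configs h by rewrite mem_configs su.
have nu j : (j < h)%N -> nth false (u ++ rev u) j = (j == position x).
  by move=> lt_j; rewrite nth_cat su lt_j (nth_map 0%N) ?size_iota // nth_iota.
have pxy : position y != position x.
  by apply: contraNneq xy => pyx; apply/eqP/point_inj; rewrite ?lx ?ly.
rewrite (big_rem u) //= !nu // eqxx (negbTE pxy) KE // mul1r ltr_pwDl ?exprn_gt0 //.
rewrite big_seq; apply: sumr_ge0 => v vc; rewrite mulr_ge0 ?ler0n // KE ?exprn_ge0 //.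
by have := mem_rem vc; rewrite mem_configs => /eqP.
Qed.

(** A minimum at [i] forces equal colours on the points [i] and [i + 1], which therefore lie on one
    component. *)
Lemma S_entry_cup c w' i : red c w (rcons w' (Cup, i)) -> S_entry s t = 0.
Proof.
move=> r; have := red_run r (run_flip_cat s t); rewrite -cats1 => rw'.
have [k rk] := run_catl rw'; rewrite /=; case: ifP => // le_i [ek].
have lt_i : (i.+1 < h)%N by lia.
have KE u : size u = h -> nth false u i != nth false u i.+1 -> K u = 0.
  move=> su ui; rewrite (K_red r su) -cats1 /colour ev_cat.
  suff -> : ev eqcol eqcol 0 0 w' (ev eqcol eqcol 0 0 [:: (Cup, i)] (fun y => (y == u)%:R)) u =
    ev eqcol eqcol 0 0 w' (fun=> 0) u by rewrite ev0 mulr0.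
  apply: ev_eq rk _ _ su => v sv /=.
  have si : size (take i v) = i by rewrite size_takel; lia.
  have ne a : (take i v ++ [:: a, a & drop i v] == u) = false.
    apply: contraNF ui => /eqP <-; rewrite !nth_cat si ltnn subnn /=.
    by rewrite ltnNge leqnSn /= subSnn.
  by rewrite -{1}(cat_take_drop i v) lay_cup // !ne /eqcol !mulr0 !mul0r !addr0.
rewrite /S_entry ifF //; apply/negbTE/negP => /forallP D.
have wh : (i.+1 < width 0 (tword T) h)%N.
  rewrite /width glue_word take_size_cat ?size_map ?size_iota //.
  by rewrite (eqP (nestP h)) /=; lia.
have le_h : (h <= size (tword T))%N.
  by rewrite glue_word size_cat size_map size_iota leq_addr.
have [x [lx px]] := point_exists le_h (ltnW wh); have [y [ly py]] := point_exists le_h wh.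
have := D x => /forallP/(_ y); rewrite lx ly px py !eqxx (ltnW lt_i) lt_i /=.
have -> : x != y by apply: contra_eqN px => /eqP ->; rewrite py; lia.
rewrite connect_level_h // px py big_seq big1 ?eqxx // => u.
rewrite mem_configs => /eqP su; rewrite !nth_cat su (ltnW lt_i) lt_i.
by have [_|/KE ->] := eqVneq; rewrite ?mul0r ?mulr0.
Qed.

End SEntry.

(** * Quantum sl2 on the spin model *)

Definition top (h : nat) (y : seq bool) : Lam := (y == nseq h true)%:R.

Definition qq : Lam := lamA ^+ 2.
Definition qi : Lam := lamA ^- 2.

Lemma qqK : qq * qi = 1.
Proof. by rewrite divrr // unitrX ?lamA_unit. Qed.

Lemma qq_unit : qq \is a GRing.unit. Proof. by rewrite unitrX ?lamA_unit. Qed.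

Lemma qi_unit : qi \is a GRing.unit. Proof. by rewrite unitrV qq_unit. Qed.

Definition Kf (x : seq bool) : Lam := \prod_(c <- x) (if c then qq else qi).

Lemma Kf_cat x y : Kf (x ++ y) = Kf x * Kf y. Proof. exact: big_cat. Qed.
Lemma Kf_cons c x : Kf (c :: x) = (if c then qq else qi) * Kf x. Proof. exact: big_cons. Qed.
Lemma Kf_rcons c x : Kf (rcons x c) = (if c then qq else qi) * Kf x.
Proof. by rewrite -cats1 Kf_cat /Kf big_seq1 mulrC. Qed.
Lemma Kf0 : Kf [::] = 1. Proof. exact: big_nil. Qed.

(** [Eop x f] is the value at [x] of [E f], where [E] is the raising operator of
    quantum sl2 with coproduct [E (x) K + 1 (x) E]; [Fop] is its transpose for
    the dot product and [Kf] the diagonal operator [K]. *)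
Fixpoint Eop (x : seq bool) (f : seq bool -> Lam) : Lam :=
  if x is c :: x' then
    (if c then Kf x' * f (false :: x') else 0) + Eop x' (fun y => f (c :: y))
  else 0.

Fixpoint Fop (x : seq bool) (f : seq bool -> Lam) : Lam :=
  if x is c :: x' then
    (if c then 0 else Kf x' * f (true :: x')) + Fop x' (fun y => f (c :: y))
  else 0.

Lemma Eop_eq x f g : (forall y, size y = size x -> f y = g y) -> Eop x f = Eop x g.
Proof.
elim: x f g => //= c x IHx f g fg; rewrite fg //; congr (_ + _).
by apply: IHx => y sy; rewrite fg //= sy.
Qed.

Lemma Fop_eq x f g : (forall y, size y = size x -> f y = g y) -> Fop x f = Fop x g.
Proof.
elim: x f g => //= c x IHx f g fg; rewrite fg //; congr (_ + _).
by apply: IHx => y sy; rewrite fg //= sy.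
Qed.

Lemma EopP x a f g : Eop x (fun y => a * f y + g y) = a * Eop x f + Eop x g.
Proof.
elim: x f g => [|c x IHx] f g /=; first by rewrite mulr0 addr0.
by rewrite IHx; case: c; ring.
Qed.

Lemma FopP x a f g : Fop x (fun y => a * f y + g y) = a * Fop x f + Fop x g.
Proof.
elim: x f g => [|c x IHx] f g /=; first by rewrite mulr0 addr0.
by rewrite IHx; case: c; ring.
Qed.

Lemma Eop0 x : Eop x (fun=> 0) = 0.
Proof. by elim: x => //= c x ->; rewrite mulr0 addr0 if_same. Qed.

Lemma Fop0 x : Fop x (fun=> 0) = 0.
Proof. by elim: x => //= c x ->; rewrite mulr0 addr0 if_same. Qed.

Lemma EopZ x a f : Eop x (fun y => a * f y) = a * Eop x f.
Proof. by rewrite -[RHS]addr0 -[in RHS](Eop0 x) -EopP; apply: Eop_eq => y _; rewrite addr0. Qed.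

Lemma FopZ x a f : Fop x (fun y => a * f y) = a * Fop x f.
Proof. by rewrite -[RHS]addr0 -[in RHS](Fop0 x) -FopP; apply: Fop_eq => y _; rewrite addr0. Qed.

Lemma Eop_cat u v f :
  Eop (u ++ v) f = Kf v * Eop u (fun y => f (y ++ v)) + Eop v (fun y => f (u ++ y)).
Proof.
elim: u f => [|c u IHu] f /=; first by rewrite mulr0 add0r.
by rewrite IHu Kf_cat; case: c; ring.
Qed.

Lemma Eop_rcons u c f : Eop (rcons u c) f =
  (if c then qq else qi) * Eop u (fun y => f (rcons y c)) + (if c then f (rcons u false) else 0).
Proof.
rewrite -!cats1 Eop_cat /= Kf_cons !Kf0 mulr1 addr0 mul1r; congr (_ * _ + _).
by apply: Eop_eq => y _; rewrite cats1.
Qed.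

Lemma EF_adjoint n f g :
  \sum_(x <- configs n) Eop x f * g x = \sum_(x <- configs n) f x * Fop x g.
Proof.
elim: n f g => [|n IHn] f g; first by rewrite !big_seq1 /= mul0r mulr0.
rewrite /= !big_cat !big_map /=.
under eq_bigr do rewrite mulrDl.
under [X in _ + X]eq_bigr do rewrite add0r.
under [X in _ = X + _]eq_bigr do rewrite add0r.
under [X in _ = _ + X]eq_bigr do rewrite mulrDr.
rewrite !big_split /= !IHn.
have -> : \sum_(x <- configs n) Kf x * f (false :: x) * g (true :: x) =
    \sum_(x <- configs n) f (false :: x) * (Kf x * g (true :: x)).
  by apply: eq_bigr => x _; ring.
by ring.
Qed.

(** [Eop x] samples [f] at states with one more down spin than [x], whose [Kf] is smaller by the
    factor [qq ^+ 2]. *)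
Lemma Eop_Kf x f : qq ^+ 2 * Eop x (fun y => Kf y * f y) = Kf x * Eop x f.
Proof.
elim: x f => [|c x IHx] f /=; first by rewrite !mulr0.
have -> : Eop x (fun y => Kf (c :: y) * f (c :: y)) =
   (if c then qq else qi) * Eop x (fun y => Kf y * f (c :: y)).
  by rewrite -EopZ; apply: Eop_eq => y _; rewrite Kf_cons mulrA.
rewrite mulrDr [_ * (_ * Eop _ _)]mulrCA IHx !Kf_cons mulrDr; congr (_ + _); last by rewrite mulrA.
by case: c; rewrite ?mulr0 //; ring: qqK.
Qed.

Lemma Fop_Kf x f : Fop x (fun y => Kf y * f y) = qq ^+ 2 * (Kf x * Fop x f).
Proof.
elim: x f => [|c x IHx] f /=; first by rewrite !mulr0.
have -> : Fop x (fun y => Kf (c :: y) * f (c :: y)) =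
   (if c then qq else qi) * Fop x (fun y => Kf y * f (c :: y)).
  by rewrite -FopZ; apply: Fop_eq => y _; rewrite Kf_cons mulrA.
rewrite IHx !Kf_cons; case: c; first by ring.
by ring: qqK.
Qed.

(** The commutation relation of quantum sl2, cleared of denominators. The twist [qi ^+ 2] appears
    because the transpose of [E] is [qq] times [K] times the usual lowering operator. *)
Lemma EF_comm x f :
  (qq ^+ 2 - 1) * (Eop x (Fop^~ f) - qi ^+ 2 * Fop x (Eop^~ f)) = (Kf x ^+ 2 - 1) * f x.
Proof.
elim: x f => [|c x IHx] f /=; first by rewrite Kf0; ring.
have /eqP := IHx (fun z => f (c :: z)); rewrite -subr_eq0 => /eqP IH.
apply/eqP; rewrite -subr_eq0 -[X in _ == X]IH; apply/eqP; case: c {IH}; rewrite Kf_cons.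
  have -> : Eop x (fun y => 0 + Fop y (fun z => f (true :: z))) =
     Eop x (Fop^~ (fun z => f (true :: z))) by apply: Eop_eq => y _; rewrite add0r.
  have -> : Fop x (fun y => Kf y * f (false :: y) + Eop y (fun z => f (true :: z))) =
     qq ^+ 2 * (Kf x * Fop x (fun y => f (false :: y))) + Fop x (Eop^~ (fun z => f (true :: z))).
    rewrite -Fop_Kf -[X in X + _]mul1r -FopP.
    by apply: Fop_eq => y _; rewrite mul1r.
  by ring: qqK.
have E2 : Eop x (fun y => Kf y * f (true :: y)) = qi ^+ 2 * Kf x * Eop x (fun y => f (true :: y)).
  by rewrite -mulrA -Eop_Kf mulrA -exprMn [qi * _]mulrC qqK expr1n mul1r.
have -> : Eop x (fun y => Kf y * f (true :: y) + Fop y (fun z => f (false :: z))) =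
   Eop x (fun y => Kf y * f (true :: y)) + Eop x (Fop^~ (fun z => f (false :: z))).
  rewrite -[X in _ = X + _]mul1r -EopP; apply: Eop_eq => y _; by rewrite mul1r.
have -> : Fop x (fun y => 0 + Eop y (fun z => f (false :: z))) =
   Fop x (Eop^~ (fun z => f (false :: z))) by apply: Fop_eq => y _; rewrite add0r.
by rewrite E2; ring: qqK.
Qed.

(** The two-spin vector of a maximum is invariant: [E] kills it and [K] fixes it. *)
Lemma Eop_cap x i G : (i + 2 <= size x)%N ->
  Eop x (spin [:: (Cap, i)] G) = spin [:: (Cap, i)] (Eop^~ G) x.
Proof.
move=> /split2[u [a [b [v [-> su]]]]].
rewrite /spin /= lay_cap // -[[:: a, b & v]]/([:: a; b] ++ v).
rewrite Eop_cat (Eop_cat [:: a; b] v) (Eop_cat u v).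
have -> : Eop u (fun y => lay spin_cap spin_cup lamA lamA^-1 (Cap, i) G (y ++ [:: a; b] ++ v)) =
    spin_cap a b * Eop u (fun y => G (y ++ v)).
  by rewrite -EopZ; apply: Eop_eq => y sy; rewrite lay_cap // sy.
have -> : Eop v (fun y => lay spin_cap spin_cup lamA lamA^-1 (Cap, i) G (u ++ [:: a; b] ++ y)) =
    spin_cap a b * Eop v (fun y => G (u ++ y)).
  by rewrite -EopZ; apply: Eop_eq => y sy; rewrite lay_cap.
rewrite /= !lay_cap // !Kf_cons !Kf0.
by case: a; case: b; rewrite /= -?/qi; ring: qqK.
Qed.

(** [f] is a highest weight vector of weight [p] on [n] strands. *)
Definition hw (n p : nat) (f : seq bool -> Lam) : Prop :=
  forall x, size x = n -> Eop x f = 0 /\ Kf x * f x = qq ^+ p * f x.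

Lemma hw_eq n p f g : (forall x, size x = n -> f x = g x) -> hw n p f -> hw n p g.
Proof.
move=> fg hf x sx; have [Ef Kx] := hf x sx; split; last by rewrite -!fg.
by rewrite -Ef; apply: Eop_eq => y; rewrite sx => /fg.
Qed.

Lemma hwP n p a f g : hw n p f -> hw n p g -> hw n p (fun x => a * f x + g x).
Proof.
move=> hf hg x sx; have [Ef Kx] := hf x sx; have [Eg Kg] := hg x sx.
rewrite EopP Ef Eg mulr0 addr0; split=> //.
by rewrite !mulrDr Kg [Kf x * _]mulrCA Kx; ring.
Qed.

Lemma hw_sum n p (I : eqType) (r : seq I) (c : I -> Lam) (F : I -> seq bool -> Lam) :
  (forall i, i \in r -> hw n p (F i)) -> hw n p (fun x => \sum_(i <- r) c i * F i x).
Proof.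
elim: r => [_|i r IHr hF].
  by move=> x _; split; [under Eop_eq do rewrite big_nil; exact: Eop0 | rewrite big_nil !mulr0].
have hi := hF i (mem_head _ _); have hr : hw n p (fun x => \sum_(i <- r) c i * F i x).
  by apply: IHr => j jr; apply: hF; rewrite inE jr orbT.
by apply: hw_eq (hwP (c i) hi hr) => x _; rewrite big_cons.
Qed.

Lemma hw_top h : hw h h (top h).
Proof.
have Et x f : (forall y, false \in y -> f y = 0) -> Eop x f = 0.
  elim: x f => //= c x IHx f f0; rewrite f0 ?inE // mulr0 if_same add0r.
  by apply: IHx => y yf; rewrite f0 // inE yf orbT.
move=> x sx; split.
  apply: Et => y yf; rewrite /top; case: eqP => // ey; move: yf.
  by rewrite ey mem_nseq andbF.
rewrite /top; case: eqP => [->|]; rewrite ?mulr0 // /Kf big_nseq.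
by rewrite iter_mulr_1.
Qed.

Lemma hw_cap n p i G : (i + 2 <= n)%N -> hw (n - 2) p G -> hw n p (spin [:: (Cap, i)] G).
Proof.
move=> le_i hG x sx; rewrite Eop_cap ?sx //.
have := le_i; rewrite -{1}sx => /split2[u [a [b [v [ex su]]]]].
have suv : size (u ++ v) = (n - 2)%N by rewrite -sx ex !size_cat /=; lia.
have [EG KG] := hG _ suv; rewrite ex /spin /= !lay_cap // EG mulr0; split=> //.
move: KG; rewrite !Kf_cat !Kf_cons => KG; rewrite [RHS]mulrCA -KG.
by case: a {ex}; case: b; rewrite /= -?/qi; ring: qqK.
Qed.

Lemma hw_cap_word n m p w G : cap_word w -> run n w = Some m -> hw m p G -> hw n p (spin w G).
Proof.
elim: w n => [n _ [->] //|[x i] w IHw n /= /andP[/eqP /= -> cw]] /=.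
case: ifP => // le_i rw hG; apply: hw_cap => //; apply: IHw => //.
by rewrite -rw; congr run; lia.
Qed.

Definition qd (p : nat) : Lam := qq ^+ (2 * p) - 1.
(** The quantum integer [1 + qq ^+ 2 + ... + qq ^+ (2 * (p - 1))], the eigenvalue of [E F] on
    highest weight vectors of weight [p]. *)
Definition cc (p : nat) : Lam := qd p / qd 1.

Lemma qd_unit p : qd p.+1 \is a GRing.unit.
Proof.
by rewrite /qd /qq -exprM (_ : (2 * (2 * p.+1))%N = (p * 4 + 3).+1) ?lamA_exp_sub1_unit //; lia.
Qed.

Lemma cc_unit p : cc p.+1 \is a GRing.unit.
Proof. by rewrite /cc unitrM unitrV !qd_unit. Qed.

Lemma hw_EF n p f x : hw n p f -> size x = n -> Eop x (Fop^~ f) = cc p * f x.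
Proof.
move=> hf sx; have [Ef Kx] := hf x sx; have := EF_comm x f.
have -> : Fop x (Eop^~ f) = 0.
  rewrite -(Fop0 x); apply: Fop_eq => y; rewrite sx => sy; by case: (hf y sy).
have K2 : Kf x ^+ 2 * f x = qq ^+ (2 * p) * f x.
  by rewrite expr2 -mulrA Kx mulrCA Kx mulrA -exprD addnn mul2n.
rewrite mulr0 subr0 [RHS]mulrBl K2 mul1r => E; apply: (mulrI (qd_unit 0)).
rewrite [LHS]E /cc [_ / _]mulrC !mulrA divrr ?qd_unit // mul1r /qd; ring.
Qed.

(** * Adding one spin to a highest weight vector *)

Definition dot n (f g : seq bool -> Lam) : Lam := \sum_(x <- configs n) f x * g x.

Lemma dotC n f g : dot n f g = dot n g f.
Proof. by apply: eq_bigr => x _; rewrite mulrC. Qed.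

Lemma eq_dot n f f' g g' : (forall x, size x = n -> f x = f' x) ->
  (forall x, size x = n -> g x = g' x) -> dot n f g = dot n f' g'.
Proof.
move=> ff' gg'; rewrite /dot big_seq [RHS]big_seq; apply: eq_bigr => x.
by rewrite mem_configs => /eqP sx; rewrite ff' ?gg'.
Qed.

Lemma dot_suml n (I : Type) (r : seq I) (c : I -> Lam) (F : I -> seq bool -> Lam) g :
  dot n (fun x => \sum_(i <- r) c i * F i x) g = \sum_(i <- r) c i * dot n (F i) g.
Proof.
rewrite /dot; under eq_bigr do rewrite mulr_suml.
rewrite exchange_big /=; apply: eq_bigr => i _; rewrite mulr_sumr.
by apply: eq_bigr => x _; rewrite mulrA.
Qed.

Lemma dotS n f g : dot n.+1 f g =
  dot n (fun x => f (rcons x true)) (fun x => g (rcons x true)) +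
  dot n (fun x => f (rcons x false)) (fun x => g (rcons x false)).
Proof.
rewrite /dot -addn1 sum_configsD -big_split /=; apply: eq_bigr => x _.
by rewrite !big_cons big_nil addr0 -!cats1.
Qed.

Definition add_up (f : seq bool -> Lam) (x : seq bool) : Lam :=
  (last false x)%:R * f (take (size x).-1 x).

Definition add_down (c : Lam) (f : seq bool -> Lam) (x : seq bool) : Lam :=
  let x' := take (size x).-1 x in if last false x then c * Fop x' f else f x'.

Lemma take_rcons (x : seq bool) a : take (size (rcons x a)).-1 (rcons x a) = x.
Proof. by rewrite size_rcons /= -cats1 take_size_cat. Qed.

Lemma add_up_rcons f x a : add_up f (rcons x a) = a%:R * f x.
Proof. by rewrite /add_up take_rcons last_rcons. Qed.

Lemma add_down_rcons c f x a : add_down c f (rcons x a) = if a then c * Fop x f else f x.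
Proof. by rewrite /add_down take_rcons last_rcons. Qed.

Lemma rconsP n (x : seq bool) : size x = n.+1 -> exists y a, x = rcons y a /\ size y = n.
Proof. by case/lastP: x => // y a; rewrite size_rcons => -[]; exists y, a. Qed.

Lemma hw_up n p f : hw n p f -> hw n.+1 p.+1 (add_up f).
Proof.
move=> hf _ /rconsP[x [a [-> sx]]]; have [Ef Kx] := hf x sx.
rewrite Eop_rcons !add_up_rcons Kf_rcons; split.
  have -> : Eop x (fun y => add_up f (rcons y a)) = a%:R * Eop x f.
    by rewrite -EopZ; apply: Eop_eq => y _; rewrite add_up_rcons.
  by rewrite Ef !mulr0 add0r mul0r if_same.
by case: a => /=; rewrite ?mul0r ?mulr0 // !mul1r -mulrA Kx exprS mulrA.
Qed.

(** The coefficient for which [add_down (gam p)] preserves highest weight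
    vectors; it is meaningless at [p = 0], where [cc 0 = 0]. *)
Definition gam (p : nat) : Lam := - (qq * cc p)^-1.

Lemma gam_cc p : qq * (gam p.+1 * cc p.+1) = -1.
Proof.
rewrite /gam mulrCA mulNr mulVr // unitrM qq_unit; exact: cc_unit.
Qed.

Lemma hw_down n p f : hw n p.+1 f -> hw n.+1 p (add_down (gam p.+1) f).
Proof.
move=> hf _ /rconsP[x [a [-> sx]]]; have [Ef Kx] := hf x sx.
rewrite Eop_rcons Kf_rcons !add_down_rcons; split.
  case: a.
    have -> : Eop x (fun y => add_down (gam p.+1) f (rcons y true)) = gam p.+1 * Eop x (Fop^~ f).
      by rewrite -EopZ; apply: Eop_eq => y _; rewrite add_down_rcons.
    (* This cancellation is the equation that determines [gam]. *)
    by rewrite (hw_EF hf sx) [gam _ * _]mulrA [qq * _]mulrA gam_cc mulN1r addNr.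
  rewrite addr0 -[RHS](mulr0 qi) -Ef; congr (_ * _).
  by apply: Eop_eq => y _; rewrite add_down_rcons.
have E1 : qi * qq ^+ p.+1 = qq ^+ p by rewrite exprS mulrA [qi * _]mulrC qqK mul1r.
case: a; last by rewrite -mulrA Kx mulrA E1.
have := Fop_Kf x f.
have -> : Fop x (fun y => Kf y * f y) = qq ^+ p.+1 * Fop x f.
  by rewrite -FopZ; apply: Fop_eq => y; rewrite sx => /hf[].
rewrite exprS => E2.
have E3 : qq * (Kf x * Fop x f) = qq ^+ p * Fop x f.
  apply: (mulrI qq_unit); transitivity (qq ^+ 2 * (Kf x * Fop x f)); first by ring.
  by rewrite -E2; ring.
by rewrite [RHS]mulrCA -E3; ring.
Qed.

Lemma dot_up n f g : dot n.+1 (add_up f) (add_up g) = dot n f g.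
Proof.
rewrite dotS [X in _ + X](_ : _ = 0); last first.
  by apply: big1 => x _; rewrite !add_up_rcons !mul0r.
by rewrite addr0; apply: eq_dot => x _; rewrite add_up_rcons mul1r.
Qed.

(** Only the up components meet, and [f] against [F g] is [E f = 0] against [g]. *)
Lemma dot_up_down n p c f g : hw n p f -> dot n.+1 (add_up f) (add_down c g) = 0.
Proof.
move=> hf; rewrite dotS [X in _ + X](_ : _ = 0); last first.
  by apply: big1 => x _; rewrite !add_up_rcons !mul0r.
transitivity (c * \sum_(x <- configs n) f x * Fop x g).
  rewrite addr0 mulr_sumr; apply: eq_bigr => x _.
  by rewrite add_up_rcons add_down_rcons mul1r mulrCA.
rewrite -EF_adjoint big_seq big1 ?mulr0 // => x; rewrite mem_configs => /eqP /hf[-> _].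
by rewrite mul0r.
Qed.

(** In the up component, [F f] against [F g] is [E F f = cc p * f] against [g]. *)
Lemma dot_down n p c f g : hw n p f ->
  dot n.+1 (add_down c f) (add_down c g) = (1 + c ^+ 2 * cc p) * dot n f g.
Proof.
move=> hf; rewrite dotS addrC mulrDl mul1r; congr (_ + _).
  by apply: eq_dot => x _; rewrite add_down_rcons.
transitivity (c ^+ 2 * \sum_(x <- configs n) Fop x f * Fop x g).
  rewrite mulr_sumr; apply: eq_bigr => x _; rewrite !add_down_rcons; ring.
rewrite -(EF_adjoint n (Fop^~ f)) -mulrA; congr (_ * _).
rewrite /dot mulr_sumr big_seq [RHS]big_seq; apply: eq_bigr => x.
by rewrite mem_configs => /eqP sx; rewrite (hw_EF hf sx) mulrA.
Qed.

(** * An orthogonal basis indexed by paths *)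

(** The tuples of [D n h], read backwards and preceded by the height [0]. *)
Fixpoint paths (n h : nat) : seq (seq nat) :=
  if n is n'.+1 then
    [seq h :: s | s <- (if h is h'.+1 then paths n' h' else [::]) ++ paths n' h.+1]
  else if h is 0 then [:: [::]] else [::].

Definition lower n h := if h is h'.+1 then paths n h' else [::].

Lemma pathsS n h : paths n.+1 h = [seq h :: s | s <- lower n h ++ paths n h.+1].
Proof. by []. Qed.

Lemma paths_head n h s : s \in paths n h -> size s = n /\ head 0%N s = h.
Proof.
elim: n h s => [|n IHn] h s; first by case: h => // /[!inE] /eqP ->.
move=> /mapP[s' s'P ->] /=; split=> //; congr _.+1; move: s'P.
by rewrite mem_cat => /orP[|/IHn[]//]; case: h => // h /IHn[].
Qed.

Lemma lower_head n h s : s \in lower n h ->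
  [/\ size s = n, h = (head 0%N s).+1 & s \in paths n (head 0%N s)].
Proof. by case: h => // h /[dup] sP /paths_head[-> hs]; rewrite hs. Qed.

Lemma sum_paths (V : nmodType) n h (F : seq nat -> V) :
  \sum_(s <- paths n.+1 h) F s =
  \sum_(s <- lower n h) F (h :: s) + \sum_(s <- paths n h.+1) F (h :: s).
Proof. by rewrite pathsS big_map big_cat. Qed.

Lemma prod_paths n h (F : seq nat -> Lam) :
  \prod_(s <- paths n.+1 h) F s =
  \prod_(s <- lower n h) F (h :: s) * \prod_(s <- paths n h.+1) F (h :: s).
Proof. by rewrite pathsS big_map big_cat. Qed.

Lemma uniq_paths n h : uniq (paths n h).
Proof.
elim: n h => [|n IHn] h; first by case: h.
rewrite pathsS map_inj_uniq => [|s s' [] //]; rewrite cat_uniq IHn andbT.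
apply/andP; split; first by case: h.
apply/hasPn => s /paths_head[_ hs]; apply/negP => /lower_head[_ + _]; rewrite hs; lia.
Qed.

Fixpoint zvec (s : seq nat) : seq bool -> Lam :=
  if s is y :: s' then
    let p := head 0%N s' in
    if y == p.+1 then add_up (zvec s') else add_down (gam p) (zvec s')
  else fun x => (x == [::])%:R.

Fixpoint znorm (s : seq nat) : Lam :=
  if s is y :: s' then
    let p := head 0%N s' in
    znorm s' * (if y == p.+1 then 1 else 1 + gam p ^+ 2 * cc p)
  else 1.

Lemma zvec_lower n h s : s \in lower n h -> zvec (h :: s) = add_up (zvec s).
Proof. by move=> /lower_head[_ -> _] /=; rewrite eqxx. Qed.

Lemma zvec_upper n h s : s \in paths n h.+1 -> zvec (h :: s) = add_down (gam h.+1) (zvec s).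
Proof. by move=> /paths_head[_ hs] /=; rewrite hs ltn_eqF. Qed.

Lemma znorm_lower n h s : s \in lower n h -> znorm (h :: s) = znorm s.
Proof. by move=> /lower_head[_ -> _] /=; rewrite eqxx mulr1. Qed.

Lemma znorm_upper n h s : s \in paths n h.+1 ->
  znorm (h :: s) = (1 + gam h.+1 ^+ 2 * cc h.+1) * znorm s.
Proof. by move=> /paths_head[_ hs] /=; rewrite hs ltn_eqF // mulrC. Qed.

Lemma hw_zvec n h s : s \in paths n h -> hw n h (zvec s).
Proof.
elim: n h s => [|n IHn] h s.
  case: h => // /[!inE] /eqP -> x /size0nil ->; split=> //.
  by rewrite Kf0 expr0.
move=> /mapP[s' + ->]; rewrite mem_cat => /orP[sL|sU].
  by rewrite (zvec_lower sL); have [_ -> sP] := lower_head sL; apply: hw_up; exact: IHn.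
by rewrite (zvec_upper sU); apply: hw_down; exact: IHn.
Qed.

Lemma dot_zvec n h s s' : s \in paths n h -> s' \in paths n h ->
  dot n (zvec s) (zvec s') = (s == s')%:R * znorm s.
Proof.
elim: n h s s' => [|n IHn] h s s'.
  case: h => //; rewrite !inE => /eqP -> /eqP ->.
  by rewrite /dot big_seq1.
move=> /mapP[r + ->] /mapP[r' + ->]; rewrite !mem_cat eqseq_cons eqxx andTb.
have sep a b : a \in lower n h -> b \in paths n h.+1 -> (a == b) = false.
  by move=> /lower_head[_ -> _] /paths_head[_ hb]; apply: contra_eqF hb => /eqP ->; lia.
move=> /orP[] rP /orP[] r'P.
- rewrite (zvec_lower rP) (zvec_lower r'P) (znorm_lower rP) dot_up.
  by case: h rP r'P {sep} => // h; exact: IHn.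
- rewrite (zvec_lower rP) (zvec_upper r'P) sep // mul0r.
  by have [_ _ rP'] := lower_head rP; exact: dot_up_down (hw_zvec rP').
- rewrite dotC (zvec_upper rP) (zvec_lower r'P) eq_sym sep // mul0r.
  by have [_ _ rP'] := lower_head r'P; exact: dot_up_down (hw_zvec rP').
- rewrite (zvec_upper rP) (zvec_upper r'P) (znorm_upper rP) (dot_down _ _ (hw_zvec rP)).
  by rewrite (IHn _ _ _ rP r'P) mulrCA.
Qed.

Lemma Delta_cc m : Delta m = (-1) ^+ m * qi ^+ m * cc m.+1.
Proof.
have diffE j : lamA ^+ (2 * j) - lamA ^- (2 * j) = qi ^+ j * qd j.
  rewrite -exprVn !exprM exprVn -/qi -/qq /qd mulrBr mulr1 mul2n -addnn exprD mulrA -exprMn.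
  by rewrite [qi * _]mulrC qqK expr1n mul1r.
have U : qi * qd 1 \is a GRing.unit by rewrite unitrM qd_unit unitrV qq_unit.
have := diffE 1%N; rewrite muln1 expr1 => d2; rewrite /Delta diffE d2.
apply: (mulIr U); rewrite divrK // /cc; set c := qd m.+1.
transitivity ((-1) ^+ m * qi ^+ m.+1 * (c / qd 1 * qd 1)); last first.
  by move: (c / qd 1) (qd 1) => e d; rewrite exprS; ring.
by rewrite divrK ?qd_unit // mulrA.
Qed.

(** As [gam * cc = - qi], the bracket is [(cc p.+1 + qi ^+ 2) / cc p.+1], that is
    [qi ^+ 2 * cc p.+2 / cc p.+1]; the ratio of the [Delta] is [- qi * cc p.+2 / cc p.+1]. *)
Lemma down_norm p : - qq * (1 + gam p.+1 ^+ 2 * cc p.+1) = Delta p.+1 / Delta p.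
Proof.
have cS : cc p.+2 = qq ^+ 2 * cc p.+1 + 1.
  apply: (mulIr (qd_unit 0)).
  transitivity (qq ^+ 2 * (cc p.+1 * qd 1) + qd 1); last by ring.
  by rewrite /cc !divrK ?qd_unit // /qd (mulnS 2 p.+1) exprD muln1; ring.
apply: (mulIr (Delta_unit p)); rewrite divrK ?Delta_unit // !Delta_cc cS.
have gc : gam p.+1 * cc p.+1 = - qi.
  by apply: (mulrI qq_unit); rewrite gam_cc mulrN qqK.
transitivity (- qq * (cc p.+1 + (gam p.+1 * cc p.+1) ^+ 2) * ((-1) ^+ p * qi ^+ p)); first by ring.
by rewrite gc !exprS; ring: qqK.
Qed.

(** [E] is injective in negative weights. *)
Definition lowest_free n : Prop := forall m f,
  (forall x, size x = n -> Eop x f = 0 /\ Kf x * (qq ^+ m.+1 * f x) = f x) ->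
  forall x, size x = n -> f x = 0.

Definition spanned n : Prop := forall p f, hw n p f ->
  exists c : seq nat -> Lam, forall x, size x = n ->
    f x = \sum_(b <- paths n p) c b * zvec b x.

Lemma znorm_unit n h s : s \in paths n h -> znorm s \is a GRing.unit.
Proof.
elim: n h s => [|n IHn] h s.
  by case: h => // /[!inE] /eqP ->; rewrite unitr1.
move=> /mapP[r + ->]; rewrite mem_cat => /orP[rL|rU].
  by rewrite (znorm_lower rL); have [_ _ /IHn] := lower_head rL.
rewrite (znorm_upper rU) unitrM (IHn _ _ rU) andbT.
have U : - qq * (1 + gam h.+1 ^+ 2 * cc h.+1) \is a GRing.unit.
  by rewrite down_norm unitrM unitrV !Delta_unit.
by move: U; rewrite unitrM => /andP[].
Qed.

(** Subtracting the given combination from [f] leaves a vector that ends with an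
    up spin, whose first [n] spins form a highest weight vector of weight [p - 1]. *)
Lemma hw_extend n p f (c : seq nat -> Lam) : lowest_free n -> spanned n -> hw n.+1 p f ->
  (forall x, size x = n -> f (rcons x false) = \sum_(b <- paths n p.+1) c b * zvec b x) ->
  exists d : seq nat -> Lam, forall x, size x = n.+1 ->
    f x = \sum_(b <- lower n p) d b * zvec (p :: b) x +
          \sum_(b <- paths n p.+1) c b * zvec (p :: b) x.
Proof.
move=> L S hf fF.
pose r x := -1 * \sum_(b <- paths n p.+1) c b * zvec (p :: b) x + f x.
have hr : hw n.+1 p r.
  apply: hwP hf; apply: (@hw_sum _ _ _ _ c (fun b => zvec (p :: b))) => b bP; apply: hw_zvec.
  by rewrite pathsS map_f // mem_cat bP orbT.
have rF x : size x = n -> r (rcons x false) = 0.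
  move=> sx; rewrite /r fF // mulN1r addrC; apply/eqP; rewrite subr_eq0; apply/eqP.
  rewrite big_seq [RHS]big_seq; apply: eq_bigr => b bP.
  by rewrite (zvec_upper bP) add_down_rcons.
pose w x := r (rcons x true).
have rw d : (forall x, size x = n -> w x = \sum_(b <- lower n p) d b * zvec b x) ->
    forall x, size x = n.+1 -> r x = \sum_(b <- lower n p) d b * zvec (p :: b) x.
  move=> wd _ /rconsP[x [a [-> sx]]]; rewrite big_seq.
  case: a; last first.
    by rewrite rF // big1 // => b bP; rewrite (zvec_lower bP) add_up_rcons mul0r mulr0.
  rewrite -/(w x) wd // big_seq; apply: eq_bigr => b bP.
  by rewrite (zvec_lower bP) add_up_rcons mul1r.
suff [d wd] : exists d : seq nat -> Lam,
    forall x, size x = n -> w x = \sum_(b <- lower n p) d b * zvec b x.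
  by exists d => x sx; rewrite -(rw d wd) // /r mulN1r addrAC addNr add0r.
have Ew x : size x = n -> Eop x w = 0.
  move=> sx; have [|+ _] := hr (rcons x true); first by rewrite size_rcons sx.
  rewrite Eop_rcons rF // addr0 => E; apply: (mulrI qq_unit); rewrite mulr0 -[RHS]E.
  by congr (_ * _).
have Kw x : size x = n -> qq * Kf x * w x = qq ^+ p * w x.
  move=> sx; have [|_] := hr (rcons x true); first by rewrite size_rcons sx.
  by rewrite Kf_rcons.
(* At height 0 the vector [w] has weight -1 and vanishes; at positive height spanning applies. *)
move: w Ew Kw {rw} => w Ew Kw; case: p {rF hr r fF hf c f} w Ew Kw => [|p] w Ew Kw.
  exists (fun=> 0) => x sx; rewrite big_nil; apply: (L 0%N) sx => y sy; split; first exact: Ew.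
  by rewrite mulrA [Kf y * _]mulrC Kw // mul1r.
apply: S => x sx; split; first exact: Ew.
by apply: (mulrI qq_unit); rewrite mulrA Kw // exprS mulrA.
Qed.

(** Spanning at [n + 1]: the part of [f] ending with a down spin is itself of highest weight, one
    higher, so it expands by induction and [hw_extend] supplies the rest. *)
Lemma span_lowest n : spanned n /\ lowest_free n.
Proof.
elim: n => [|n [S L]].
  split=> [p f hf|m f H x /size0nil ->].
    case: p hf => [|p] hf.
      exists (fun=> f [::]) => x /size0nil ->; by rewrite big_seq1 /= mulr1.
    exists (fun=> 0) => x /size0nil ->; rewrite big_nil.
    have [_] := hf [::] erefl; rewrite Kf0 mul1r => E.
    have U : (1 - qq ^+ p.+1) \is a GRing.unit.
      rewrite -unitrN opprB /qq -exprM.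
      by rewrite (_ : (2 * p.+1)%N = (2 * p + 1).+1) ?lamA_exp_sub1_unit //; lia.
    by apply: (mulrI U); rewrite mulr0 mulrBl mul1r -E subrr.
  have [_] := H [::] erefl; rewrite Kf0 mul1r => E.
  have U : (1 - qq ^+ m.+1) \is a GRing.unit.
    rewrite -unitrN opprB /qq -exprM.
    by rewrite (_ : (2 * m.+1)%N = (2 * m + 1).+1) ?lamA_exp_sub1_unit //; lia.
  by apply: (mulrI U); rewrite mulr0 mulrBl mul1r E subrr.
split=> [p f hf|m f H].
  have hF : hw n p.+1 (fun x => f (rcons x false)).
    move=> x sx; have [|] := hf (rcons x false); first by rewrite size_rcons sx.
    rewrite Eop_rcons addr0 Kf_rcons => E K; split.
      by apply: (mulrI qi_unit); rewrite mulr0 -[RHS]E.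
    by rewrite exprS -mulrA -K !mulrA qqK mul1r.
  have [c fF] := S _ _ hF; have [d fE] := hw_extend L S hf fF.
  exists (fun b => if head 0%N (behead b) == p.+1 then c (behead b) else d (behead b)) => x sx.
  rewrite fE // sum_paths; congr (_ + _); rewrite big_seq [RHS]big_seq; apply: eq_bigr => b bP.
    rewrite [behead _]/= ifF //; have [_ -> _] := lower_head bP.
    by rewrite ltn_eqF.
  by rewrite [behead _]/= (paths_head bP).2 eqxx.
pose f1 x := f (rcons x true); pose f2 x := f (rcons x false).
have H1 x : size x = n -> qq * Eop x f1 + f2 x = 0 /\ qq * Kf x * (qq ^+ m.+1 * f1 x) = f1 x.
  by move=> sx; have := H (rcons x true); rewrite size_rcons sx Eop_rcons Kf_rcons => /(_ erefl).
have H2 x : size x = n -> Eop x f2 = 0 /\ Kf x * (qq ^+ m * f2 x) = f2 x.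
  move=> sx; have := H (rcons x false); rewrite size_rcons sx Eop_rcons Kf_rcons addr0.
  move=> /(_ erefl)[E K]; split.
    by apply: (mulrI qi_unit); rewrite mulr0 -[RHS]E.
  transitivity (qi * Kf x * (qq ^+ m.+1 * f2 x)); last exact: K.
  by rewrite exprS; ring: qqK.
have f20 x : size x = n -> f2 x = 0.
  (* [f2] has weight [-m]. For [m = 0] it lies in the span of the [zvec] of weight 0, and being
     [- qq * E f1] it is orthogonal to all of them. *)
  case: m {H} H1 H2 => [|m] H1 H2; last exact: L H2 x.
  have hf2 : hw n 0 f2.
    by move=> y sy; have [E K] := H2 y sy; split=> //; rewrite expr0 mul1r -{2}K mul1r.
  have [c f2E] := S _ _ hf2.
  have c0 b : b \in paths n 0 -> c b = 0.
    move=> bP; apply: (mulIr (znorm_unit bP)); rewrite mul0r.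
    (* [F zvec] has weight -2 and is killed by [E], since [cc 0 = 0]. *)
    have Fz y : size y = n -> Fop y (zvec b) = 0.
      apply: (L 1%N (fun y => Fop y (zvec b))) => z sz; split.
        by rewrite (hw_EF (hw_zvec bP) sz) /cc /qd muln0 expr0 subrr !mul0r.
      rewrite mulrCA -Fop_Kf; apply: Fop_eq => u; rewrite sz => /(hw_zvec bP)[_ ->].
      by rewrite mul1r.
    transitivity (dot n f2 (zvec b)).
      rewrite (eq_dot f2E (fun _ _ => erefl)) dot_suml (bigD1_seq b) ?uniq_paths //=.
      rewrite (dot_zvec bP bP) eqxx mul1r big1_seq ?addr0 // => b' /andP[ne b'P].
      by rewrite (dot_zvec b'P bP) (negbTE ne) mul0r mulr0.
    transitivity (\sum_(y <- configs n) - qq * (Eop y f1 * zvec b y)).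
      rewrite /dot big_seq [RHS]big_seq; apply: eq_bigr => y; rewrite mem_configs => /eqP sy.
      by have [/eqP + _] := H1 y sy; rewrite addrC addr_eq0 => /eqP ->; rewrite mulrA !mulNr.
    rewrite -mulr_sumr EF_adjoint big_seq big1 ?mulr0 // => y; rewrite mem_configs => /eqP sy.
    by rewrite Fz // mulr0.
  by move=> sx; rewrite f2E // big_seq big1 // => b /c0 ->; rewrite mul0r.
have f10 x : size x = n -> f1 x = 0.
  apply: (L m.+1) => y sy; have [E K] := H1 y sy; split.
    by apply: (mulrI qq_unit); rewrite mulr0 -[RHS]E f20 // addr0.
  by rewrite -[RHS]K !exprS; ring.
by move=> _ /rconsP[x [a [-> sx]]]; case: a; [exact: f10 | exact: f20].
Qed.

(** * The Gram determinant *)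

(** The word of [Bprime] on reversed tuples: a step down to [y] joins the last two of [y + 2]
    strands, which are [y] and [y + 1] counted from 0. *)
Fixpoint path_word (s : seq nat) : seq layer :=
  if s is y :: s' then
    path_word s' ++ (if y == (head 0%N s').+1 then [::] else [:: (Cap, y)])
  else [::].

Lemma path_word_lower n h s : s \in lower n h -> path_word (h :: s) = path_word s.
Proof. by move=> /lower_head[_ -> _] /=; rewrite eqxx cats0. Qed.

Lemma path_word_upper n h s : s \in paths n h.+1 ->
  path_word (h :: s) = path_word s ++ [:: (Cap, h)].
Proof. by move=> /paths_head[_ hs] /=; rewrite hs ltn_eqF. Qed.

Lemma cap_path_word s : cap_word (path_word s).
Proof. by elim: s => //= y s IHs; rewrite /cap_word all_cat [all _ _]IHs; case: ifP. Qed.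

Lemma run_path_word n h s : s \in paths n h -> run n (path_word s) = Some h.
Proof.
elim: n h s => [|n IHn] h s; first by case: h => // /[!inE] /eqP ->.
move=> /mapP[r + ->]; rewrite mem_cat => /orP[rL|rU].
  rewrite (path_word_lower rL); have [_ -> rP] := lower_head rL.
  by have := run_widen 1 (IHn _ _ rP); rewrite !addn1.
have := run_widen 1 (IHn _ _ rU); rewrite !addn1 (path_word_upper rU) run_cat => -> /=.
by rewrite addn2 leqnn subn2 addn0.
Qed.

Definition Yvec (s : seq nat) : seq bool -> Lam := spin (path_word s) (top (head 0%N s)).

Lemma hw_Yvec n h s : s \in paths n h -> hw n h (Yvec s).
Proof.
move=> sP; rewrite /Yvec (paths_head sP).2.
exact: hw_cap_word (cap_path_word s) (run_path_word sP) (@hw_top h).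
Qed.

Lemma top_rcons h x a : top h.+1 (rcons x a) = a%:R * top h x.
Proof.
have E : nseq h.+1 true = rcons (nseq h true) true by rewrite -[in LHS]addn1 nseqD cats1.
by rewrite /top E eqseq_rcons; case: a; case: eqP => _; rewrite /= ?mul1r ?mul0r.
Qed.

Lemma spin_rcons n m w F x a : run n w = Some m -> size x = n ->
  spin w F (rcons x a) = spin w (fun y => F (rcons y a)) x.
Proof.
move=> rw sx; rewrite -cats1 /spin (ev_widen _ _ _ _ _ _ rw) //.
by apply: eq_ev => y; rewrite cats1.
Qed.

Lemma Yvec_lower n h s x a : s \in lower n h -> size x = n ->
  Yvec (h :: s) (rcons x a) = a%:R * Yvec s x.
Proof.
move=> sL sx; rewrite /Yvec (path_word_lower sL) [head _ (h :: s)]/=.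
have [_ -> sP] := lower_head sL; rewrite (spin_rcons _ _ (run_path_word sP)) //.
rewrite /spin -evZ; apply: eq_ev => y; exact: top_rcons.
Qed.

(** A last spin down forces the strand joined to it up, with weight [spin_cap true false = 1]; this
    normalizes the leading coefficient to 1. *)
Lemma Yvec_upper n h s x : s \in paths n h.+1 -> size x = n ->
  Yvec (h :: s) (rcons x false) = Yvec s x.
Proof.
move=> sU sx; have rs := run_path_word sU.
rewrite /Yvec (path_word_upper sU) [head _ (h :: s)]/= (paths_head sU).2 /spin ev_cat.
rewrite -/(spin _ _) (spin_rcons _ _ rs) //; apply: ev_eq rs _ _ sx => _ /rconsP[y [a [-> sy]]].
rewrite top_rcons -!cats1 -catA /= lay_cap // cats0.
by case: a; rewrite /= ?mul1r ?mul0r.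
Qed.

(** The last step of the path is the most significant binary digit. *)
Fixpoint rank (s : seq nat) : nat :=
  if s is y :: s' then
    ((if y == (head 0%N s').+1 then 2 ^ size s' else 0) + rank s')%N
  else 0%N.

Lemma rank_lt n h s : s \in paths n h -> (rank s < 2 ^ n)%N.
Proof.
elim: n h s => [|n IHn] h s; first by case: h => // /[!inE] /eqP ->.
move=> /mapP[r + ->]; rewrite mem_cat expnS => /orP[rL|rU] /=.
  by have [sr _ /IHn] := lower_head rL; rewrite sr; case: ifP; lia.
by have [sr _] := paths_head rU; have := IHn _ _ rU; rewrite sr; case: ifP; lia.
Qed.

(** An up step adds the same spin to [Yvec] and [zvec]. After a down step, the new terms given by
    [hw_extend] belong to paths ending with an up step, which have larger rank. *)
Lemma Yvec_zvec n h s : s \in paths n h -> exists c : seq nat -> Lam,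
  [/\ forall x, size x = n -> Yvec s x = \sum_(b <- paths n h) c b * zvec b x,
      c s = 1
    & forall b, b \in paths n h -> c b != 0 -> b = s \/ (rank s < rank b)%N].
Proof.
elim: n h s => [|n IHn] h s.
  case: h => // /[!inE] /eqP ->; exists (fun=> 1); split=> // [x /size0nil ->|b].
    by rewrite big_seq1 mul1r.
  by rewrite inE => /eqP -> _; left.
have headL b : b \in lower n h -> (head 0%N b == h.+1) = false.
  by move=> /lower_head[_ -> _]; rewrite ltn_eqF.
have headU b : b \in paths n h.+1 -> (head 0%N b == h.+1) by move=> /paths_head[_ ->].
move=> /mapP[r + ->]; rewrite mem_cat => /orP[rL|rU].
  have [_ eh rP] := lower_head rL; have [c [cE c1 cr]] := IHn _ _ rP.
  have lE : lower n h = paths n (head 0%N r) by rewrite eh.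
  exists (fun b => if head 0%N (behead b) == h.+1 then 0 else c (behead b)).
  rewrite [behead _]/= headL //; split=> //.
    move=> _ /rconsP[x [a [-> sx]]]; rewrite (Yvec_lower _ rL sx) cE // sum_paths.
    rewrite [X in _ + X]big1_seq ?addr0 => [|b /= bU]; last by rewrite headU ?mul0r.
    rewrite lE mulr_sumr big_seq [RHS]big_seq; apply: eq_bigr => b; rewrite -lE => bL.
    by rewrite [behead _]/= headL // (zvec_lower bL) add_up_rcons mulrCA.
  move=> b /mapP[b' + ->]; rewrite mem_cat => /orP[bL|bU] /=; last by rewrite headU ?eqxx.
  rewrite headL // => /cr; rewrite -lE => /(_ bL)[->|lt_r]; first by left.
  have [sb eb _] := lower_head bL; have [sr er _] := lower_head rL.
  by right; rewrite -eb -er !eqxx sb sr ltn_add2l.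
have [_ hr] := paths_head rU; have [c [cE c1 cr]] := IHn _ _ rU.
have rP : h :: r \in paths n.+1 h by rewrite pathsS map_f // mem_cat rU orbT.
have [S L] := span_lowest n.
have [|d dE] := hw_extend L S (hw_Yvec rP) (c := c).
  by move=> x sx; rewrite (Yvec_upper rU sx) cE.
exists (fun b => if head 0%N (behead b) == h.+1 then c (behead b) else d (behead b)).
rewrite [behead _]/= headU //; split=> //.
  move=> x sx; rewrite dE // sum_paths; congr (_ + _); rewrite big_seq [RHS]big_seq.
    by apply: eq_bigr => b bL; rewrite [behead _]/= headL.
  by apply: eq_bigr => b bU; rewrite [behead _]/= headU.
move=> b /mapP[b' + ->]; rewrite mem_cat => /orP[bL|bU] /=.
  move=> _; right; have [sb eb _] := lower_head bL; rewrite -eb eqxx sb hr ltn_eqF //.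
  by rewrite add0n ltn_addr // (rank_lt rU).
rewrite headU // => /(cr _ bU)[->|lt_r]; first by left.
by right; have [sb hb] := paths_head bU; rewrite hb hr ltn_eqF.
Qed.

(** The indices are not sorted by [r], hence the expansion over permutations: in a nonzero term the
    permutation never lowers [r] but preserves its sum, so it is the identity. *)
Lemma det_unitriangular (R : comNzRingType) m (M : 'M[R]_m) (r : 'I_m -> nat) :
  (forall i j, M i j != 0 -> i = j \/ (r i < r j)%N) -> (forall i, M i i = 1) ->
  \det M = 1.
Proof.
move=> Mr M1; rewrite /determinant (bigD1 (1%g : 'S_m)) //= odd_perm1 expr0 mul1r.
rewrite big1 ?mul1r => [|i _]; last by rewrite perm1.
rewrite big1 ?addr0 // => s s1.
have [/forallP nz|] := boolP [forall i, M i (s i) != 0]; last first.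
  by rewrite negb_forall => /existsP[i /negPn/eqP z]; rewrite (bigD1 i) //= z mul0r mulr0.
have le_r i : (r i <= r (s i))%N by have [<-|/ltnW] := Mr _ _ (nz i).
have [i si] : exists i, s i != i.
  apply/existsP; apply: contraR s1; rewrite negb_exists => /forallP sE.
  by apply/eqP/permP => i; rewrite perm1; apply/eqP; have := sE i; rewrite negbK.
have lt_r : (r i < r (s i))%N by have [e|] := Mr _ _ (nz i); [rewrite -e eqxx in si |].
have : (\sum_i r i = \sum_i r (s i))%N by exact: reindex_inj (@perm_inj _ s).
rewrite (bigD1 i) //= [RHS](bigD1 i) //= => eq_r.
have le_s : (\sum_(j | j != i) r j <= \sum_(j | j != i) r (s j))%N by apply: leq_sum.
by have := leq_add lt_r le_s; rewrite -eq_r addSn ltnn.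
Qed.

(** A minimum is [- qq] times a transposed maximum, so reflection is transposition up to one such
    factor per layer. The indicator of [x] extracts a column of [w]. *)
Lemma spin_flip_word n m w F x : cap_word w -> run n w = Some m -> size x = m ->
  spin (flip_word w) F x =
  (- qq) ^+ size w * dot n (spin w (fun z => (z == x)%:R)) F.
Proof.
elim: w n F => [|[y i] w IHw] n F.
  move=> _ [<-] sx; rewrite expr0 mul1r /dot (bigD1_seq x) ?uniq_configs ?mem_configs ?sx //=.
  by rewrite eqxx mul1r big1 ?addr0 // => z /negbTE ->; rewrite mul0r.
move=> /= /andP[/eqP /= -> cw]; rewrite /= addn0; case: ifP => // le_i rw sx.
rewrite -cat1s flip_word_cat /spin ev_cat -/(spin _ _) (IHw _ _ cw rw sx) exprSr -mulrA.
congr (_ * _); rewrite /spin; set W := ev _ _ _ _ w _; pose r := (n - 2 - i)%N.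
have [e1 e2] : n = (i + (2 + r))%N /\ (n - 2 = i + r)%N by rewrite /r; lia.
rewrite e2 e1.
rewrite /dot !sum_configsD mulr_sumr big_seq [RHS]big_seq; apply: eq_bigr => u.
rewrite mem_configs => /eqP su; rewrite sum_configsD exchange_big /= mulr_sumr.
apply: eq_bigr => v _; rewrite lay_cup // !big_cons big_nil !lay_cap //=.
by rewrite -/qq -/qi; ring: qqK.
Qed.

Lemma pair_Yvec n h s s' : s \in paths n h -> s' \in paths n h ->
  spin (flip_word (path_word s') ++ path_word s) (top h) (nseq h true) =
  (- qq) ^+ size (path_word s') * dot n (Yvec s) (Yvec s').
Proof.
move=> sP s'P; rewrite /spin ev_cat -/(spin _ _).
rewrite (spin_flip_word _ (cap_path_word s') (run_path_word s'P)) ?size_nseq // dotC.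
by rewrite /Yvec (paths_head sP).2 (paths_head s'P).2.
Qed.

Fixpoint step_norm (s : seq nat) : Lam :=
  if s is y :: s' then
    let p := head 0%N s' in
    step_norm s' * (if y == p.+1 then 1 else Delta p / Delta p.-1)
  else 1.

Lemma step_normE n h s : s \in paths n h ->
  (- qq) ^+ size (path_word s) * znorm s = step_norm s.
Proof.
elim: n h s => [|n IHn] h s.
  by case: h => // /[!inE] /eqP ->; rewrite mul1r.
move=> /mapP[r + ->]; rewrite mem_cat => /orP[rL|rU].
  rewrite (path_word_lower rL) (znorm_lower rL) /=.
  by have [_ -> /IHn ->] := lower_head rL; rewrite eqxx mulr1.
rewrite (path_word_upper rU) (znorm_upper rU) size_cat addn1 exprS mulrACA down_norm.
by rewrite (IHn _ _ rU) /= (paths_head rU).2 ltn_eqF // mulrC.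
Qed.

Lemma mem_paths m k s : (0 < m)%N -> (s \in paths m k) =
  [&& size s == m, last 0%N s == 1%N, head 0%N s == k & sorted adjacent s].
Proof.
case: m => // m _; elim: m k s => [|m IHm] k s.
  case: k => [|[|k]]; first by case: s => [|[|[|x]] []].
    rewrite /= inE; case: s => [|x [|y s]] //=; last by apply/negbTE/eqP => -[].
    by rewrite eqseq_cons !andbT andbb.
  by rewrite in_nil; case: s => [|x []] //=; case: eqP => // ->.
case: s => [|y s]; first by apply/negbTE/mapP => -[].
rewrite pathsS [size _]/= [head _ _]/= eqSS.
have -> : (y :: s \in [seq k :: r | r <- lower m.+1 k ++ paths m.+1 k.+1]) =
    (y == k) && ((s \in lower m.+1 k) || (s \in paths m.+1 k.+1)).
  rewrite -mem_cat; apply/mapP/andP => [[r rP [-> ->]]|[/eqP -> sP]]; first by rewrite eqxx.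
  by exists s.
have [->|] := eqVneq y k; last by rewrite /= !andbF.
rewrite [X in _ || X]IHm; case: s => [|x s]; first by case: k => [|k]; rewrite //= IHm.
rewrite [last _ (k :: _)]/= [sorted _ (k :: _)]/= {2}/adjacent.
case: k => [|k]; first by rewrite in_nil /= orbF.
rewrite [lower _ _]/= IHm /= !eqSS [k == x]eq_sym.
by case: (_ == m) => //=; case: (_ == 1%N) => //=; case: (x == k); case: (x == k.+2); case: path.
Qed.

Lemma paths_bound m k s : s \in paths m k -> all (fun y => y <= m)%N s.
Proof.
elim: m k s => [|m IHm] k s; first by case: k => // /[!inE] /eqP ->.
move=> sP; have le_k : (k <= m.+1)%N.
  by rewrite (run_cap_word (cap_path_word s) (run_path_word sP)) leq_addr.
move: sP => /mapP[r + ->] /=; rewrite le_k mem_cat => /orP[rL|rU].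
  by have [_ _ /IHm/allP rm] := lower_head rL; apply/allP => y /rm /leqW.
by have /allP rm := IHm _ _ rU; apply/allP => y /rm /leqW.
Qed.

Section PathMatrix.
Variables (n h : nat).
Hypothesis n_gt0 : (0 < n)%N.

Definition rpath (a : D n h) : seq nat := rev [seq val x | x <- val a].

Lemma rpath_inj : injective rpath.
Proof.
move=> a b /(congr1 rev); rewrite /rpath !revK => ab; apply/val_inj/val_inj.
exact: (inj_map val_inj) ab.
Qed.

Lemma sorted_adjacent_rev s : sorted adjacent (rev s) = sorted adjacent s.
Proof. by rewrite rev_sorted; apply: eq_sorted => x y; rewrite /adjacent orbC. Qed.

Lemma head_rev (s : seq nat) : head 0%N (rev s) = last 0%N s.
Proof. by case/lastP: s => // s x; rewrite rev_rcons last_rcons. Qed.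

Lemma last_rev (s : seq nat) : last 0%N (rev s) = head 0%N s.
Proof. by rewrite -head_rev revK. Qed.

Lemma rpath_mem a : rpath a \in paths n h.
Proof.
case: a => a aP; rewrite mem_paths // /rpath /= size_rev size_map size_tuple eqxx.
by rewrite last_rev head_rev sorted_adjacent_rev; exact: aP.
Qed.

Lemma rpath_onto s : s \in paths n h -> exists a, rpath a = s.
Proof.
move=> sP; have := sP; rewrite mem_paths // => /and4P[/eqP ss ls hs ads].
have st : size [seq (inord x : 'I_n.+1) | x <- rev s] == n by rewrite size_map size_rev ss.
pose t : n.-tuple 'I_n.+1 := Tuple st.
have tE : [seq val x | x <- t] = rev s.
  rewrite -map_comp -[RHS]map_id; apply/eq_in_map => x; rewrite mem_rev => xs /=.
  by rewrite inordK // ltnS; have /allP := paths_bound sP; apply.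
have tP : admissible h t.
  by rewrite /admissible tE head_rev last_rev sorted_adjacent_rev ls hs ads.
by exists (exist _ t tP); rewrite /rpath tE revK.
Qed.

Lemma perm_rpath : perm_eq [seq rpath a | a <- enum {: D n h}] (paths n h).
Proof.
apply: uniq_perm; rewrite ?uniq_paths ?(map_inj_uniq rpath_inj) ?enum_uniq // => s.
apply/mapP/idP => [[a _ ->]|/rpath_onto[a <-]]; first exact: rpath_mem.
by exists a; rewrite ?mem_enum.
Qed.

Lemma Bprime_word_rpath a : Bprime_word a = path_word (rpath a).
Proof.
rewrite /Bprime_word /rpath; have := rpath_mem a; rewrite mem_paths // /rpath.
rewrite sorted_adjacent_rev last_rev => /and4P[_ h1 _].
case: [seq val x | x <- val a] h1 => //= x s /eqP -> {x}.
elim/last_ind: s => [|s y IHs] //; rewrite -rcons_cons rev_rcons /= rcons_path head_rev.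
move=> /andP[ps ys]; rewrite -{}IHs //= [last _ _]/=.
have steps_rcons x r : steps_word x (rcons r y) = steps_word x r ++ steps_word (last x r) [:: y].
  by elim: r x => //= z r IHr x; rewrite IHr catA.
rewrite steps_rcons /= cats0; congr (_ ++ _); case: ifP => // ne; congr [:: (_, _)].
by move: ys; rewrite /adjacent ne /= => /eqP ->.
Qed.

Definition pair_mx : 'M[Lam]_#|D n h| := \matrix_(i, j)
  spin (flip_word (Bprime_word (enum_val j)) ++ Bprime_word (enum_val i)) (top h) (nseq h true).

Lemma sum_rpath (F : seq nat -> Lam) :
  \sum_(s <- paths n h) F s = \sum_(i < #|D n h|) F (rpath (enum_val i)).
Proof.
rewrite -(perm_big _ perm_rpath) big_map big_enum /=.
exact: big_enum_val.
Qed.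

Lemma prod_rpath (F : seq nat -> Lam) :
  \prod_(s <- paths n h) F s = \prod_(i < #|D n h|) F (rpath (enum_val i)).
Proof.
rewrite -(perm_big _ perm_rpath) big_map big_enum /=.
exact: big_enum_val.
Qed.

Lemma det_pair_mx : \det pair_mx = \prod_(s <- paths n h) step_norm s.
Proof.
pose p (i : 'I_#|D n h|) := rpath (enum_val i).
have pP i : p i \in paths n h by exact: rpath_mem.
pose c i := projT1 (cid (Yvec_zvec (pP i))).
have cP i := projT2 (cid (Yvec_zvec (pP i))).
pose T : 'M[Lam]_#|D n h| := \matrix_(i, j) c i (p j).
pose N : 'rV[Lam]_#|D n h| := \row_j step_norm (p j).
have p_inj i j : p i = p j -> i = j by move=> /rpath_inj/enum_val_inj.
have detT : \det T = 1.
  apply: (@det_unitriangular _ _ _ (fun i => rank (p i))) => [i j|i]; rewrite mxE.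
    by have [_ _ ci] := cP i; move=> /(ci _ (pP j))[/p_inj ->|]; [left | right].
  by have [_ ci _] := cP i.
suff -> : pair_mx = T *m diag_mx N *m T^T.
  rewrite !det_mulmx det_tr detT mul1r mulr1 det_diag prod_rpath.
  by apply: eq_bigr => i _; rewrite mxE.
apply/matrixP => i j; rewrite !mxE !Bprime_word_rpath (pair_Yvec (pP i) (pP j)).
have dotE : dot n (Yvec (p i)) (Yvec (p j)) = \sum_k c i (p k) * (c j (p k) * znorm (p k)).
  have [Yi _ _] := cP i; have [Yj _ _] := cP j.
  rewrite (eq_dot Yi (fun _ _ => erefl)) dot_suml sum_rpath; apply: eq_bigr => k _.
  congr (_ * _); rewrite dotC (eq_dot Yj (fun _ _ => erefl)) dot_suml sum_rpath.
  rewrite (bigD1 k) //= (dot_zvec (pP k) (pP k)) eqxx mul1r big1 ?addr0 // => l lk.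
  rewrite (dot_zvec (pP l) (pP k)) (_ : (_ == _) = false) ?mul0r ?mulr0 //.
  by apply: contraNF lk => /eqP/p_inj ->.
rewrite dotE mulr_sumr; apply: eq_bigr => k _.
(* All diagrams have equally many maxima, so the power of [- qq] from column [j] can be absorbed
   into the diagonal entry at [k]. *)
have sz l : size (path_word (p l)) = ((n - h)./2)%N.
  have := run_cap_word (cap_path_word (p l)) (run_path_word (pP l)) => ->.
  by rewrite addKn doubleK.
rewrite mul_mx_diag !mxE -/(p k) -(step_normE (pP k)) !sz; ring.
Qed.

End PathMatrix.

(** * Counting the steps of all paths *)

Lemma bin_halfS n a : bin_half n.+1 a.+2 = (bin_half n a.+2 + bin_half n a)%N.
Proof. by rewrite /bin_half /= negbK; case: odd => //=; rewrite binS. Qed.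

Lemma bin_half_large n a : (n.*2 < a)%N -> bin_half n a = 0%N.
Proof.
rewrite /bin_half; case: ifP => // ev lt_a; apply: bin_small.
by move: lt_a; rewrite -{1}(odd_double_half a) ev add0n ltn_double.
Qed.

(** The ballot numbers: the second term removes the walks that leave the half line. *)
Lemma size_paths n h :
  (size (paths n h))%:Z = (bin_half n (n + h))%:Z - (bin_half n (n + h + 2))%:Z.
Proof.
elim: n h => [|n IHn] h.
  case: h => [|h]; first by [].
  by rewrite /= !bin_half_large.
rewrite pathsS size_map size_cat PoszD IHn.
case: h => [|h] /=.
  case: n {IHn} => [|n]; first by [].
  have -> : bin_half n.+2 (n.+2 + 0) = (bin_half n.+1 n.+2 + bin_half n.+1 n)%N.
    by rewrite addn0 bin_halfS.
  have -> : bin_half n.+2 (n.+2 + 0 + 2) = (bin_half n.+1 (n + 4) + bin_half n.+1 n.+2)%N.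
    by rewrite addn0 addn2 bin_halfS addn4.
  (* At the wall [h = 0], the symmetry of binomials replaces the missing lower neighbour. *)
  have E : bin_half n.+1 n = bin_half n.+1 n.+2.
    rewrite /bin_half /= negbK; case: ifP => // on; rewrite -(bin_sub (n := n.+1) (m := n./2)).
      by congr 'C(_, _); move: (odd_double_half n); rewrite on; lia.
    by move: (odd_double_half n); rewrite on; lia.
  rewrite (_ : n.+1 + 1 = n.+2)%N; last lia; rewrite (_ : n.+2 + 2 = n + 4)%N; last lia.
  by rewrite E; lia.
rewrite IHn (_ : n.+1 + h.+1 = (n + h).+2)%N; last lia.
rewrite (_ : (n + h).+2 + 2 = (n + h + 2).+2)%N; last lia.
rewrite !bin_halfS (_ : n + h.+2 = (n + h).+2)%N; last lia.
rewrite (_ : (n + h).+2 + 2 = (n + h + 2).+2)%N; last lia.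
rewrite (_ : (n + h) + 2 = (n + h).+2)%N; last lia.
lia.
Qed.

(** Here and in [alpha_le] the minimum is resolved; [a] and [b] are passed with equations so that
    they can be given in the shape required by [bin_halfS]. *)
Lemma alpha_ge n h j a b : (j <= h)%N -> a = (n + h + 2)%N -> b = (n + h + 2 * j + 4)%N ->
  alpha n h j.+1 = (bin_half n a)%:Z - (bin_half n b)%:Z.
Proof.
move=> le_jh -> ->; rewrite /alpha /= (minn_idPl le_jh).
by congr (Posz _ - Posz _); congr bin_half; lia.
Qed.

Lemma alpha_le n h j a b : (h <= j)%N -> (a + h = n + 2 * j + 2)%N -> b = (n + h + 2 * j + 4)%N ->
  alpha n h j.+1 = (bin_half n a)%:Z - (bin_half n b)%:Z.
Proof.
move=> le_hj ea ->; rewrite /alpha /= (minn_idPr le_hj).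
by congr (Posz _ - Posz _); congr bin_half; lia.
Qed.

(** The recursion satisfied by the number of steps from [k] to [k - 1] over all paths: remove the
    last step, which itself counts when it descends from [h + 1]. *)
Lemma alphaS n h k : (0 < k)%N -> alpha n.+1 h k =
  (if h is h'.+1 then alpha n h' k else 0) + alpha n h.+1 k +
  (if k == h.+1 then (size (paths n h.+1))%:Z else 0).
Proof.
case: k => // j _; rewrite eqSS; have [lt_hj|lt_jh|->] := ltngtP j h.
- case: h lt_hj => // h le_jh; rewrite addr0.
  rewrite (@alpha_ge n.+1 h.+1 j (n + h + 2).+2 (n + h + 2 * j + 4).+2); try lia.
  rewrite (@alpha_ge n h j (n + h + 2) (n + h + 2 * j + 4)); try lia.
  rewrite (@alpha_ge n h.+2 j (n + h + 2).+2 (n + h + 2 * j + 4).+2); try lia.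
  by rewrite !bin_halfS; lia.
- rewrite addr0.
  have [d ej] : exists d, j = (h + d.+1)%N by exists (j - h.+1)%N; lia.
  rewrite (@alpha_le n.+1 h j (n + h + 2 * d + 3).+2 (n + h + 2 * j + 3).+2); try lia.
  rewrite (@alpha_le n h.+1 j (n + h + 2 * d + 3) (n + h + 2 * j + 3).+2); try lia.
  case: h lt_jh ej => [|h] lt_hj ej; last first.
    rewrite (@alpha_le n h j (n + h.+1 + 2 * d + 3).+2 (n + h.+1 + 2 * j + 3)); try lia.
    by rewrite !bin_halfS; lia.
  (* For [h = 0] the two inner binomials coincide and cancel, in agreement with the absent lower
     term. *)
  rewrite !bin_halfS add0r (_ : n + 0 + 2 * j + 3 = (n + 0 + 2 * d + 3).+2)%N; lia.
- rewrite size_paths.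
  rewrite (@alpha_ge n.+1 h h (n + h + 1).+2 (n + 3 * h + 3).+2); try lia.
  rewrite (@alpha_ge n h.+1 h (n + h + 1).+2 (n + 3 * h + 3).+2); try lia.
  rewrite (_ : n + h.+1 = n + h + 1)%N; last lia.
  rewrite (_ : n + h + 1 + 2 = (n + h + 1).+2)%N; last lia.
  case: h => [|h].
    by rewrite !bin_halfS (_ : n + 3 * 0 + 3 = (n + 0 + 1).+2)%N; lia.
  rewrite (@alpha_le n h h.+1 (n + h.+1 + 1).+2 (n + 3 * h.+1 + 3)); try lia.
  by rewrite !bin_halfS; lia.
Qed.

Lemma alpha0 h k : (0 < k)%N -> alpha 0 h k = 0.
Proof. by move=> k0; rewrite /alpha !bin_half_large //; lia. Qed.

Lemma alpha_large n h k : (n < k)%N -> alpha n h k = 0.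
Proof.
case: k => // k lt_nk; have [le_kh|lt_hk] := leqP k h.
  by rewrite (@alpha_ge n h k _ _ le_kh erefl erefl) !bin_half_large //; lia.
have ea : (n + 2 * k + 2 - h + h = n + 2 * k + 2)%N by lia.
by rewrite (@alpha_le n h k _ _ (ltnW lt_hk) ea erefl) !bin_half_large //; lia.
Qed.

Definition Delta_ratio (k : nat) : Lam := Delta k / Delta k.-1.

Lemma Delta_ratio_unit k : Delta_ratio k \is a GRing.unit.
Proof. by rewrite unitrM unitrV !Delta_unit. Qed.

(** The range [M] stays fixed during the induction on [n], so that the products combine factor by
    factor. *)
Lemma prod_step_norm M n h : (n <= M)%N ->
  \prod_(s <- paths n h) step_norm s = \prod_(k <- iota 1 M) Delta_ratio k ^ alpha n h k.
Proof.
elim: n h => [|n IHn] h le_nM.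
  rewrite [RHS]big1_seq => [|k]; last by rewrite mem_iota => /andP[_ /andP[k0 _]]; rewrite alpha0.
  by case: h => [|h]; rewrite /= ?big_nil ?big_seq1.
have upper : \prod_(s <- paths n h.+1) step_norm (h :: s) =
    \prod_(s <- paths n h.+1) step_norm s * Delta_ratio h.+1 ^+ size (paths n h.+1).
  transitivity (\prod_(s <- paths n h.+1) (step_norm s * Delta_ratio h.+1)).
    rewrite big_seq [RHS]big_seq; apply: eq_bigr => s /paths_head[_ hs] /=.
    by rewrite hs ltn_eqF.
  by rewrite big_split /= big_const_seq count_predT iter_mulr_1.
have low : \prod_(s <- lower n h) step_norm (h :: s) = \prod_(s <- lower n h) step_norm s.
  rewrite big_seq [RHS]big_seq; apply: eq_bigr => s /lower_head[_ -> _] /=.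
  by rewrite eqxx mulr1.
have last_factor : \prod_(k <- iota 1 M) Delta_ratio k ^
    (if k == h.+1 then (size (paths n h.+1))%:Z else 0)
    = Delta_ratio h.+1 ^+ size (paths n h.+1).
  have [hM|hM] := boolP (h.+1 \in iota 1 M).
    rewrite (bigD1_seq h.+1) ?iota_uniq //= eqxx big1 ?mulr1 // => k /negbTE -> //.
  rewrite big1_seq => [|k /andP[_ kM]]; last by case: eqP kM hM => // -> ->.
  (* Out of range, [h + 1] exceeds [M], a height which [n] steps cannot reach. *)
  have -> : paths n h.+1 = [::]; last by [].
  case e : (paths n h.+1) => [|s r] //; have sP : s \in paths n h.+1 by rewrite e mem_head.
  have := run_cap_word (cap_path_word s) (run_path_word sP).
  by move: hM; rewrite mem_iota; lia.
have lowE : \prod_(s <- lower n h) step_norm s =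
    \prod_(k <- iota 1 M) Delta_ratio k ^ (if h is h'.+1 then alpha n h' k else 0).
  case: h {upper low last_factor} => [|h] /=; last by apply: IHn; exact: ltnW.
  by rewrite big_nil big1.
rewrite prod_paths upper low lowE IHn ?(ltnW le_nM) // -last_factor mulrA -!big_split /=.
rewrite big_seq [RHS]big_seq; apply: eq_bigr => k; rewrite mem_iota => /andP[k0 _].
by rewrite alphaS // !exprzDr ?Delta_ratio_unit.
Qed.

(** * The two determinants *)

Local Open Scope classical_set_scope.
Local Open Scope ring_scope.

Section PairEntry.
Variables (n h : nat) (s t : tangle n h).
Hypotheses (planar_s : planar (tword s)) (planar_t : planar (tword t)).
Let w := flip_word (tword t) ++ tword s.
Let pairing := spin w (top h) (nseq h true).

Lemma spin_red_id c : red c w [::] -> pairing = delta ^+ c.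
Proof.
move=> r; rewrite /pairing /spin.
rewrite (red_ev _ _ spin_zigzag spin_zagzig _ r (run_flip_cat s t)) ?size_nseq //.
by rewrite spin_loop_value /= /top eqxx mulr1.
Qed.

(** A minimum always creates a down spin, where [top h] vanishes. *)
Lemma spin_red_cup c w' i : red c w (rcons w' (Cup, i)) -> pairing = 0.
Proof.
move=> r; have := red_run r (run_flip_cat s t); rewrite -cats1 => /run_catl[k rk].
rewrite /=; case: ifP => // le_i _; rewrite /pairing /spin.
rewrite (red_ev _ _ spin_zigzag spin_zagzig _ r (run_flip_cat s t)) ?size_nseq // -cats1 ev_cat.
suff -> : ev spin_cap spin_cup lamA lamA^-1 w'
    (ev spin_cap spin_cup lamA lamA^-1 [:: (Cup, i)] (top h))
    (nseq h true) = ev spin_cap spin_cup lamA lamA^-1 w' (fun=> 0) (nseq h true).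
  by rewrite ev0 mulr0.
apply: ev_eq rk _ _ (size_nseq _ _) => v sv /=.
have top0 y : false \in y -> top h y = 0.
  by rewrite /top; case: eqP => // ->; rewrite mem_nseq andbF.
rewrite -{1}(cat_take_drop i v) lay_cup ?size_takel; try lia.
by rewrite mul0r add0r !top0 ?mem_cat ?inE ?eqxx ?orbT // !mulr0 !addr0.
Qed.

Lemma pairing_entry :
  S_entry s t = delta ^+ h * pairing /\
  Defs.form (stack (jones_wenzl h) (cls s)) (stack (jones_wenzl h) (cls t)) = Delta h * pairing.
Proof.
have [c [r|[w' [i r]]]] := planar_endo (planar_flip_cat planar_s planar_t) (run_flip_cat s t).
  rewrite (S_entry_id planar_s planar_t r) (form_red_id r) (spin_red_id r).
  by rewrite exprD mulrC.
by rewrite (S_entry_cup planar_s planar_t r) (form_red_cup r) (spin_red_cup r) !mulr0.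
Qed.

End PairEntry.

Lemma planar_Bprime n h (a : D n h) : (0 < n)%N -> planar (tword (Bprime a)).
Proof.
move=> n0; rewrite [tword _]/= Bprime_word_rpath //.
by apply/allP => l /(allP (cap_path_word _)) cl; rewrite /planar_layer cl.
Qed.

Lemma Smx_pair n h : (0 < n)%N -> Smx n h = delta ^+ h *: pair_mx n h.
Proof.
move=> n0; apply/matrixP => i j; rewrite !mxE.
by have [-> _] := pairing_entry (planar_Bprime (enum_val i) n0) (planar_Bprime (enum_val j) n0).
Qed.

Lemma Bmx_pair n h : (0 < n)%N -> Bmx n h = Delta h *: pair_mx n h.
Proof.
move=> n0; apply/matrixP => i j; rewrite !mxE.
by have [_ <-] := pairing_entry (planar_Bprime (enum_val i) n0) (planar_Bprime (enum_val j) n0).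
Qed.

(** The product over all [k >= 1] is finite because [alpha] vanishes for [k > n]. *)
Lemma fsbig_Delta_ratio n h :
  \big[*%R/1]_(k \in [set k : nat | (1 <= k)%N]) (Delta k / Delta k.-1) ^ alpha n h k =
  \prod_(k <- iota 1 n) Delta_ratio k ^ alpha n h k.
Proof.
rewrite (@fsbigE _ _ _ _ _ (iota 1 n)) ?iota_uniq //=.
- rewrite big_seq_cond [RHS]big_seq; apply: eq_bigl => k.
  rewrite mem_iota; case: (leqP 1 k) => [k1|]; last by rewrite andFb.
  by rewrite (_ : k \in _) ?andbT //; apply/mem_set.
- by move=> k /=; rewrite mem_iota => /andP[].
- by move=> k /= k1; rewrite mem_iota => kn; rewrite alpha_large //; lia.
Qed.

Theorem theorem6p6 (n h : nat) (n_ge1 : (1 <= n)%N) :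
  \det (Smx n h) = (Delta 1 ^+ h / Delta h) ^+ #|D n h| * \det (Bmx n h)
  /\
  (Delta 1 ^+ h / Delta h) ^+ #|D n h| * \det (Bmx n h) =
    Delta 1 ^+ (h * #|D n h|) *
    \big[*%R/1]_(k \in [set k : nat | (1 <= k)%N])
      (Delta k / Delta k.-1) ^ alpha n h k.
Proof.
have detE : (Delta 1 ^+ h / Delta h) ^+ #|D n h| * \det (Bmx n h) =
    Delta 1 ^+ (h * #|D n h|) * \det (pair_mx n h).
  by rewrite Bmx_pair // detZ mulrA -exprMn divrK ?Delta_unit // exprM.
split; first by rewrite detE Smx_pair // detZ Delta1 exprM.
by rewrite detE fsbig_Delta_ratio det_pair_mx // (prod_step_norm h (leqnn n)).
Qed.
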